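(* For every $\gamma>0$ there exist constants $k_1,k_2>0$ and $n_0$, depending only on $\gamma$, such that for every $n\ge n_0$ and every simple graph $G$ with $n$ vertices in which every vertex has even degree and whose algebraic connectivity satisfies $\lambda_2(G)\ge \gamma n$, $$k_1\cdot \frac{2^{|EG|+\frac n2}\,\pi^{-\frac n2}}{\sqrt{t(G)}}\ \le\ EO(G)\ \le\ k_2\cdot \frac{2^{|EG|+\frac n2}\,\pi^{-\frac n2}}{\sqrt{t(G)}}.$$
   Context: A simple graph is an undirected graph without loops and multiple edges; $VG$ and $EG$ denote its vertex and edge sets. An Eulerian orientation of $G$ is an orientation of its edges such that at every vertex the number of incoming edges equals the number of outgoing edges; $EO(G)$ is the number of Eulerian orientations of $G$. $t(G)$ is the number of spanning trees of $G$. The Laplacian matrix $Q=Q(G)$ of a simple graph with vertices $v_1,\dots,v_n$ is the $n\times n$ matrix with $Q_{jj}=d_j$ (the degree of $v_j$), $Q_{jk}=-1$ if $\{v_j,v_k\}\in EG$, and $Q_{jk}=0$ otherwise. Its eigenvalues are $0=\lambda_1\le\lambda_2\le\dots\le\lambda_n$, and $\lambda_2=\lambda_2(G)$ is the algebraic connectivity of $G$. *)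

(* Defs.v *)
From HB Require Import structures.
From mathcomp Require Import all_boot all_order all_algebra.
From mathcomp Require Import polyrcf.
From mathcomp Require Import boolp reals exp trigo.

Set Implicit Arguments.
Unset Strict Implicit.
Unset Printing Implicit Defensive.

Import Order.TTheory GRing.Theory Num.Theory.
Local Open Scope ring_scope.

Record sgraph (T : finType) := SGraph {
  adj :> rel T;
  adj_sym : symmetric adj;
  adj_irrefl : irreflexive adj }.

Definition edges (T : finType) (G : sgraph T) : {set {set T}} :=
  [set [set p.1; p.2] | p : T * T & G p.1 p.2].

Definition degree (T : finType) (G : sgraph T) (x : T) : nat :=
  #|[set y | G x y]|.

(* A set of arcs, (x, y) standing for the edge {x, y} directed from x to y. *)
Definition orientation (T : finType) (G : sgraph T) (A : {set T * T}) : bool :=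
  [forall x, forall y,
    if G x y then ((x, y) \in A) (+) ((y, x) \in A) else (x, y) \notin A].

Definition balanced (T : finType) (A : {set T * T}) : bool :=
  [forall x, #|[set y | (y, x) \in A]| == #|[set y | (x, y) \in A]|].

Definition EO (T : finType) (G : sgraph T) : nat :=
  #|[set A : {set T * T} | orientation G A && balanced A]|.

Definition edge_rel (T : finType) (F : {set {set T}}) : rel T :=
  fun x y => [set x; y] \in F.

(* Closed walks of length at most 2 without repeated vertices are not cycles,
   whence the condition on size c. *)
Definition spanning_tree (T : finType) (G : sgraph T) (F : {set {set T}}) :
    Prop :=
  [/\ F \subset edges G,
      forall x y, connect (edge_rel F) x y
    & forall c : seq T, (2 < size c)%N -> ~ ucycle (edge_rel F) c].

Definition num_spanning_trees (T : finType) (G : sgraph T) : nat :=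
  #|[set F : {set {set T}} | `[< spanning_tree G F >]]|.

Definition laplacian (R : realType) (n : nat) (G : sgraph 'I_n) : 'M[R]_n :=
  \matrix_(j, k) if j == k then (degree G j)%:R else if G j k then -1 else 0.

(* rootsR lists the distinct real roots in increasing order, and each is
   repeated according to its multiplicity in the characteristic polynomial. *)
Definition eigenvalues (R : realType) (n : nat) (A : 'M[R]_n) : seq R :=
  flatten [seq nseq (mup x (char_poly A)) x | x <- rootsR (char_poly A)].

(* The second smallest eigenvalue lambda_2; positions are numbered from 0.
   The default value 0 only occurs for n <= 1. *)
Definition algebraic_connectivity (R : realType) (n : nat) (G : sgraph 'I_n) :
    R :=
  (eigenvalues (laplacian R G))`_1.

(* Main.v *)
(* Writing each edge factor as [exp(i(x_j - x_k)) + exp(- i(x_j - x_k))] and extracting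
   the coefficient of the balanced orientations by a discrete Fourier transform,
   EO(G) is 2^|EG| times the average of the product of [cos (x_j - x_k)] over the
   edges, where x ranges over a lattice of mesh [h = pi / (2L + 1)] in the torus
   (R / pi Z)^n with one coordinate pinned to 0.  As L grows this is a Riemann sum.

   Near the diagonal, [cos u <= exp (- u^2 / 2)] bounds the sum by the Gaussian one of
   the reduced Laplacian, which tends to [sqrt ((2 pi)^(n-1) / t(G))] by the matrix
   tree theorem.  Conversely [cos u >= exp (- u^2 / 2 - u^4)]; by Jensen's
   inequality it suffices that the Gaussian mean of the sum of [(x_j - x_k)^4] over the
   edges is O(1), which holds since the spectral gap makes each [x_j - x_k] of variance O(1 / n).

   Away from the diagonal, [|cos u| <= exp (- sin^2 u / 2)] and the spectral gap applied
   to [cos 2x] and [sin 2x] bound the product by [exp (- c S)], S being the sum of all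
   [sin^2 (x_j - x_k)].  Choose a centre c with small sum of [sin^2 (x_c - x_k)]: either that
   sum exceeds a constant, and the resulting product integral is exponentially small
   against n^-n, or only boundedly many points are far from c; each of them loses a factor
   [exp (- c n)] and, averaged over a window of width 1 / n, costs only a factor O(n)
   compared with the Gaussian sum. *)
Require Import Defs.
From HB Require Import structures.
From mathcomp Require Import all_boot all_order all_algebra.
From mathcomp Require Import fingroup perm.
From mathcomp Require Import polyrcf complex.
From mathcomp Require Import boolp reals sequences exp trigo.
From mathcomp Require Import ring lra zify.
From mathcomp Require all_classical all_reals all_analysis measurable_realfun.

Set Implicit Arguments.
Unset Strict Implicit.
Unset Printing Implicit Defensive.

Import Order.TTheory GRing.Theory Num.Theory.
Local Open Scope ring_scope.

(** * Spectral gap *)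

Section SpectralGap.

Variables (R : realType) (n : nat).
Local Notation C := R[i].
Local Notation toC := (@real_complex R).

(** The Fourier identity is exact once the mesh resolves every degree, so no multiple integral is
    formed: [L] is chosen after [G], as large as needed, and only the constants must depend on
    [gamma] alone. Gaussian sums in several variables reduce to the one-dimensional integral through
    Schur complements.

    The period is pi rather than 2 pi because even degrees make each difference of out-degree and
    in-degree even.

    Everything is measured against [v], the square root of (2 pi)^(n-1) / t(G). A configuration may
    be recentred at any vertex: squared sines and absolute cosines are invariant under rotation, and
    all reduced Laplacians have determinant t(G), so the Gaussian sum pinned at any vertex has the
    same limit [v]. Not knowing the centre costs a factor n, so each kind of bad configuration is
    shown to contribute O(v / n^2) per centre. The yardstick for exponential smallness is the crude
    bound t(G) <= n^(n-1). The total error O(v / n) then competes with a main term between two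
    constant multiples of [v], and absorbing it determines [n0]. *)

Lemma char_poly_conj (F : fieldType) (P A : 'M[F]_n) : P \in unitmx ->
  char_poly (invmx P *m A *m P) = char_poly A.
Proof.
move=> Pu; rewrite /char_poly /char_poly_mx.
have PVP : map_mx polyC (invmx P) *m map_mx polyC P = 1%:M.
  by rewrite -map_mxM mulVmx // map_mx1.
have -> : 'X%:M - map_mx polyC (invmx P *m A *m P)
    = map_mx polyC (invmx P) *m ('X%:M - map_mx polyC A) *m map_mx polyC P.
  by rewrite mulmxBr mulmxBl scalar_mxC -(mulmxA 'X%:M) PVP mulmx1 !map_mxM.
rewrite !det_mulmx mulrC mulrA -det_mulmx.
by rewrite -map_mxM mulmxV // map_mx1 det1 mul1r.
Qed.

(** Over the complex numbers the matrix is Hermitian, hence unitarily diagonalizable with a real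
    diagonal; the factorization of the characteristic polynomial is pulled back to the reals. *)
Lemma real_symmetric_spectral (A : 'M[R]_n) : A^T = A ->
  exists (P : 'M[C]_n) (d : 'I_n -> R),
    [/\ P \is unitarymx,
        map_mx toC A = invmx P *m diag_mx (\row_i toC (d i)) *m P
      & char_poly A = \prod_i ('X - (d i)%:P)].
Proof.
move=> sA; set B := map_mx toC A.
have hB : B \is hermsymmx.
  apply: realsym_hermsym.
    by apply/is_hermitianmxP; rewrite expr0 scale1r /B map_mx_id // map_trmx sA.
  by apply/mxOverP => i j; rewrite mxE; apply/complex_realP; exists (A i j).
have /orthomx_spectralP EB := hermitian_normalmx hB.
have /mxOverP rd := hermitian_spectral_diag_real hB.
exists (spectralmx B), (fun i => complex.Re (spectral_diag B 0 i)).
have dE : \row_i toC (complex.Re (spectral_diag B 0 i)) = spectral_diag B.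
  by apply/rowP => i; rewrite mxE; apply: RRe_real.
split; [exact: spectral_unitarymx | by rewrite dE |].
apply: (map_poly_inj toC).
rewrite map_char_poly -/B {1}EB char_poly_conj ?spectral_unit //.
rewrite char_poly_trig ?diag_mx_is_trig // rmorph_prod.
apply: eq_bigr => i _; rewrite !mxE eqxx mulr1n rmorphB /= map_polyX map_polyC /=.
by congr (_ - _%:P); rewrite -{1}dE mxE.
Qed.

Lemma pairwise_flatten_nseq (k : R -> nat) (r : seq R) : sorted <%R r ->
  pairwise <=%R (flatten [seq nseq (k x) x | x <- r]).
Proof.
rewrite lt_sorted_pairwise; elim: r => [|x r IH] //= /andP[xr /IH pr].
rewrite pairwise_cat pr andbT; apply/andP; split.
  apply/allrelP => a b /nseqP[-> _] /flattenP[_ /mapP[y yr ->] /nseqP[-> _]].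
  by move/allP: xr => /(_ _ yr) /ltW.
by elim: (k x) => //= j ->; rewrite andbT; apply/allP => y /nseqP[-> _].
Qed.

(** Links the list read off from roots and multiplicities with any spectral decomposition: in both,
    a number occurs as often as its multiplicity in the characteristic polynomial. *)
Lemma perm_eigenvalues (A : 'M[R]_n) (s : seq R) :
  char_poly A = \prod_(y <- s) ('X - y%:P) -> perm_eq (eigenvalues A) s.
Proof.
move=> pE; apply/allP => x _; apply/eqP => /=.
have p0 : char_poly A != 0 by rewrite monic_neq0 // char_poly_monic.
have urp : uniq (rootsR (char_poly A)).
  by apply: (@sorted_uniq _ <%R lt_trans ltxx); rewrite sorted_roots.
rewrite -(mu_prod_XsubC x s) -pE /eigenvalues count_flatten -map_comp.
have memr : (x \in rootsR (char_poly A)) = root (char_poly A) x.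
  by rewrite -roots_on_rootsR // in_itv.
transitivity (\sum_(y <- rootsR (char_poly A) | y == x) mup x (char_poly A))%N.
  rewrite sumnE big_map [RHS]big_mkcond; apply: eq_bigr => y _ /=.
  by rewrite count_nseq /=; case: eqP => [->|]; rewrite ?mul1n ?mul0n.
rewrite big_const_seq iter_addn_0 count_uniq_mem // memr.
by case: (boolP (root _ _)) => [|/mupNroot ->]; rewrite ?muln1 ?muln0.
Qed.

(** The list is sorted, so all its entries from position 1 on are at least [g]. The conclusion
    concerns indices, hence accounts for multiplicity. *)
Lemma eigenvalues_lt_unique (A : 'M[R]_n) (d : 'I_n -> R) (g : R) :
  char_poly A = \prod_i ('X - (d i)%:P) -> 0 < g -> g <= (eigenvalues A)`_1 ->
  forall i j, d i < g -> d j < g -> i = j.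
Proof.
move=> pE g0 gE.
have PE : perm_eq (eigenvalues A) [seq d i | i <- enum 'I_n].
  by apply: perm_eigenvalues; rewrite big_map big_enum.
have : (count (fun y => (y < g)%R) (eigenvalues A) <= 1)%N.
  have : pairwise <=%R (eigenvalues A).
    by apply: pairwise_flatten_nseq; rewrite sorted_roots.
  move: gE; case: (eigenvalues A) => [|x [|y t]] //=; first by case: (_ < _).
  move=> gy /andP[_ /andP[/allP yt _]].
  rewrite [y < g]ltNge gy /= add0n (@eq_in_count _ _ pred0) ?count_pred0 ?addn0.
    by case: (_ < _).
  by move=> z /yt yz /=; rewrite ltNge (le_trans gy yz).
rewrite (seq.permP PE) count_map -size_filter => sz i j di dj.
have : i \in [seq k <- enum 'I_n | preim d (fun y => y < g) k].
  by rewrite mem_filter /= di mem_enum.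
have : j \in [seq k <- enum 'I_n | preim d (fun y => y < g) k].
  by rewrite mem_filter /= dj mem_enum.
by case: [seq _ <- _ | _] sz => [|a [|]] //=; rewrite !inE => _ /eqP -> /eqP ->.
Qed.

(* A vector killed by [A] has only one nonzero spectral coordinate, that of the
   eigenvalue below [g]; being orthogonal to it means having coordinate 0. *)
Lemma rayleigh_orthogonal (A : 'M[R]_n) (u : 'rV[R]_n) (g : R) :
  A^T = A -> u *m A = 0 -> u != 0 -> 0 < g -> g <= (eigenvalues A)`_1 ->
  forall x : 'rV[R]_n, (x *m u^T) 0 0 = 0 ->
    g * (x *m x^T) 0 0 <= (x *m A *m x^T) 0 0.
Proof.
move=> sA uA u0 g0 gE x xu.
have [P [d [PU AE pE]]] := real_symmetric_spectral sA.
have Pu := unitarymx_unit PU.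
have uniq_d := eigenvalues_lt_unique pE g0 gE.
pose y (v : 'rV[R]_n) := map_mx toC v *m invmx P.
have dotE (v w : 'rV[R]_n) :
    toC ((v *m w^T) 0 0) = \sum_i y v 0 i * (y w 0 i)^*.
  have -> : toC ((v *m w^T) 0 0) = (y v *m (map_mx Num.conj (y w)^T)) 0 0.
    have -> : map_mx Num.conj (y w)^T = P *m map_mx toC w^T.
      rewrite /y invmx_unitary // trmx_mul map_mxM; congr (_ *m _); apply/matrixP => i j.
        by rewrite !mxE; exact: conjCK.
      by rewrite !mxE; apply/CrealP/complex_realP; exists (w j i).
    by rewrite /y mulmxA mulmxKV // -map_mxM [RHS]mxE.
  by rewrite [LHS]mxE; apply: eq_bigr => i _; rewrite !mxE.
have qE (v w : 'rV[R]_n) : toC ((v *m A *m w^T) 0 0) =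
    \sum_i toC (d i) * (y v 0 i * (y w 0 i)^*).
  rewrite dotE; apply: eq_bigr => i _.
  rewrite /y map_mxM AE !mulmxA mulmxK // mul_mx_diag !mxE mulrA.
  by congr (_ * _); rewrite mulrC.
have yu0 i : d i != 0 -> y u 0 i = 0.
  move=> di.
  have : y (u *m A) 0 i = 0 by rewrite uA /y map_mx0 mul0mx mxE.
  rewrite /y map_mxM AE !mulmxA mulmxK // mul_mx_diag !mxE.
  move/eqP; rewrite mulf_eq0 => /orP[/eqP //|].
  by rewrite -[0](rmorph0 toC) (inj_eq (@complexI R)) (negPf di).
have [i0 yui0] : exists i0, y u 0 i0 != 0.
  apply/existsP; apply: contraR u0; rewrite negb_exists => /forallP yu.
  have : y u = 0 by apply/rowP => i; rewrite [RHS]mxE; apply/eqP; have := yu i; rewrite negbK.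
  move/(congr1 (fun z => z *m P)); rewrite /y mulmxKV // mul0mx.
  rewrite -(map_mx0 toC) => /matrixP uE.
  by apply/eqP/rowP => i; apply: (@complexI R); have := uE 0 i; rewrite !mxE.
have di0 : d i0 = 0 by apply/eqP; apply: contraTT yui0 => /yu0 ->; rewrite eqxx.
have dg i : i != i0 -> g <= d i.
  by move=> ii0; rewrite leNgt; apply: contra ii0 => di; apply/eqP/uniq_d; rewrite ?di0.
have yx0 : y x 0 i0 = 0.
  move: (dotE x u); rewrite xu rmorph0 (bigD1 i0) //= big1 ?addr0; last first.
    by move=> i /dg di; rewrite yu0 ?conjC0 ?mulr0 // gt_eqF // (lt_le_trans g0).
  move/esym/eqP; rewrite mulf_eq0 conjC_eq0 (negPf yui0) orbF.
  by move/eqP.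
rewrite -lecR rmorphM /= dotE qE mulr_sumr; apply: ler_sum => i _.
have [->|/dg di] := eqVneq i i0; first by rewrite yx0 mul0r !mulr0.
by apply: ler_wpM2r; [exact: mul_conjC_ge0 | rewrite lecR].
Qed.

End SpectralGap.

(** * The spectral gap as an inequality between quadratic forms *)

Section LaplacianGap.

Variables (R : realType) (n : nat) (G : sgraph 'I_n).

(* Every edge is counted twice, once in each direction. *)
Definition edge_sum (e : 'I_n -> 'I_n -> R) : R := \sum_j \sum_(k | G j k) e j k.

Lemma edge_sum_sym (e : 'I_n -> 'I_n -> R) :
  edge_sum e = edge_sum (fun j k => e k j).
Proof.
rewrite /edge_sum [RHS](exchange_big_dep xpredT) //=.
by apply: eq_bigr => j _; apply: eq_bigl => k; rewrite adj_sym.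
Qed.

Lemma edge_sumD (e f : 'I_n -> 'I_n -> R) :
  edge_sum (fun j k => e j k + f j k) = edge_sum e + edge_sum f.
Proof. by rewrite /edge_sum -big_split; apply: eq_bigr => j _; rewrite big_split. Qed.

Lemma edge_sumZ c (e : 'I_n -> 'I_n -> R) :
  edge_sum (fun j k => c * e j k) = c * edge_sum e.
Proof. by rewrite /edge_sum mulr_sumr; apply: eq_bigr => j _; rewrite mulr_sumr. Qed.

Lemma eq_edge_sum (e f : 'I_n -> 'I_n -> R) : (forall j k, e j k = f j k) ->
  edge_sum e = edge_sum f.
Proof. by move=> ef; apply: eq_bigr => j _; apply: eq_bigr => k _. Qed.

Lemma laplacian_sym : (laplacian R G)^T = laplacian R G.
Proof.
by apply/matrixP => j k; rewrite !mxE eq_sym adj_sym; case: eqP => [->|].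
Qed.

Lemma laplacian_form (x : 'rV[R]_n) :
  2 * (x *m laplacian R G *m x^T) 0 0 = edge_sum (fun j k => (x 0 j - x 0 k) ^+ 2).
Proof.
have -> : (x *m laplacian R G *m x^T) 0 0 =
    edge_sum (fun j k => x 0 j * (x 0 j - x 0 k)).
  rewrite -mulmxA mxE.
  apply: eq_bigr => j _; rewrite -mulr_sumr; congr (_ * _).
  rewrite mxE (bigD1 j) //= mxE eqxx big_split /= sumr_const sumrN.
  rewrite (_ : #|_| = degree G j) ?mulr_natl; last by apply: eq_card => k; rewrite !inE.
  rewrite mxE; congr (_ + _); rewrite (bigID (fun k => G j k)) /= [X in _ + X]big1 ?addr0.
    rewrite -sumrN; apply: eq_big => k.
      by rewrite andbC; case: eqP => [->|] /=; rewrite ?adj_irrefl ?andbT.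
    by rewrite !mxE [j == k]eq_sym => /andP[/negPf -> ->]; rewrite mulN1r.
  by move=> k /andP[kj /negPf jk]; rewrite !mxE [j == k]eq_sym (negPf kj) jk mul0r.
rewrite mulr_natl mulr2n {2}edge_sum_sym -edge_sumD; apply: eq_edge_sum => j k.
by ring.
Qed.

Lemma mul_ones_laplacian : const_mx 1 *m laplacian R G = 0 :> 'rV_n.
Proof.
apply/rowP => j; rewrite !mxE (bigD1 j) //= !mxE eqxx mul1r.
rewrite (bigID (fun k => G j k)) /= [X in _ + (_ + X)]big1 ?addr0; last first.
  move=> k /andP[kj /negPf jk]; rewrite !mxE (negPf kj) adj_sym jk mulr0.
  by [].
rewrite (eq_bigr (fun=> -1)); last first.
  by move=> k /andP[kj jk]; rewrite !mxE (negPf kj) adj_sym jk mul1r.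
rewrite sumr_const (_ : #|_| = degree G j); first by rewrite mulNrn subrr.
apply: eq_card => k; rewrite !inE unfold_in andbC.
by case: eqP => [->|]; rewrite ?adj_irrefl ?andbT.
Qed.

(** Subtracting the mean makes [x] orthogonal to the constants, where the Rayleigh bound applies,
    and the double sum is [2 * n] times the squared norm of the centred vector. In this form, free
    of any orthogonality condition, algebraic connectivity enters all later estimates. *)
Lemma spectral_gap (gamma : R) : 0 < gamma ->
  gamma * n%:R <= algebraic_connectivity R G ->
  forall x : 'I_n -> R, gamma * (\sum_j \sum_k (x j - x k) ^+ 2)
    <= edge_sum (fun j k => (x j - x k) ^+ 2).
Proof.
move=> g0 gE x; have [n0|n_gt0] := posnP n.
  by rewrite /edge_sum !big1 ?mulr0 // => j; have := ltn_ord j; rewrite {2}n0.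
have nR : 0 < n%:R :> R by rewrite ltr0n.
pose m := (\sum_j x j) / n%:R; pose y := \row_j (x j - m).
have sumy : \sum_j y 0 j = 0.
  under eq_bigr do rewrite mxE.
  by rewrite sumrB sumr_const card_ord -[m *+ n]mulr_natl mulrC divfK ?subrr ?gt_eqF.
have y1 : (y *m (const_mx 1 : 'rV[R]_n)^T) 0 0 = 0.
  by rewrite mxE -[RHS]sumy; apply: eq_bigr => j _; rewrite !mxE mulr1.
have u0 : const_mx 1 != 0 :> 'rV[R]_n.
  apply/eqP => /rowP /(_ (Ordinal n_gt0)); rewrite !mxE => /eqP.
  by rewrite oner_eq0.
have := rayleigh_orthogonal laplacian_sym mul_ones_laplacian u0
  (mulr_gt0 g0 nR) gE y1.
have -> : edge_sum (fun j k => (x j - x k) ^+ 2) =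
    2 * (y *m laplacian R G *m y^T) 0 0.
  by rewrite laplacian_form; apply: eq_edge_sum => j k; rewrite !mxE; congr (_ ^+ 2); ring.
have -> : \sum_j \sum_k (x j - x k) ^+ 2 = 2 * n%:R * (y *m y^T) 0 0.
  rewrite [(y *m _) 0 0]mxE.
  transitivity (\sum_j \sum_k ((y 0 j) ^+ 2 + (y 0 k) ^+ 2 - 2 * y 0 j * y 0 k)).
    by apply: eq_bigr => j _; apply: eq_bigr => k _; rewrite !mxE; ring.
  transitivity (\sum_j (n%:R * (y 0 j) ^+ 2 + \sum_k (y 0 k) ^+ 2)).
    apply: eq_bigr => j _; rewrite sumrB big_split /= sumr_const card_ord.
    by rewrite -mulr_sumr sumy mulr0 subr0 mulr_natl.
  rewrite big_split /= sumr_const card_ord -mulr_sumr.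
  rewrite -[X in _ + X]mulr_natl -mulrDl -mulr2n; congr (_ * _); first by ring.
  by apply: eq_bigr => k _; rewrite !mxE expr2.
move=> h; rewrite [leLHS](_ : _ = 2 * (gamma * n%:R * (y *m y^T) 0 0)).
  by rewrite ler_pM2l.
by ring.
Qed.

End LaplacianGap.

(** * Matrix tree theorem *)

Lemma det_sum_rows (R : comNzRingType) (m : nat) (K : finType) (P : 'I_m -> pred K)
    (a : 'I_m -> K -> 'I_m -> R) :
  \det (\matrix_(i, j) \sum_(k | P i k) a i k j) =
  \sum_(f : {ffun 'I_m -> K} | f \in family P) \det (\matrix_(i, j) a i (f i) j).
Proof.
rewrite /determinant exchange_big /=; apply: eq_bigr => s _.
rewrite -mulr_sumr; congr (_ * _).
under eq_bigr do rewrite mxE.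
by rewrite bigA_distr_big_dep; apply: eq_bigr => f _; apply: eq_bigr => i _; rewrite mxE.
Qed.

Lemma set2_inj (T : finType) (a b x y : T) :
  [set a; b] = [set x; y] -> (a = x /\ b = y) \/ (a = y /\ b = x).
Proof.
move=> E; have : a \in [set x; y] by rewrite -E set21.
have : b \in [set x; y] by rewrite -E set22.
have : x \in [set a; b] by rewrite E set21.
have : y \in [set a; b] by rewrite E set22.
rewrite !inE => /orP[]/eqP ? /orP[]/eqP ? /orP[]/eqP ? /orP[]/eqP ?; subst; auto.
Qed.

Lemma edge_rel_sym (T : finType) (F : {set {set T}}) : symmetric (edge_rel F).
Proof. by move=> x y; rewrite /edge_rel setUC. Qed.

Lemma edges_adj (T : finType) (G : sgraph T) (x y : T) :
  ([set x; y] \in edges G) = G x y.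
Proof.
apply/imsetP/idP => [[[a b]] /= | gxy]; last by exists (x, y); rewrite ?inE.
by rewrite inE /= => gab /set2_inj [[-> ->]|[-> ->]] //; rewrite adj_sym.
Qed.

Section MatrixTree.

Variables (m : nat) (G : sgraph 'I_m.+1) (c : 'I_m.+1).

Implicit Types f g : {ffun 'I_m -> 'I_m.+1}.

Definition parent_fun f := [forall i, G (lift c i) (f i)].

(** A rank decreasing along [f] says that iterating [f] from any vertex ends at [c], and it serves
    as the measure of the inductions below. *)
Definition rooted f : Prop :=
  exists d : 'I_m.+1 -> nat, forall i, (d (f i) < d (lift c i))%N.

Definition parent_edges f : {set {set 'I_m.+1}} := [set [set lift c i; f i] | i : 'I_m].

(** A permutation with a nonzero contribution fixes each vertex or sends it to its parent, so it
    never raises the rank; since it preserves the sum of all ranks, it is the identity. *)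
Lemma det_rooted (R : comNzRingType) f : rooted f ->
  \det (\matrix_(i, j) ((i == j)%:R - (f i == lift c j)%:R) : 'M[R]_m) = 1.
Proof.
case=> d dP; rewrite /determinant (bigD1 (1%g : {perm 'I_m})) //= [X in _ + X]big1 ?addr0 => [|s s1].
  rewrite odd_perm1 expr0 mul1r big1 // => i _; rewrite mxE perm1 eqxx.
  case: eqP => [fi|_]; last by rewrite subr0.
  by have := dP i; rewrite fi ltnn.
have [] := boolP [forall i : 'I_m, (s i == i) || (f i == lift c (s i))]; last first.
  move=> /forallPn[ i]; rewrite negb_or => /andP[si fi].
  by rewrite (bigD1 i) //= mxE eq_sym (negPf si) (negPf fi) subr0 mul0r mulr0.
move/forallP=> sP; case/eqP: s1; apply/permP => i; rewrite perm1.
have le_d j : (d (lift c (s j)) <= d (lift c j) ?= iff (s j == j))%N.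
  apply/leqifP; case: ifP => [/eqP ->|sj] //.
  by have := sP j; rewrite sj /= => /eqP <-.
have /leqif_sum : forall j, true -> (d (lift c (s j)) <= d (lift c j) ?= iff (s j == j))%N by [].
case=> _; rewrite [X in _ == X](reindex_inj (@perm_inj _ s)) /=.
by rewrite eqxx => /esym/forallP /(_ i) /eqP.
Qed.

(** The indicator of the vertices from which iterating [f] never reaches [c] lies in the kernel,
    because a vertex belongs to this set exactly when its parent does. *)
Lemma det_not_rooted (R : fieldType) f : ~ rooted f ->
  \det (\matrix_(i, j) ((i == j)%:R - (f i == lift c j)%:R) : 'M[R]_m) = 0.
Proof.
move=> nr; pose nx v := if unlift c v is Some i then f i else c.
have nxl i : nx (lift c i) = f i by rewrite /nx liftK.
have nxc : nx c = c by rewrite /nx unlift_none.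
pose good v := `[< exists k, iter k nx v == c >].
have goodf i : good (lift c i) = good (f i).
  apply/asboolP/asboolP => -[k kP]; last by exists k.+1; rewrite iterSr nxl.
  case: k kP => [|k]; last by rewrite iterSr nxl; exists k.
  by rewrite /= eq_sym (negPf (neq_lift c i)).
have [gd|] := boolP [forall v, good v].
  case: nr; move/forallP: gd => gd.
  have ex v : exists k, iter k nx v == c by apply/asboolP; exact: gd.
  exists (fun v => ex_minn (ex v)) => i.
  case: ex_minnP => k kP kmin; case: ex_minnP => -[|l] lP lmin.
    by move: lP; rewrite /= eq_sym (negPf (neq_lift c i)).
  by rewrite ltnS kmin // -nxl -iterSr.
rewrite negb_forall => /existsP[v nv].
apply/eqP; rewrite -det_tr; apply/det0P.
exists (\row_i (~~ good (lift c i))%:R).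
  case: (unliftP c v) nv => [i ->|->] nv.
    by apply/eqP => /rowP /(_ i); rewrite !mxE nv => /eqP; rewrite oner_eq0.
  by case/negP: nv; apply/asboolP; exists 0%N.
apply/rowP => i; rewrite !mxE.
under eq_bigr do rewrite !mxE mulrBr.
rewrite sumrB (bigD1 i) //= eqxx mulr1 big1 ?addr0; last first.
  by move=> j ji; rewrite eq_sym (negPf ji) mulr0.
rewrite goodf; case: (unliftP c (f i)) => [j ->|->].
  rewrite (bigD1 j) //= eqxx mulr1 big1 ?addr0 ?subrr // => k kj.
  by rewrite (inj_eq lift_inj) eq_sym (negPf kj) mulr0.
rewrite big1 ?subr0; last by move=> k _; rewrite (negPf (neq_lift c k)) mulr0.
by rewrite (_ : good c) //; apply/asboolP; exists 0%N.
Qed.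

(** Row [i] is the sum of [e_i - e_k] over the neighbours [k], with [e_c = 0]. Expanding all rows by
    multilinearity gives a sum over parent functions of determinants equal to 1 or 0. *)
Lemma reduced_laplacian_rooted (R : realType) :
  \det (row' c (col' c (laplacian R G))) =
  #|[set f | parent_fun f && `[< rooted f >]]|%:R.
Proof.
pose a i k j : R := (i == j)%:R - (k == lift c j)%:R.
have -> : row' c (col' c (laplacian R G)) =
    \matrix_(i, j) \sum_(k | G (lift c i) k) a i k j.
  apply/matrixP => i j; rewrite !mxE (inj_eq lift_inj) sumrB sumr_const.
  have [<-|ij] := eqVneq i j.
    rewrite [X in _ - X]big1 ?subr0 => [|k gk].
      by congr (_ *+ _); apply: eq_card => k; rewrite inE.
    by have [kE|//] := eqVneq k (lift c i); rewrite kE adj_irrefl in gk.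
  rewrite mul0rn sub0r; case: ifP => gij; last first.
    by rewrite big1 ?oppr0 // => k gk; have [kE|//] := eqVneq k (lift c j); rewrite kE gij in gk.
  by rewrite (bigD1 (lift c j)) //= eqxx big1 ?addr0 // => k /andP[_ /negPf ->].
rewrite det_sum_rows -sum1_card natr_sum.
rewrite [LHS](bigID (fun f : {ffun _} => `[< rooted f >])) /= [X in _ + X]big1 ?addr0; last first.
  by move=> f /andP[_ /asboolPn nr]; exact: det_not_rooted.
apply: eq_big => [f|f /andP[_ /asboolP]]; last exact: det_rooted.
by rewrite [RHS]inE; congr andb; apply/familyP/forallP.
Qed.

Lemma parent_edges_connected f : rooted f ->
  forall x y, connect (edge_rel (parent_edges f)) x y.
Proof.
case=> d dP; have toc v : connect (edge_rel (parent_edges f)) v c.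
  have [k] := ubnP (d v); elim: k v => // k IH v.
  case: (unliftP c v) => [i ->|-> _]; last exact: connect0.
  rewrite ltnS => dk; apply: connect_trans (IH (f i) _); last exact: leq_trans (dP i) dk.
  by apply: connect1; apply/imsetP; exists i.
by move=> x y; apply: connect_trans (toc x) _; rewrite (sym_connect_sym (edge_rel_sym _)).
Qed.

Lemma next_neq_prev (T : eqType) (p : seq T) x : uniq p -> (2 < size p)%N ->
  x \in p -> next p x != prev p x.
Proof.
move=> up sp xp; apply/eqP => E.
have : next p (next p x) = x by rewrite E next_prev.
case: (rot_to xp) => i q Eq.
rewrite -!(next_rot i up) Eq.
have : uniq (x :: q) by rewrite -Eq rot_uniq.
have : (2 < size (x :: q))%N by rewrite -Eq size_rot.
case: q {Eq} => [|a [|b q]] //= _; rewrite !inE !negb_or eqxx.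
move=> /andP[/and3P[xa xb _] /andP[/andP[ab _] _]].
by rewrite eq_sym (negPf xa) eqxx => bx; rewrite bx eqxx in xb.
Qed.

(** At a vertex of maximal rank on the cycle, both cycle neighbours would have to be its parent, yet
    they differ when the length exceeds 2. *)
Lemma parent_edges_acyclic f : rooted f ->
  forall p : seq 'I_m.+1, (2 < size p)%N -> ~ ucycle (edge_rel (parent_edges f)) p.
Proof.
case=> d dP p sp /andP[cp up].
have [x xp xmax] : exists2 x, x \in p & forall y, y \in p -> (d y <= d x)%N.
  case: p sp {cp up} => // x0 p _.
  case: (@arg_maxnP _ x0 (fun x => x \in x0 :: p) d (mem_head _ _)) => x xp xmax.
  by exists x.
have nb y : y \in p -> edge_rel (parent_edges f) x y -> exists2 i, x = lift c i & y = f i.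
  move=> yp /imsetP[i _ /set2_inj [[]|[]]] xE yE; first by exists i.
  by have := dP i; rewrite -xE -yE ltnNge xmax.
have [i xi yi] : exists2 i, x = lift c i & next p x = f i.
  by apply: nb; [rewrite mem_next | exact: next_cycle cp xp].
have [j xj yj] : exists2 i, x = lift c i & prev p x = f i.
  by apply: nb; [rewrite mem_prev | rewrite edge_rel_sym; exact: prev_cycle cp xp].
have := next_neq_prev up sp xp; rewrite yi yj.
by move: xj; rewrite xi => /lift_inj ->; rewrite eqxx.
Qed.

(** Induction on the rank for [f]. If the parent edge of a vertex occurred in [g] with the opposite
    direction, then by induction the vertex would be, also for [f], the parent of its own parent,
    against the decrease of the rank. *)
Lemma parent_edges_inj f g : rooted f -> rooted g -> parent_edges f = parent_edges g -> f = g.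
Proof.
case=> d dP _ fg; apply/ffunP => i; have [k] := ubnP (d (lift c i)).
elim: k i => // k IH i; rewrite ltnS => dk.
have : [set lift c i; f i] \in parent_edges g by rewrite -fg; apply/imsetP; exists i.
case/imsetP => j _ /set2_inj [[/lift_inj -> ->] //|[gj fj]].
have := IH j; rewrite -fj => /(_ (leq_trans (dP i) dk)) fgj.
by have := dP j; rewrite fgj -gj -fj ltnNge ltnW // dP.
Qed.

(** The parent of a vertex is a neighbour closer to [c] inside [F]. An edge of [F] outside the
    parent edges would close a cycle with the path of parent edges joining its ends. *)
Lemma spanning_tree_rooted F : spanning_tree G F ->
  exists2 f, parent_fun f /\ rooted f & parent_edges f = F.
Proof.
case=> /subsetP FG Fc Fa.
have exd v : exists k, [exists p : k.-tuple 'I_m.+1, path (edge_rel F) v p && (last v p == c)].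
  have /connectP[p pp ->] := Fc v c.
  by exists (size p); apply/existsP; exists (in_tuple p); rewrite pp eqxx.
pose d v := ex_minn (exd v).
have exf i : exists y, edge_rel F (lift c i) y && (d y < d (lift c i))%N.
  rewrite [d (lift c i)]/d; case: ex_minnP => k /existsP[[p sp] /= /andP[pp lp]] _.
  case: p sp pp lp => [|y p] sp /=; first by rewrite eq_sym (negPf (neq_lift c i)).
  move=> /andP[ey pp] lp; exists y; rewrite ey /= -(eqP sp) /= ltnS /d.
  case: ex_minnP => l _ lmin; apply: lmin; apply/existsP; exists (in_tuple p).
  by rewrite pp.
pose f := [ffun i => xchoose (exf i)].
have fP i : edge_rel F (lift c i) (f i) && (d (f i) < d (lift c i))%N.
  by rewrite ffunE; apply: (xchooseP (exf i)).
have rf : rooted f by exists d => i; case/andP: (fP i).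
exists f; first split=> //.
  by apply/forallP => i; case/andP: (fP i) => /FG; rewrite edges_adj.
have sub x y : edge_rel (parent_edges f) x y -> edge_rel F x y.
  by case/imsetP => i _; rewrite /edge_rel => ->; case/andP: (fP i).
apply/eqP; rewrite eqEsubset; apply/andP; split; apply/subsetP => e.
  by case/imsetP => i _ ->; case/andP: (fP i).
move=> eF; have /imsetP[[x y]] := FG _ eF; rewrite inE /= => gxy eE.
apply: contraT => ne; exfalso.
have /connectP[p pp lp] := parent_edges_connected rf x y.
case: (shortenP pp) lp => q pq uq _ lq.
have sq : (2 < size (x :: q))%N.
  case: q pq uq lq => [|a [|b q]] //=; first by move=> _ _ yx; rewrite yx adj_irrefl in gxy.
  by move=> /andP[xa _] _ ya; move: xa; rewrite -ya /edge_rel -eE (negPf ne).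
apply: (Fa (x :: q) sq); rewrite /ucycle uq andbT /= rcons_path.
apply/andP; split; first by apply: sub_path pq; exact: sub.
by rewrite -lq edge_rel_sym /edge_rel -eE.
Qed.

Lemma card_rooted : #|[set f | parent_fun f && `[< rooted f >]]| = num_spanning_trees G.
Proof.
have inj : {in [set f | parent_fun f && `[< rooted f >]] &, injective parent_edges}.
  move=> f g; rewrite !inE => /andP[_ /asboolP rf] /andP[_ /asboolP rg].
  exact: parent_edges_inj.
rewrite -(card_in_imset inj) /num_spanning_trees; congr #|pred_of_set _|.
apply/setP => F; rewrite inE; apply/imsetP/asboolP => [[f]|sF]; last first.
  have [f [pf rf] <-] := spanning_tree_rooted sF.
  by exists f; rewrite ?inE ?pf //; apply/asboolP.
rewrite inE => /andP[/forallP pf /asboolP rf ->]; split.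
- apply/subsetP => e /imsetP[i _ ->]; rewrite edges_adj; exact: pf.
- exact: parent_edges_connected.
- exact: parent_edges_acyclic.
Qed.

Lemma matrix_tree (R : realType) :
  \det (row' c (col' c (laplacian R G))) = (num_spanning_trees G)%:R.
Proof. by rewrite reduced_laplacian_rooted card_rooted. Qed.

(** Weaker than Cayley's formula by one factor [m.+1], but enough to bound the Gaussian volume from
    below. *)
Lemma num_spanning_trees_le : (num_spanning_trees G <= m.+1 ^ m)%N.
Proof.
rewrite -card_rooted; apply: leq_trans (max_card _) _.
by rewrite card_ffun !card_ord.
Qed.

End MatrixTree.

(** * Gaussian lattice sums *)

Module GaussIntegral.

Import all_classical all_reals all_analysis measurable_realfun.
Import numFieldNormedType.Exports.
Local Open Scope classical_set_scope.
Local Open Scope ring_scope.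

(** Keeps of the Lebesgue integral just what Riemann sums require: comparison on short intervals,
    the total mass as an upper bound, and its approximation on long intervals. *)
Lemma gauss_primitive (R : realType) : exists H : R -> R,
  [/\ forall s t lo hi, s <= t ->
        (forall y, s <= y <= t -> lo <= expR (- y ^+ 2) <= hi) ->
        lo * (t - s) <= H t - H s <= hi * (t - s),
      forall s t, s <= t -> H t - H s <= Num.sqrt pi
    & forall e, 0 < e -> exists2 B, 0 < B &
        forall s t, s <= - B -> B <= t -> Num.sqrt pi - e <= H t - H s].
Proof.
pose mu := @lebesgue_measure R.
pose g := @gauss_fun R.
have ig : mu.-integrable [set: R] (EFin \o g) by exact: integrableT_gauss.
have igD (D : set R) : measurable D -> mu.-integrable D (EFin \o g).
  by move=> mD; apply: integrableS ig.
have icst (s t c : R) : mu.-integrable `]s, t] (EFin \o cst c).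
  apply: (@integrableS _ _ _ mu `[s, t]) => //; first exact: subset_itv_oc_cc.
  apply: continuous_compact_integrable; first exact: segment_compact.
  by apply: continuous_subspaceT => z; exact: cvg_cst.
pose H x := (\int[mu]_(t in `]-oo, x]) g t)%R.
have HB s t : s <= t -> H t - H s = (\int[mu]_(x in `]s, t]) g x)%R.
  move=> st; rewrite /H Rintegral_itvB //; exact: igD.
have bd s t lo hi : s <= t ->
    (forall y, s <= y <= t -> lo <= expR (- y ^+ 2) <= hi) ->
    lo * (t - s) <= H t - H s <= hi * (t - s).
  move=> st b; rewrite HB //.
  have ms : fine (mu `]s, t]%classic) = t - s.
    rewrite /mu lebesgue_measure_itv /= lte_fin.
    move: st; rewrite le_eqVlt => /predU1P[->|st]; first by rewrite ltxx subrr.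
    by rewrite st.
  have cE (c : R) : c * (t - s) = (\int[mu]_(x in `]s, t]) cst c x)%R.
    by rewrite Rintegral_cst // ms.
  rewrite !cE; apply/andP; split; apply: le_Rintegral => //; try exact: igD.
    by move=> y /=; rewrite in_itv /= => /andP[sy yt]; have := b y; rewrite (ltW sy) yt => /(_ isT) /andP[].
  by move=> y /=; rewrite in_itv /= => /andP[sy yt]; have := b y; rewrite (ltW sy) yt => /(_ isT) /andP[].
have mono s t : s <= t -> H s <= H t.
  move=> st; rewrite -subr_ge0 HB //; apply: Rintegral_ge0 => y _.
  exact: gauss_fun_ge0.
exists H; split=> // [s t st|e e0].
  rewrite HB // /Rintegral -[leRHS]/(fine (Num.sqrt pi)%:E) -integralT_gauss.
  apply: fine_le; [exact: integrable_fin_num (igD _ _) | exact: integrable_fin_num ig |].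
  apply: ge0_subset_integral => //; first by apply/measurable_EFinP; exact: measurable_gauss_fun.
  by move=> x _; rewrite lee_fin gauss_fun_ge0.
pose D n : set (measurableTypeR R) := [set` `]- n%:R, n%:R]].
have cv : (\int[mu]_(x in D n) (g x)%:E)%E @[n --> \oo] --> (Num.sqrt pi)%:E.
  rewrite -integralT_gauss.
  have -> : [set: R] = \bigcup_n D n.
    apply/esym/seteqP; split=> // x _.
    exists (Num.truncn `|x|).+1 => //; rewrite /D /= in_itv /=.
    have := truncnS_gt `|x|; rewrite ltr_norml => /andP[-> /ltW].
    by [].
  apply: ge0_nondecreasing_set_cvg_integral => //.
  - apply/nondecreasing_seqP => n; apply/subsetPset => x.
    rewrite /D /= !in_itv /= => /andP[a b]; apply/andP; split.
      by apply: le_lt_trans a; rewrite lerN2 ler_nat.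
    by apply: le_trans b _; rewrite ler_nat.
  - by move=> n; exact: measurable_itv.
  - by move=> n; apply/measurable_EFinP/measurable_funTS; exact: measurable_gauss_fun.
  - by move=> n x _; rewrite lee_fin gauss_fun_ge0.
have /fine_cvgP[_ cvf] := cv.
have := @cvgr_gt _ _ _ _ _ _ cvf (Num.sqrt pi - e).
rewrite /= ltrBlDr ltrDl => /(_ _ e0) [N _ hN].
have {hN} := hN N.+1; rewrite /= leqnSn => /(_ isT) hN.
exists N.+1%:R => // s t sN Nt.
have HN : H N.+1%:R - H (- N.+1%:R) = fine (\int[mu]_(x in D N.+1) (g x)%:E)%E.
  by rewrite HB //; apply: le_trans (_ : _ <= 0) _ => //; rewrite oppr_le0.
apply: le_trans (ltW hN) _; rewrite -HN.
by apply: lerB; exact: mono.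
Qed.

End GaussIntegral.

(** * Riemann sums of the one-dimensional Gaussian *)

Section GaussSum.

Variable R : realType.
Implicit Types (h a b s t y : R) (L m : nat).

(* A Riemann sum of a unimodal function differs from the integral by at most the
   mesh times the total variation; [V] is the variation function. *)
Lemma gauss_riemann : exists2 H : R -> R,
    (forall s t, s <= t -> H t - H s <= Num.sqrt pi) /\
    (forall e, 0 < e -> exists2 B, 0 < B &
        forall s t, s <= - B -> B <= t -> Num.sqrt pi - e <= H t - H s)
  & forall h y N, 0 < h ->
      `|\sum_(k < N) h * expR (- (y + k%:R * h) ^+ 2) - (H (y + N%:R * h) - H y)| <= 2 * h.
Proof.
have [H [bd Hu Hl]] := GaussIntegral.gauss_primitive R; exists H => // h y N h0.
pose g z : R := expR (- z ^+ 2).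
have g0 z : 0 <= g z by exact: expR_ge0.
have g1 z : g z <= 1 by rewrite -expR0 ler_expR oppr_le0 sqr_ge0.
have gdec s t : 0 <= s -> s <= t -> g t <= g s.
  by move=> s0 st; rewrite ler_expR lerN2 lerXn2r // nnegrE (le_trans s0).
have ginc s t : s <= t -> t <= 0 -> g s <= g t.
  move=> st t0; rewrite /g -(sqrrN s) -(sqrrN t).
  by apply: gdec; rewrite ?oppr_ge0 ?lerN2.
pose V z : R := if z <= 0 then g z else 2 - g z.
have V0 z : 0 <= V z.
  by rewrite /V; case: ifP => // _; have := g1 z; lra.
have V2 z : V z <= 2.
  by rewrite /V; case: ifP => // _; [have := g1 z | have := g0 z]; lra.
have gV s t : s <= t -> `|g s - g t| <= V t - V s.
  move=> st; rewrite ler_norml /V; case: (leP t 0) => t0.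
    by rewrite (le_trans st t0); have := ginc _ _ st t0; lra.
  case: (leP s 0) => s0; first by have := g1 t; have := g1 s; have := g0 s; have := g0 t; lra.
  by have := gdec _ _ (ltW s0) st; lra.
have Vmono s t : s <= t -> V s <= V t.
  by move=> st; rewrite -subr_ge0 (le_trans _ (gV _ _ st)).
have cell s : `|h * g s - (H (s + h) - H s)| <= h * (V (s + h) - V s).
  have sh : s <= s + h by rewrite lerDl ltW.
  have := bd s (s + h) (g s - (V (s + h) - V s)) (g s + (V (s + h) - V s)) sh.
  have -> : s + h - s = h by rewrite addrC addKr.
  case/(_ _)/andP => [z /andP[sz zt]|lo hi].
    have := gV _ _ sz; have := Vmono _ _ zt; rewrite ler_norml -/(g z) => ? /andP[? ?].
    by apply/andP; split; lra.
  by rewrite ler_norml; apply/andP; split; nra.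
have stepE M : y + M.+1%:R * h = y + M%:R * h + h by rewrite -addn1 natrD; ring.
have HD M : \sum_(k < M) (H (y + k%:R * h + h) - H (y + k%:R * h)) = H (y + M%:R * h) - H y.
  elim: M => [|M IH]; first by rewrite big_ord0 mul0r addr0 subrr.
  by rewrite big_ord_recr /= IH stepE; ring.
have VD M : \sum_(k < M) h * (V (y + k%:R * h + h) - V (y + k%:R * h))
    = h * (V (y + M%:R * h) - V y).
  elim: M => [|M IH]; first by rewrite big_ord0 mul0r addr0 subrr mulr0.
  by rewrite big_ord_recr /= IH stepE; ring.
rewrite -HD -sumrB; apply: le_trans (ler_norm_sum _ _ _) _.
apply: le_trans (_ : \sum_(k < N) h * (V (y + k%:R * h + h) - V (y + k%:R * h)) <= _).
  by apply: ler_sum => k _; exact: cell.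
by rewrite VD mulrC ler_pM2r //; have := V0 y; have := V2 (y + N%:R * h); lra.
Qed.

Definition pt h L (k : 'I_(L.*2).+1) : R := h * (k%:R - L%:R).

(** The error [2 * h] is uniform in the centre [b], which in several variables moves with the other
    coordinates. The range [B] depends on [a] and [e] only, so it is a function chosen before [h],
    [b] and [L]. *)
Lemma gauss1_sum : exists B : R -> R -> R,
  (forall a e, 0 < a -> 0 < e -> 0 < B a e) /\
  forall a h b L, 0 < a -> 0 < h ->
    \sum_k h * expR (- (a / 2 * (pt h (L := L) k - b) ^+ 2)) <= Num.sqrt (2 * pi / a) + 2 * h
    /\ forall e, 0 < e -> `|b| + B a e <= h * L%:R ->
       Num.sqrt (2 * pi / a) - e - 2 * h <=
         \sum_k h * expR (- (a / 2 * (pt h (L := L) k - b) ^+ 2)).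
Proof.
have [H [Hu Hl] Hs] := gauss_riemann.
pose r a : R := Num.sqrt (a / 2).
have r0 a : 0 < a -> 0 < r a by move=> a0; rewrite sqrtr_gt0 divr_gt0.
have exB a e : exists B, 0 < a -> 0 < e -> 0 < B /\
    forall s t, s <= - (B * r a) -> B * r a <= t -> Num.sqrt pi - e * r a <= H t - H s.
  have [a0|_] := ltP 0 a; last by exists 0.
  have [e0|_] := ltP 0 e; last by exists 0.
  have [B B0 HB] := Hl (e * r a) (mulr_gt0 e0 (r0 _ a0)).
  exists (B / r a) => _ _; rewrite divr_gt0 ?r0 //; split=> // s t.
  by rewrite divfK ?gt_eqF ?r0 //; exact: HB.
pose B a e := projT1 (cid (exB a e)).
have BP a e : 0 < a -> 0 < e -> 0 < B a e /\
    forall s t, s <= - (B a e * r a) -> B a e * r a <= t -> Num.sqrt pi - e * r a <= H t - H s.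
  by rewrite /B; case: cid.
exists B; split=> [a e a0 e0|a h b L a0 h0]; first by case: (BP a e a0 e0).
have ra := r0 _ a0.
have sqr_r : r a ^+ 2 = a / 2 by rewrite sqr_sqrtr // ltW // divr_gt0.
have spi : Num.sqrt (2 * pi / a) = Num.sqrt pi / r a.
  rewrite /r -sqrtrV ?divr_ge0 ?ltW // -sqrtrM ?pi_ge0 //; congr Num.sqrt.
  by field; rewrite gt_eqF.
(* The substitution z = r (x - b) turns the exponent into -z^2; the 2L + 1 cells cover x from -hL to
   hL + h. *)
pose y := r a * (- (h * L%:R) - b); pose N := (L.*2).+1.
have yN : y + N%:R * (h * r a) = r a * (h * L%:R + h - b).
  by rewrite /y /N -addn1 -muln2 natrD natrM; ring.
have := Hs (h * r a) y N (mulr_gt0 h0 ra).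
have -> : \sum_(k < N) h * r a * expR (- (y + k%:R * (h * r a)) ^+ 2) =
    r a * \sum_k h * expR (- (a / 2 * (pt h (L := L) k - b) ^+ 2)).
  rewrite mulr_sumr; apply: eq_bigr => k _; rewrite [RHS]mulrA [r a * h]mulrC -sqr_r -exprMn.
  by congr (_ * expR (- _ ^+ 2)); rewrite /pt /y; ring.
set S := \sum_k _; rewrite yN spi ler_norml => /andP[lo up]; split.
  rewrite -(ler_pM2l ra) mulrDr mulrCA divff ?gt_eqF // mulr1.
  have hL : 0 <= h * L%:R by rewrite mulr_ge0 // ltW.
  have yle : y <= r a * (h * L%:R + h - b) by rewrite /y ler_pM2l //; lra.
  by have := Hu _ _ yle; lra.
move=> e e0 hb; have [_ HB] := BP a e a0 e0.
have b1 : b <= `|b| by exact: ler_norm.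
have b2 : - b <= `|b| by rewrite -normrN ler_norm.
have y1 : y <= - (B a e * r a) by rewrite /y -[X in _ <= X]mulNr mulrC ler_pM2r //; lra.
have y2 : B a e * r a <= r a * (h * L%:R + h - b) by rewrite mulrC ler_pM2l //; lra.
have HH := HB _ _ y1 y2.
have sE : r a * (Num.sqrt pi / r a) = Num.sqrt pi by rewrite mulrC divfK ?gt_eqF.
by rewrite -(ler_pM2l ra) !mulrBr sE; lra.
Qed.

End GaussSum.

Definition finsert (X : Type) (m : nat) (c : 'I_m.+1) (a : X) (t : {ffun 'I_m -> X}) :
  {ffun 'I_m.+1 -> X} := [ffun i => if unlift c i is Some j then t j else a].

Lemma finsert_eq (X : Type) m (c : 'I_m.+1) (a : X) t : finsert c a t c = a.
Proof. by rewrite ffunE unlift_none. Qed.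

Lemma finsert_lift (X : Type) m (c : 'I_m.+1) (a : X) t i : finsert c a t (lift c i) = t i.
Proof. by rewrite ffunE liftK. Qed.

Lemma sum_ffun_pin (V : zmodType) (X : finType) m (c : 'I_m.+1) (a : X)
    (P : pred {ffun 'I_m.+1 -> X}) (F : {ffun 'I_m.+1 -> X} -> V) :
  \sum_(t : {ffun 'I_m.+1 -> X} | (t c == a) && P t) F t =
  \sum_(t : {ffun 'I_m -> X} | P (finsert c a t)) F (finsert c a t).
Proof.
rewrite (reindex_onto (finsert c a) (fun t => [ffun i => t (lift c i)])) /=.
  apply: eq_bigl => t; rewrite finsert_eq eqxx /=.
  suff -> : [ffun i => finsert c a t (lift c i)] = t by rewrite eqxx andbT.
  by apply/ffunP => i; rewrite ffunE finsert_lift.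
move=> t /andP[/eqP ta _]; apply/ffunP => i.
by case: (unliftP c i) => [j ->|->]; rewrite ?finsert_lift ?finsert_eq ?ffunE.
Qed.

Lemma sum_ffun_split (V : zmodType) (X : finType) m (c : 'I_m.+1)
    (F : {ffun 'I_m.+1 -> X} -> V) :
  \sum_t F t = \sum_t \sum_a F (finsert c a t).
Proof.
rewrite exchange_big /= (partition_big (fun t : {ffun _} => t c) xpredT) //=.
apply: eq_bigr => a _; rewrite -(sum_ffun_pin c a xpredT).
by apply: eq_bigl => t; rewrite andbT.
Qed.

(** * Gaussian sums in several variables by Schur complements *)

Section Gauss.

Variable R : realType.
Implicit Types (h : R) (L m : nat).

Definition qf m (A : 'M[R]_m) (x : 'I_m -> R) : R := \sum_i \sum_j A i j * (x i * x j).

Definition posdef m (A : 'M[R]_m) : Prop :=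
  forall x, (exists i, x i != 0) -> 0 < qf A x.

Definition schur m (A : 'M[R]_m.+1) : 'M[R]_m :=
  \matrix_(i, j) (A (lift 0 i) (lift 0 j) - A (lift 0 i) 0 * A 0 (lift 0 j) / A 0 0).

Lemma det_schur m (A : 'M[R]_m.+1) : A 0 0 != 0 -> \det A = A 0 0 * \det (schur A).
Proof.
move=> a0; pose B : 'M[R]_m.+1 := \matrix_(i, j)
  if unlift 0 i is Some k then (i == j)%:R - A i 0 / A 0 0 * (j == 0)%:R else (j == 0)%:R.
have dB : \det B = 1.
  rewrite det_trig; last first.
    apply/is_trig_mxP => i j ij; rewrite mxE.
    have j0 : (j == 0) = false by apply/negbTE; rewrite -lt0n (leq_ltn_trans _ ij).
    have ijN : (i == j) = false by apply/negbTE; rewrite neq_ltn ij.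
    by rewrite j0 ijN mulr0 subr0; case: unlift.
  rewrite big1 // => i _; rewrite mxE eqxx; case: unliftP => [k ->|->].
    by rewrite eq_sym (negPf (neq_lift _ _)) mulr0 subr0.
  by rewrite eqxx.
rewrite -[LHS]mul1r -dB -det_mulmx.
have BA i j : (B *m A) i j = if unlift 0 i is Some k
    then A i j - A i 0 / A 0 0 * A 0 j else A 0 j.
  rewrite mxE; case E : (unlift 0 i) => [k|].
    under eq_bigr => l _ do rewrite mxE E mulrBl.
    rewrite sumrB (bigD1 i) //= eqxx mul1r big1 ?addr0; last first.
      by move=> l li; rewrite eq_sym (negPf li) mul0r.
    rewrite (bigD1 0) //= ?eqxx mulr1 big1 ?addr0 // => l li.
    by rewrite (negPf li) mulr0 mul0r.
  rewrite (bigD1 0) //= mxE E ?eqxx mul1r big1 ?addr0 // => l li.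
  by rewrite mxE E (negPf li) mul0r.
rewrite (expand_det_col _ 0) (bigD1 0) //= big1 ?addr0; last first.
  move=> i; rewrite BA; case: unliftP => [k ->|->]; last by rewrite ?eqxx.
  by rewrite divfK // subrr mul0r.
rewrite BA unlift_none /cofactor addn0 expr0 mul1r; congr (_ * \det _).
by apply/matrixP => i j; rewrite 2![LHS]mxE BA liftK mxE; ring.
Qed.

(** Completing the square in [x 0]. The double minus exhibits the conditional mean of [x 0] in the
    shape of the centre [b] of [gauss1_sum]. *)
Lemma qf_schur m (A : 'M[R]_m.+1) (x : 'I_m.+1 -> R) : A^T = A -> A 0 0 != 0 ->
  qf A x = A 0 0 * (x 0 - - (\sum_j A 0 (lift 0 j) * x (lift 0 j)) / A 0 0) ^+ 2
           + qf (schur A) (fun i => x (lift 0 i)).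
Proof.
move=> sA a0; set v := \sum_j _.
have vE : v = \sum_i A (lift 0 i) 0 * x (lift 0 i).
  by apply: eq_bigr => i _; rewrite -{1}sA mxE.
have -> : qf (schur A) (fun i => x (lift 0 i)) =
    \sum_i \sum_j A (lift 0 i) (lift 0 j) * (x (lift 0 i) * x (lift 0 j)) - v * v / A 0 0.
  rewrite {1}vE -mulrA mulr_suml -sumrB; apply: eq_bigr => i _.
  rewrite mulr_suml mulr_sumr -sumrB; apply: eq_bigr => j _.
  by rewrite mxE; ring.
rewrite /qf big_ord_recl big_ord_recl.
have -> : \sum_(i < m) A 0 (lift ord0 i) * (x 0 * x (lift ord0 i)) = x 0 * v.
  by rewrite mulr_sumr; apply: eq_bigr => i _; ring.
have -> : \sum_(i < m) \sum_j A (lift ord0 i) j * (x (lift ord0 i) * x j) =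
    x 0 * v + \sum_i \sum_j A (lift 0 i) (lift 0 j) * (x (lift 0 i) * x (lift 0 j)).
  rewrite vE mulr_sumr -big_split; apply: eq_bigr => i _; rewrite big_ord_recl.
  by congr (_ + _); ring.
by field.
Qed.

Lemma posdef_00 m (A : 'M[R]_m.+1) : posdef A -> 0 < A 0 0.
Proof.
move=> pA; have := pA (fun i => (i == 0)%:R); rewrite /qf => h.
have /h : exists i : 'I_m.+1, (i == 0)%:R != 0 :> R by exists 0; rewrite eqxx oner_eq0.
rewrite (bigD1 0) //= (bigD1 0) //= ?eqxx !mulr1 !big1 ?addr0 //.
  by move=> i i0; rewrite big1 // => j _; rewrite (negPf i0) mul0r mulr0.
by move=> i i0; rewrite (negPf i0) !mulr0.
Qed.

(** When [x 0] is chosen to annul the completed square, the form of [A] takes the value of the form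
    of its Schur complement. *)
Lemma posdef_schur m (A : 'M[R]_m.+1) : A^T = A -> posdef A -> posdef (schur A).
Proof.
move=> sA pA x [i xi]; have a0 := posdef_00 pA.
pose y k := if unlift 0 k is Some j then x j
            else - (\sum_j A 0 (lift 0 j) * x j) / A 0 0.
have yl j : y (lift 0 j) = x j by rewrite /y liftK.
have := pA y (ex_intro _ (lift 0 i) _); rewrite yl => /(_ xi).
rewrite (qf_schur _ sA) ?gt_eqF //; under eq_bigr do rewrite yl.
rewrite {1}/y unlift_none subrr expr0n /= mulr0 add0r.
rewrite (_ : qf _ _ = qf (schur A) x) //.
by apply: eq_bigr => k _; apply: eq_bigr => j _; rewrite !yl.
Qed.

Lemma schur_sym m (A : 'M[R]_m.+1) : A^T = A -> (schur A)^T = schur A.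
Proof.
move=> sA; apply/matrixP => i j; rewrite !mxE -{1 2 3}sA !mxE.
by congr (_ - _ / _); rewrite mulrC.
Qed.

Lemma det_posdef m (A : 'M[R]_m) : A^T = A -> posdef A -> 0 < \det A.
Proof.
elim: m A => [|m IH] A sA pA; first by rewrite det_mx00 ltr01.
have a0 := posdef_00 pA; rewrite det_schur ?gt_eqF // mulr_gt0 //.
by apply: IH; [exact: schur_sym | exact: posdef_schur].
Qed.

(** For positive definite [A], the integral of [expR (- (qf A x / 2))] over the whole space. *)
Definition gauss_vol m (A : 'M[R]_m) : R := Num.sqrt ((2 * pi) ^+ m / \det A).

Definition gsum h L m (A : 'M[R]_m) : R :=
  h ^+ m * \sum_(t : {ffun 'I_m -> 'I_(L.*2).+1}) expR (- (qf A (fun i => pt h (t i)) / 2)).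

Lemma gauss_vol_gt0 m (A : 'M[R]_m) : A^T = A -> posdef A -> 0 < gauss_vol A.
Proof.
by move=> sA pA; rewrite sqrtr_gt0 divr_gt0 ?det_posdef // exprn_gt0 // mulr_gt0 ?pi_gt0.
Qed.

Lemma gauss_vol_schur m (A : 'M[R]_m.+1) : A^T = A -> posdef A ->
  gauss_vol A = Num.sqrt (2 * pi / A 0 0) * gauss_vol (schur A).
Proof.
move=> sA pA; have a0 := posdef_00 pA.
have pi2 : 0 < 2 * pi :> R by rewrite mulr_gt0 ?pi_gt0.
rewrite /gauss_vol -sqrtrM ?divr_ge0 ?ltW // det_schur ?gt_eqF //; congr Num.sqrt.
have d0 := det_posdef (schur_sym sA) (posdef_schur sA pA).
by rewrite exprS; field; rewrite !gt_eqF.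
Qed.

Lemma gsum_schur h L m (A : 'M[R]_m.+1) : A^T = A -> posdef A ->
  gsum h L A = h ^+ m * \sum_(t : {ffun 'I_m -> 'I_(L.*2).+1})
    expR (- (qf (schur A) (fun i => pt h (t i)) / 2)) *
    \sum_(k : 'I_(L.*2).+1) h * expR (- (A 0 0 / 2 *
      (pt h k - - (\sum_j A 0 (lift 0 j) * pt h (t j)) / A 0 0) ^+ 2)).
Proof.
move=> sA pA; rewrite /gsum exprSr -mulrA; congr (_ * _).
rewrite (sum_ffun_split 0) mulr_sumr; apply: eq_bigr => t _.
rewrite !mulr_sumr; apply: eq_bigr => k _.
rewrite (qf_schur _ sA) ?gt_eqF ?posdef_00 // finsert_eq.
rewrite [RHS]mulrCA -expRD; congr (_ * expR _).
have -> : qf (schur A) (fun i => pt h (finsert 0 k t (lift 0 i))) =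
    qf (schur A) (fun i => pt h (t i)).
  by apply: eq_bigr => i _; apply: eq_bigr => j _; rewrite !finsert_lift.
under eq_bigr do rewrite finsert_lift.
by ring.
Qed.

(** Splitting off one variable costs a factor sqrt r, and another sqrt r is left to the Schur
    complement. The one-dimensional bound is uniform in the moving centre, so it factors out of the
    sum. *)
Lemma gsum_upper m (A : 'M[R]_m) (r : R) : A^T = A -> posdef A -> 1 < r ->
  exists2 h0, 0 < h0 & forall h L, 0 < h < h0 -> gsum h L A <= r * gauss_vol A.
Proof.
elim: m A r => [|m IH] A r sA pA r1.
  exists 1 => // h L _; rewrite /gsum /gauss_vol det_mx00 expr0 mul1r divr1 expr0 sqrtr1 mulr1.
  rewrite (eq_bigr (fun=> 1)); last by move=> t _; rewrite /qf big_ord0 mul0r oppr0 expR0.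
  by rewrite sumr_const card_ffun !card_ord expn0 ltW.
have [B [_ HB]] := gauss1_sum R.
have a0 := posdef_00 pA; set c := Num.sqrt (2 * pi / A 0 0).
have c0 : 0 < c by rewrite sqrtr_gt0 divr_gt0 // mulr_gt0 ?pi_gt0.
pose r' := Num.sqrt r; have r'1 : 1 < r' by rewrite -[1]sqrtr1 ltr_sqrt // (lt_trans ltr01).
have r'r : r' * r' = r by rewrite -expr2 sqr_sqrtr // ltW // (lt_trans ltr01).
have [h1 h10 H1] := IH _ r' (schur_sym sA) (posdef_schur sA pA) r'1.
have h20 : 0 < (r' - 1) * c / 2 by rewrite divr_gt0 // mulr_gt0 // subr_gt0.
exists (Num.min h1 ((r' - 1) * c / 2)); first by rewrite lt_min h10.
move=> h L; rewrite lt_min => /and3P[h0 hh1 hh2].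
rewrite gsum_schur // gauss_vol_schur // -/c.
apply: le_trans (_ : r' * c * gsum h L (schur A) <= _); last first.
  rewrite -r'r -!mulrA ler_pM2l ?(lt_trans ltr01) //.
  by rewrite [leRHS]mulrCA ler_pM2l // H1 // h0.
rewrite /gsum mulrCA ler_pM2l ?exprn_gt0 // mulr_sumr; apply: ler_sum => t _.
rewrite mulrC ler_pM2r ?expR_gt0 //.
have [] := HB (A 0 0) h (- (\sum_j A 0 (lift 0 j) * pt h (t j)) / A 0 0) L a0 h0.
by rewrite -/c => hu _; apply: le_trans hu _; lra.
Qed.

(** Both lattices have mesh [h] and are centred at 0, so the smaller box sits in the larger one by
    the index shift [L - L']. *)
Lemma sum_box_restrict L L' m (phi : ('I_m -> R) -> R) h : (L' <= L)%N ->
  (forall x y, x =1 y -> phi x = phi y) ->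
  \sum_(t : {ffun 'I_m -> 'I_(L'.*2).+1}) phi (fun i => pt h (t i)) =
  \sum_(t : {ffun 'I_m -> 'I_(L.*2).+1} | [forall i, (L - L' <= t i <= L + L')%N])
     phi (fun i => pt h (t i)).
Proof.
move=> LL ephi.
pose up (t : {ffun 'I_m -> 'I_(L'.*2).+1}) : {ffun 'I_m -> 'I_(L.*2).+1} :=
  [ffun i => inord (t i + (L - L'))].
pose dn (t : {ffun 'I_m -> 'I_(L.*2).+1}) : {ffun 'I_m -> 'I_(L'.*2).+1} :=
  [ffun i => inord (t i - (L - L'))].
have LE : (L.*2 = L'.*2 + (L - L') + (L - L'))%N.
  by rewrite -addnA addnn -doubleD subnKC.
have upE t i : up t i = (t i + (L - L'))%N :> nat.
  rewrite ffunE inordK // ltnS LE.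
  by apply: leq_trans (leq_addr _ _); rewrite leq_add2r -ltnS.
rewrite [RHS](reindex_onto up dn) /=; last first.
  move=> t /forallP tP; apply/ffunP => i; apply: val_inj; rewrite /= upE ffunE.
  have /andP[t1 t2] := tP i; rewrite inordK ?subnK // ltnS.
  by rewrite leq_subLR (leq_trans t2) // -addnn addnA subnK.
apply: eq_big => t.
  have -> : dn (up t) = t.
    by apply/ffunP => i; apply: val_inj; rewrite /= ffunE upE addnK inord_val.
  rewrite eqxx andbT; apply/esym/forallP => i; rewrite upE leq_addl /=.
  apply: leq_trans (_ : L'.*2 + (L - L') <= _)%N; first by rewrite leq_add2r -ltnS.
  by rewrite -addnn -addnA subnKC // addnC.
move=> _; apply: ephi => i; rewrite /pt upE natrD natrB //.
by congr (_ * _); ring.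
Qed.

Lemma pt_le h L (k : 'I_(L.*2).+1) : 0 <= h -> `|pt h k| <= h * L%:R.
Proof.
move=> h0; rewrite /pt normrM ger0_norm // ler_wpM2l // ler_norml.
have : (k <= L + L)%N by rewrite addnn -ltnS.
by rewrite -(ler_nat R) natrD; have := ler0n R k; lra.
Qed.

(** The centre of the inner Gaussian moves with the other coordinates. Restricting these to a box of
    radius at most [B1 + 1] bounds the centre by [D * (B1 + 1)], and the range of the inner sum is
    required to exceed that bound by [B (A 0 0) e]. *)
Lemma gsum_lower m (A : 'M[R]_m) (r : R) : A^T = A -> posdef A -> 0 < r < 1 ->
  exists h0 B : R, [/\ 0 < h0, 0 < B &
    forall h L, 0 < h < h0 -> B <= h * L%:R -> r * gauss_vol A <= gsum h L A].
Proof.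
elim: m A r => [|m IH] A r sA pA /andP[r0 r1].
  exists 1, 1; split=> // h L _ _.
  rewrite /gsum /gauss_vol det_mx00 !expr0 divr1 sqrtr1 mulr1 mul1r.
  rewrite (eq_bigr (fun=> 1)); last by move=> t _; rewrite /qf big_ord0 mul0r oppr0 expR0.
  by rewrite sumr_const card_ffun !card_ord expn0 ltW.
have [B [B0 HB]] := gauss1_sum R.
have a0 := posdef_00 pA; set c := Num.sqrt (2 * pi / A 0 0).
have c0 : 0 < c by rewrite sqrtr_gt0 divr_gt0 // mulr_gt0 ?pi_gt0.
pose r' := Num.sqrt r; have r'1 : r' < 1 by rewrite -[1]sqrtr1 ltr_sqrt.
have r'0 : 0 < r' by rewrite sqrtr_gt0.
have r'r : r' * r' = r by rewrite -expr2 sqr_sqrtr // ltW.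
have r'01 : 0 < r' < 1 by rewrite r'0.
have [h1 [B1 [h10 B10 H1]]] := IH _ r' (schur_sym sA) (posdef_schur sA pA) r'01.
pose e := (1 - r') * c / 4.
have e0 : 0 < e by rewrite divr_gt0 // mulr_gt0 // subr_gt0.
pose D := (\sum_j `|A 0 (lift 0 j)|) / A 0 0.
have D0 : 0 <= D by apply: divr_ge0; [exact: sumr_ge0 | exact: ltW].
exists (Num.min (Num.min h1 1) (e / 2)), (Num.max (B1 + 1) (D * (B1 + 1) + B (A 0 0) e)).
split; first by rewrite !lt_min h10 ltr01 divr_gt0.
  by rewrite lt_max addr_gt0.
move=> h L; rewrite !lt_min ge_max => /and3P[h0 /andP[hh1 hlt1] hh2] /andP[BL1 BL2].
pose L' := (Num.truncn (B1 / h)).+1.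
have BL' : B1 <= h * L'%:R.
  by rewrite mulrC -ler_pdivrMr //; apply: ltW; exact: truncnS_gt.
have L'B : h * L'%:R <= B1 + 1.
  rewrite /L' -addn1 natrD mulrDr mulr1; apply: lerD; last exact: ltW.
  by rewrite mulrC -ler_pdivlMr // truncn_le // divr_ge0 ?ltW.
have LL : (L' <= L)%N.
  by rewrite -(ler_nat R) -(ler_pM2l h0) (le_trans L'B).
have HL := H1 h L' _ BL'; rewrite h0 hh1 in HL; have {}HL := HL isT.
rewrite gsum_schur // gauss_vol_schur // -/c.
apply: le_trans (_ : r' * c * gsum h L' (schur A) <= _).
  by rewrite -r'r -!mulrA ler_pM2l // [leLHS]mulrCA ler_pM2l.
rewrite /gsum mulrCA ler_pM2l ?exprn_gt0 //.
rewrite (@sum_box_restrict L L' m (fun x => expR (- (qf (schur A) x / 2)))) //; last first.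
  move=> x y xy; congr expR; congr (- (_ / _)).
  by apply: eq_bigr => i _; apply: eq_bigr => j _; rewrite !xy.
rewrite mulr_sumr big_mkcond /=; apply: ler_sum => t _.
have S0 : 0 <= \sum_(k : 'I_(L.*2).+1) h * expR (- (A 0 0 / 2 *
      (pt h k - - (\sum_j A 0 (lift 0 j) * pt h (t j)) / A 0 0) ^+ 2)).
  by apply: sumr_ge0 => k _; rewrite mulr_ge0 ?expR_ge0 // ltW.
case: ifP => [/forallP tP|_]; last by rewrite mulr_ge0 // expR_ge0.
rewrite mulrC ler_pM2l ?expR_gt0 //.
have [_ Hl] := HB (A 0 0) h (- (\sum_j A 0 (lift 0 j) * pt h (t j)) / A 0 0) L a0 h0.
apply: le_trans (Hl e e0 _); first by rewrite -/c /e in hh2 *; lra.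
apply: le_trans BL2; rewrite lerD2r /D normrM normrN normfV (gtr0_norm a0) mulrAC.
rewrite ler_pM2r ?invr_gt0 // mulr_suml; apply: le_trans (ler_norm_sum _ _ _) _.
apply: ler_sum => j _; rewrite normrM ler_wpM2l //.
apply: le_trans L'B; rewrite /pt normrM gtr0_norm // ler_pM2l // ler_norml.
have /andP[] := tP j; rewrite leq_subLR -!(ler_nat R) !natrD; lra.
Qed.

End Gauss.

(** * Trigonometric inequalities *)

Module TrigDerivatives.

Import all_classical all_reals all_analysis.
Import numFieldNormedType.Exports.
Local Open Scope classical_set_scope.
Local Open Scope ring_scope.

Lemma ge0_derive_le (R : realType) (f df : R -> R) (b : R) : 0 <= b ->
  (forall x : R, is_derive x 1 f (df x)) -> (forall x, 0 <= x <= b -> 0 <= df x) ->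
  f 0 <= f b.
Proof.
move=> b0 fd df0; rewrite -subr_ge0.
have cf : {within `[0, b], continuous f}.
  apply: continuous_subspaceT => x.
  by apply: differentiable_continuous; apply/derivable1_diffP; case: (fd x).
have [c] := MVT_segment b0 (fun x _ => fd x) cf.
by rewrite in_itv /= => /df0 dc ->; rewrite subr0 mulr_ge0.
Qed.

Lemma sin_le_id (R : realType) (x : R) : 0 <= x -> sin x <= x.
Proof.
move=> x0; have := @ge0_derive_le R (fun t => t - sin t) (fun t => 1 - cos t) x x0.
rewrite sin0 subr0 subr_ge0; apply=> t _.
by rewrite subr_ge0 cos_le1.
Qed.

Lemma mulr_cos_le_sin (R : realType) (x : R) : 0 <= x <= pi -> x * cos x <= sin x.
Proof.
case/andP=> x0 xpi.
have := @ge0_derive_le R (fun t => sin t - t * cos t) (fun t => t * sin t) x x0.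
rewrite sin0 mul0r subrr subr_ge0; apply=> [t|t /andP[t0 tx]].
  by apply: is_derive_eq; rewrite !scaler1 /GRing.scale /=; ring.
by rewrite mulr_ge0 // sin_ge0_pi // t0 (le_trans tx).
Qed.

(** The product cos t exp (t^2 / 2) decreases on [0, pi]: its derivative is -exp (t^2 / 2) (sin t -
    t cos t). *)
Lemma cos_le_gauss_pos (R : realType) (x : R) : 0 <= x <= pi ->
  cos x <= expR (- (x ^+ 2 / 2)).
Proof.
case/andP=> x0 xpi.
have := @ge0_derive_le R (fun t => - (cos t * expR (t ^+ 2 / 2)))
   (fun t => expR (t ^+ 2 / 2) * (sin t - t * cos t)) x x0.
rewrite cos0 expr0n /= mul0r expR0 mulr1 lerN2 expRN => h.
rewrite -[leRHS]mul1r ler_pdivlMr ?expR_gt0 //.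
apply: h => [t|t /andP[t0 tx]]; last first.
  by rewrite mulr_ge0 ?expR_ge0 // subr_ge0 mulr_cos_le_sin // t0 (le_trans tx).
apply: is_derive_eq; rewrite /GRing.scale /=.
by field.
Qed.

End TrigDerivatives.

Section TrigBounds.

Variable R : realType.
Implicit Types x y : R.

Lemma sqr_sin_le x : sin x ^+ 2 <= x ^+ 2.
Proof.
wlog x0 : x / 0 <= x => [h|].
  by case: (leP 0 x) => [/h //|x0]; rewrite -(sqrrN x) -(sqrrN (sin x)) -sinN h // oppr_ge0 ltW.
have s1 := TrigDerivatives.sin_le_id x0.
case: (leP x pi) => [xp|xp].
  by rewrite lerXn2r ?nnegrE // sin_ge0_pi // x0.
apply: le_trans (_ : 1 <= _); first by have := cos2Dsin2 x; have := sqr_ge0 (cos x); lra.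
by rewrite expr_ge1 //; have := @pi_ge2 R; lra.
Qed.

(** For 0 <= x <= pi / 2, sin x = 2 cos (x/2) sin (x/2) >= x cos^2 (x/2) = x (1 + cos x) / 2 >= x /
    2. *)
Lemma sqr_sin_ge x : `|x| <= pi / 2 -> x ^+ 2 / 4 <= sin x ^+ 2.
Proof.
wlog x0 : x / 0 <= x => [h xp|].
  case: (leP 0 x) => [/h -> //|x0]; rewrite -(sqrrN x) -(sqrrN (sin x)) -sinN h ?normrN //.
  by rewrite oppr_ge0 ltW.
rewrite ger0_norm // => xp.
have p0 := @pi_gt0 R.
have h0 : 0 <= x / 2 <= pi by lra.
have c0 : 0 <= cos x by apply: cos_ge0_pihalf; lra.
have c20 : 0 <= cos (x / 2) by apply: cos_ge0_pihalf; lra.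
have := TrigDerivatives.mulr_cos_le_sin h0.
have xE : x = (x / 2) *+ 2 by rewrite -mulr_natr divfK ?pnatr_eq0.
have cE : cos x = cos (x / 2) ^+ 2 *+ 2 - 1 by rewrite {1}xE cos_mulr2n.
have sE : sin x = (cos (x / 2) * sin (x / 2)) *+ 2 by rewrite {1}xE sin_mulr2n.
move=> s2; have : x / 2 <= sin x.
  rewrite sE; apply: le_trans (_ : cos (x / 2) * (x / 2 * cos (x / 2)) *+ 2 <= _).
    have : x / 2 * cos x >= 0 by rewrite mulr_ge0 //; lra.
    by rewrite cE; lra.
  by rewrite lerMn2r ler_wpM2l.
move=> sx; rewrite (_ : x ^+ 2 / 4 = (x / 2) ^+ 2); last by field.
by rewrite lerXn2r ?nnegrE //; lra.
Qed.

(** From cos^2 = 1 - sin^2 <= exp (-sin^2). Both sides have period pi, so the bound makes sense on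
    the torus. *)
Lemma norm_cos_le_sin x : `|cos x| <= expR (- (sin x ^+ 2 / 2)).
Proof.
rewrite -(@ler_pXn2r _ 2) ?nnegrE ?expR_ge0 // real_normK ?num_real //.
rewrite -expRM_natl (_ : 2%:R * _ = - sin x ^+ 2) ?cos2sin2; last by field.
exact: expR_ge1Dx.
Qed.

Lemma cos_le_gauss x : `|x| <= pi -> cos x <= expR (- (x ^+ 2 / 2)).
Proof.
move=> xp; rewrite -cos_norm -(real_normK (num_real x)).
by apply: TrigDerivatives.cos_le_gauss_pos; rewrite normr_ge0.
Qed.

(** With y = x^2 / 2 <= 1/2, cos x >= 1 - y and (1 - y) (1 + y + 4 y^2) >= 1. *)
Lemma cos_ge_gauss x : `|x| <= 1 -> expR (- (x ^+ 2 / 2 + x ^+ 4)) <= cos x.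
Proof.
move=> x1; have x21 : x ^+ 2 <= 1 by rewrite -(real_normK (num_real x)) exprn_ile1.
have x20 := sqr_ge0 x.
apply: le_trans (_ : 1 - x ^+ 2 / 2 <= _); last first.
  have xE : x = (x / 2) *+ 2 by rewrite -mulr_natr divfK ?pnatr_eq0.
  have cE : cos x = cos (x / 2) ^+ 2 *+ 2 - 1 by rewrite {1}xE cos_mulr2n.
  rewrite cE cos2sin2; have := sqr_sin_le (x / 2).
  by rewrite (_ : (x / 2) ^+ 2 = x ^+ 2 / 4); [lra | field].
rewrite expRN invf_ple ?posrE ?expR_gt0 //; last by lra.
apply: le_trans (expR_ge1Dx _).
rewrite -[leLHS]mul1r ler_pdivrMr; last by lra.
by rewrite (_ : x ^+ 4 = x ^+ 2 * x ^+ 2); [nra | ring].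
Qed.

Lemma sqr_sin_triangle x y : sin (x + y) ^+ 2 <= (`|sin x| + `|sin y|) ^+ 2.
Proof.
rewrite -(real_normK (num_real (sin _))) lerXn2r ?nnegrE ?addr_ge0 //.
rewrite sinD; apply: le_trans (ler_normD _ _) _; rewrite !normrM.
have := cos_max x; have := cos_max y; have := normr_ge0 (sin x); have := normr_ge0 (sin y).
nra.
Qed.

End TrigBounds.

(** * Fourier formula for the number of Eulerian orientations *)

Section EdgePairs.

Variables (n : nat) (G : sgraph 'I_n).

Definition edge_pair (p : 'I_n * 'I_n) : bool := (p.1 < p.2)%N && G p.1 p.2.

Lemma card_edges : #|edges G| = #|[pred p | edge_pair p]|.
Proof.
pose f (p : 'I_n * 'I_n) := [set p.1; p.2].
have <- : f @: [set p | edge_pair p] = edges G.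
  apply/setP => e; apply/imsetP/imsetP => -[[a b]].
    by rewrite inE => /andP[_ /= gab] ->; exists (a, b); rewrite ?inE.
  rewrite inE /= => gab ->; case: (ltngtP a b) => ab.
  - by exists (a, b); rewrite ?inE // /edge_pair /= ab.
  - by exists (b, a); rewrite ?inE /edge_pair /= ?ab 1?adj_sym // /f setUC.
  - by move: gab; rewrite (ord_inj ab) adj_irrefl.
rewrite card_in_imset ?cardsE // => -[a b] [a' b']; rewrite !inE.
move=> /andP[/= ab _] /andP[/= ab' _] /set2_inj [[/= -> ->] //|[/= E1 E2]].
by rewrite E1 E2 ltnNge ltnW in ab.
Qed.

Lemma sum_pairs_lt (V : zmodType) (g : 'I_n -> 'I_n -> V) : (forall i, g i i = 0) ->
  \sum_i \sum_j g i j = \sum_(p : 'I_n * 'I_n | (p.1 < p.2)%N) (g p.1 p.2 + g p.2 p.1).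
Proof.
move=> g0; rewrite pair_bigA /= (bigID (fun p : 'I_n * 'I_n => (p.1 < p.2)%N)) /= big_split /=.
congr (_ + _); rewrite (bigID (fun p : 'I_n * 'I_n => (p.2 < p.1)%N)) /= [X in _ + X]big1 ?addr0.
  rewrite (reindex_inj (h := fun p : 'I_n * 'I_n => (p.2, p.1))) /=.
    by apply: eq_bigl => p; case: ltngtP.
  by move=> [a b] [a' b'] /= [-> ->].
by move=> [i j] /=; case: ltngtP => // /ord_inj ->.
Qed.

Lemma edge_sum_pairs (R : realType) (e : 'I_n -> 'I_n -> R) :
  (forall i j, e i j = e j i) ->
  edge_sum G e = 2 * \sum_(p | edge_pair p) e p.1 p.2.
Proof.
move=> se; rewrite /edge_sum.
under eq_bigr do rewrite big_mkcond.
rewrite sum_pairs_lt => [|i]; last by rewrite adj_irrefl.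
rewrite mulr_sumr [RHS]big_mkcondr; apply: eq_bigr => p _.
rewrite (adj_sym G p.2) (se p.2); case: ifP => _; rewrite ?addr0 //.
by rewrite mulr_natl mulr2n.
Qed.

End EdgePairs.

Section Fourier.

Variables (R : realType).
Local Notation C := R[i].

Definition cexp (x : R) : C := (cos x +i* sin x)%C.

Lemma cexpD x y : cexp (x + y) = cexp x * cexp y.
Proof. by rewrite /cexp cosD sinD; congr (_ +i* _)%C; ring. Qed.

Lemma cexp0 : cexp 0 = 1.
Proof. by rewrite /cexp cos0 sin0. Qed.

Lemma cexp_sum (I : Type) (r : seq I) (P : pred I) (f : I -> R) :
  cexp (\sum_(i <- r | P i) f i) = \prod_(i <- r | P i) cexp (f i).
Proof. by apply: big_morph; [exact: cexpD | exact: cexp0]. Qed.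

Lemma cexpMn x k : cexp (k%:R * x) = cexp x ^+ k.
Proof.
elim: k => [|k IH]; first by rewrite mul0r cexp0.
by rewrite -addn1 natrD mulrDl mul1r cexpD IH exprD expr1.
Qed.

Lemma cexpDN x : cexp x + cexp (- x) = (2 * cos x)%:C%C.
Proof. by rewrite /cexp cosN sinN; apply/eqP; rewrite eq_complex /=; apply/andP; split; apply/eqP; ring. Qed.

Lemma cexp_pi2 : cexp (2 * pi) = 1.
Proof. by rewrite /cexp mulr_natl cos2pi sin2pi. Qed.

Lemma cexp_root_eq1 (M u v : nat) : (u < M)%N -> (v < M)%N ->
  cexp (2 * pi / M%:R * (u%:R - v%:R)) = 1 -> u = v.
Proof.
wlog uv : u v / (v <= u)%N => [h um vm|um vm].
  case: (leqP v u) => [vu|/ltnW uv]; first exact: h.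
  rewrite -opprB mulrN => E; apply/esym; apply: h => //.
  by have := cexpDN (2 * pi / M%:R * (v%:R - u%:R)); rewrite E /cexp; move: E;
    rewrite /cexp cosN sinN => -[-> /eqP]; rewrite oppr_eq0 => /eqP ->.
have M0 : 0 < M%:R :> R by rewrite ltr0n (leq_ltn_trans _ vm).
pose y : R := pi / M%:R * (u%:R - v%:R).
have -> : 2 * pi / M%:R * (u%:R - v%:R) = y *+ 2 by rewrite /y -mulr_natl; ring.
rewrite /cexp => -[+ _]; rewrite cos_mulr2n cos2sin2 => c1.
have s0 : sin y = 0.
  by apply/eqP; rewrite -sqrf_eq0; apply/eqP; lra.
apply/eqP; rewrite eqn_leq uv andbT leqNgt; apply/negP => vu.
have p0 := @pi_gt0 R.
suff yp : 0 < y < pi by have := sin_gt0_pi yp; rewrite s0 ltxx.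
apply/andP; split.
  by rewrite mulr_gt0 ?divr_gt0 // subr_gt0 ltr_nat.
rewrite /y -mulrA gtr_pMr // mulrC ltr_pdivrMr // mul1r -natrB // ltr_nat.
by rewrite (leq_ltn_trans _ um) // leq_subr.
Qed.

(** Orthogonality of characters modulo 2L + 1. The factor 2 matches the mesh pi / (2L + 1) with
    roots of unity of that order, and the hypotheses exclude that distinct [u] and [v] are
    congruent. *)
Lemma cexp_orth (L u v : nat) : (u <= L.*2)%N -> (v <= L.*2)%N ->
  \sum_(k : 'I_(L.*2).+1) cexp (pt (pi / (L.*2).+1%:R) k * (2 * (u%:R - v%:R))) =
  if u == v then (L.*2).+1%:R else 0.
Proof.
set M := (L.*2).+1; move=> uM vM; have [->|uv] := eqVneq u v.
  under eq_bigr do rewrite subrr !mulr0 cexp0.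
  by rewrite sumr_const card_ord.
set q := cexp (2 * pi / M%:R * (u%:R - v%:R)).
have q1 : q - 1 != 0.
  by rewrite subr_eq0; apply: contra uv => /eqP /cexp_root_eq1 ->.
have qM : q ^+ M = 1.
  rewrite -cexpMn; have -> : M%:R * (2 * pi / M%:R * (u%:R - v%:R)) =
      u%:R * (2 * pi) - v%:R * (2 * pi) :> R by field; rewrite pnatr_eq0.
  have := cexpD (u%:R * (2 * pi) - v%:R * (2 * pi)) (v%:R * (2 * pi)).
  by rewrite subrK (cexpMn _ u) (cexpMn _ v) cexp_pi2 !expr1n mulr1 => <-.
have -> : \sum_(k < M) cexp (pt (pi / M%:R) k * (2 * (u%:R - v%:R))) =
    cexp (- L%:R * (2 * pi / M%:R * (u%:R - v%:R))) * \sum_(k < M) q ^+ k.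
  rewrite mulr_sumr; apply: eq_bigr => k _; rewrite -cexpMn -cexpD; congr cexp.
  by rewrite /pt; ring.
suff -> : \sum_(k < M) q ^+ k = 0 by rewrite mulr0.
by apply/eqP; rewrite -(mulrI_eq0 _ (lregP q1)) -subrX1 qM subrr.
Qed.

End Fourier.

(** * Orientations as independent choices at the edges *)

Section Orientations.

Variables (n : nat) (G : sgraph 'I_n).
Implicit Types (A : {set 'I_n * 'I_n}) (v : 'I_n).

Definition outd A v : nat := #|[set y | (v, y) \in A]|.
Definition ind A v : nat := #|[set y | (y, v) \in A]|.

Lemma orientation_arc A x y : orientation G A -> (x, y) \in A -> G x y /\ (y, x) \notin A.
Proof.
by move=> /forallP /(_ x) /forallP /(_ y); case: ifP => [_ /[swap] -> /negPf ->|_ /negPf ->].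
Qed.

Lemma orientation_edge A x y : orientation G A -> G x y -> ((y, x) \in A) = ((x, y) \notin A).
Proof.
by move=> /forallP /(_ x) /forallP /(_ y) /[swap] ->; case: (_ \in A); case: (_ \in A).
Qed.

Lemma orientation_nonedge A x y : orientation G A -> ~~ G x y -> (x, y) \in A = false.
Proof. by move=> /forallP /(_ x) /forallP /(_ y) /[swap] /negPf -> /negPf. Qed.

Lemma orientation_degree A v : orientation G A -> (outd A v + ind A v)%N = degree G v.
Proof.
move=> oA; rewrite /outd /ind /degree -!sum1dep_card.
rewrite big_mkcond [X in (_ + X)%N]big_mkcond [RHS]big_mkcond -big_split /=.
apply: eq_bigr => y _; case: (boolP (G v y)) => gvy.
  by rewrite (orientation_edge oA gvy); case: (_ \in A).
by rewrite !(orientation_nonedge oA) // adj_sym.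
Qed.

Lemma sum_outd A : (\sum_v outd A v = #|A|)%N.
Proof.
transitivity (\sum_v \sum_y (if (v, y) \in A then 1 else 0))%N.
  by apply: eq_bigr => v _; rewrite /outd -sum1dep_card big_mkcond.
by rewrite pair_bigA /= -sum1_card [RHS]big_mkcond; apply: eq_bigr => -[].
Qed.

Lemma sum_ind A : (\sum_v ind A v = #|A|)%N.
Proof.
transitivity (\sum_v \sum_y (if (y, v) \in A then 1 else 0))%N.
  by apply: eq_bigr => v _; rewrite /ind -sum1dep_card big_mkcond.
rewrite exchange_big pair_bigA /= -sum1_card [RHS]big_mkcond.
by apply: eq_bigr => -[].
Qed.

(** Expanding the product picks a direction for each edge. Pairs that are not edges receive the
    factors 1 and 0, so only sets [J] containing all of them survive; [or] and [un] match these with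
    orientations. *)
Lemma sum_orientation (V : comNzRingType) (a b : 'I_n * 'I_n -> V) :
  \sum_(A | orientation G A) \prod_(p | edge_pair G p) (if p \in A then a p else b p) =
  \prod_(p | edge_pair G p) (a p + b p).
Proof.
rewrite [RHS]big_mkcond /=.
pose a' p := if edge_pair G p then a p else 1.
pose b' p := if edge_pair G p then b p else 0.
rewrite (eq_bigr (fun p => a' p + b' p)); last first.
  by move=> p _; rewrite /a' /b'; case: ifP; rewrite ?addr0.
rewrite bigA_distr [RHS](eq_bigl xpredT) //.
rewrite [RHS](bigID (fun J : {set 'I_n * 'I_n} => [forall p : 'I_n * 'I_n, edge_pair G p || (p \in J)])) /=.
rewrite [X in _ = _ + X]big1 ?addr0; last first.
  move=> J /forallPn [p]; rewrite negb_or => /andP[/negPf ep /negPf pJ].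
  by rewrite (bigD1 p) //= pJ /b' ep mul0r.
pose or (J : {set 'I_n * 'I_n}) : {set 'I_n * 'I_n} :=
  [set p : 'I_n * 'I_n | G p.1 p.2 &&
    (if (p.1 < p.2)%N then p \in J else (p.2, p.1) \notin J)].
pose un (A : {set 'I_n * 'I_n}) : {set 'I_n * 'I_n} := [set p | ~~ edge_pair G p || (p \in A)].
rewrite [RHS](reindex_onto un or) /=; last first.
  move=> J /forallP JP; apply/setP => -[x y]; rewrite !inE /edge_pair /=.
  have := JP (x, y); rewrite /edge_pair /=; case: (ltngtP x y) => xy //=.
  by case: (G x y).
apply: eq_big => A; last first.
  move=> oA; rewrite big_mkcond /=; apply: eq_bigr => p _.
  by rewrite inE /a' /b'; case: (edge_pair G p).
have -> : [forall p : 'I_n * 'I_n, edge_pair G p || (p \in un A)].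
  by apply/forallP => p; rewrite inE; case: edge_pair.
apply/idP/eqP => [oA|<-].
  apply/setP => -[x y]; rewrite !inE /edge_pair /= /edge_pair /=.
  case: (boolP (G x y)) => gxy /=; last by rewrite (orientation_nonedge oA).
  rewrite (adj_sym G y) gxy /= !andbT; case: (ltngtP x y) => [//|yx|/ord_inj xy] /=.
    by rewrite (orientation_edge oA gxy) negbK.
  by rewrite xy adj_irrefl in gxy.
apply/forallP => x; apply/forallP => y; rewrite !inE /=.
case: (boolP (G x y)) => gxy //=; rewrite adj_sym gxy /=.
by case: (ltngtP x y) => [xy|yx|/ord_inj xy]; [ | | by rewrite xy adj_irrefl in gxy];
  case: (_ || _).
Qed.

Lemma prod_orientation (R : realType) A (x : 'I_n -> R) : orientation G A ->
  \prod_v cexp (x v * ((outd A v)%:R - (ind A v)%:R)) =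
  \prod_(p | edge_pair G p)
    (if p \in A then cexp (x p.1 - x p.2) else cexp (- (x p.1 - x p.2))).
Proof.
move=> oA; rewrite -cexp_sum.
rewrite [RHS](eq_bigr (fun p => cexp (if p \in A then x p.1 - x p.2 else - (x p.1 - x p.2))));
  last by move=> p _; case: ifP.
rewrite -cexp_sum; congr cexp.
transitivity (\sum_i \sum_j (if (i, j) \in A then x i - x j else 0)).
  transitivity (\sum_i \sum_j ((if (i, j) \in A then x i else 0)
                  - (if (i, j) \in A then x j else 0))); last first.
    by apply: eq_bigr => i _; apply: eq_bigr => j _; case: ifP; rewrite ?subrr.
  under [RHS]eq_bigr do rewrite sumrB.
  rewrite sumrB [X in _ - X]exchange_big -sumrB; apply: eq_bigr => v _.
  rewrite -!big_mkcond /= !sumr_const mulrBr !mulr_natr /outd /ind.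
  by congr (_ *+ _ - _ *+ _); apply: eq_card => y; rewrite !inE.
rewrite sum_pairs_lt => [|i]; last first.
  case: ifP => // /(orientation_arc oA) []; by rewrite adj_irrefl.
rewrite /edge_pair [RHS]big_mkcondr; apply: eq_bigr => -[i j] /= _.
have [gij|gij] := boolP (G i j); last first.
  by rewrite !(orientation_nonedge oA) ?addr0 // adj_sym.
by rewrite (orientation_edge oA gij); case: (_ \in A); rewrite ?addr0 ?add0r ?opprB.
Qed.

End Orientations.

Section EulerianFourier.

Variables (R : realType) (m : nat) (G : sgraph 'I_m.+1) (c : 'I_m.+1).
Hypothesis evenG : forall x, ~~ odd (degree G x).

Lemma half_degree x : (degree G x)./2.*2 = degree G x.
Proof. by rewrite -[RHS]odd_double_half (negPf (evenG x)). Qed.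

(** Out-degrees and half degrees have the same total, so balance at all vertices but [c] forces
    balance at [c]. This is why one coordinate can be pinned. *)
Lemma balanced_pinned A : orientation G A ->
  balanced A = [forall i, outd A (lift c i) == (degree G (lift c i))./2].
Proof.
move=> oA; have bE v : (ind A v == outd A v) = (outd A v == (degree G v)./2).
  have := orientation_degree v oA; rewrite -{1}half_degree -addnn => E.
  by apply/eqP/eqP; move: E; lia.
rewrite /balanced -/(ind A) -/(outd A).
apply/forallP/forallP => bA v; first by rewrite -bE; exact: bA.
change (ind A v == outd A v); rewrite bE.
case: (unliftP c v) => [i ->|->] //; apply/eqP.
have : (\sum_v outd A v = \sum_v (degree G v)./2)%N.
  apply: double_inj; rewrite -!muln2 !big_distrl /=.
  under [RHS]eq_bigr => w _ do rewrite muln2 half_degree -(orientation_degree w oA).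
  by rewrite big_split /= sum_ind -big_distrl /= sum_outd muln2 addnn.
rewrite (bigD1 c) //= [RHS](bigD1 c) //= => /eqP.
rewrite (eq_bigr (fun v => (degree G v)./2)) ?eqn_add2r => [/eqP //|w].
by case: (unliftP c w) => [i ->|->]; rewrite ?eqxx // => _; apply/eqP; exact: bA.
Qed.

(** The phase at a vertex is x (out - in) = 2 x (out - d/2), with d/2 an integer by evenness; its
    lattice average detects out = d/2, without aliasing because degrees are at most [m]. *)
Lemma eulerian_fourier L : (m <= L.*2)%N ->
  (EO G)%:R * (L.*2).+1%:R ^+ m =
  2 ^+ #|edges G| * \sum_(t : {ffun 'I_m.+1 -> 'I_(L.*2).+1} | t c == inord L)
     \prod_(p | edge_pair G p)
        cos (pt (pi / (L.*2).+1%:R) (t p.1) - pt (pi / (L.*2).+1%:R) (t p.2)) :> R.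
Proof.
move=> mL; set M := (L.*2).+1; set h := pi / M%:R.
have dM v : (degree G v <= L.*2)%N.
  apply: leq_trans mL; rewrite -ltnS -[X in (_ < X)%N]card_ord /degree -cardsT.
  apply: proper_card; apply/properP; split; first exact: subsetT.
  by exists v; rewrite ?inE ?adj_irrefl.
apply: (@complexI R).
rewrite !rmorphM !rmorphXn !rmorph_nat rmorph_sum /=.
have -> : (EO G)%:R * M%:R ^+ m =
   \sum_(A | orientation G A) \prod_i
      (if outd A (lift c i) == (degree G (lift c i))./2 then M%:R else 0) :> R[i].
  rewrite /EO -sum1_card natr_sum mulr_suml.
  under eq_bigl => A do rewrite inE.
  rewrite big_mkcondr /=; apply: eq_bigr => A oA; rewrite (balanced_pinned oA) mul1r.
  case: ifP => [/forallP bA|].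
    by under eq_bigr => i _ do rewrite bA; rewrite prodr_const card_ord.
  move/negbT; rewrite negb_forall => /existsP [i /negPf bi].
  by rewrite (bigD1 i) //= bi mul0r.
transitivity (\sum_(A | orientation G A)
   \sum_(t : {ffun 'I_m.+1 -> 'I_M} | t c == inord L)
     \prod_v cexp (pt h (t v) * ((outd A v)%:R - (ind A v)%:R))).
  apply: eq_bigr => A oA.
  rewrite [RHS](eq_bigl (fun t : {ffun 'I_m.+1 -> 'I_M} => (t c == inord L) && true)); last first.
    by move=> t; rewrite andbT.
  rewrite (sum_ffun_pin c (inord L) xpredT) /=.
  transitivity (\sum_(t : {ffun 'I_m -> 'I_M}) \prod_i
     cexp (pt h (t i) * (2 * ((outd A (lift c i))%:R - ((degree G (lift c i))./2)%:R)))).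
    rewrite -(bigA_distr_bigA (fun i k => cexp (pt h k *
       (2 * ((outd A (lift c i))%:R - ((degree G (lift c i))./2)%:R))))).
    apply: eq_bigr => i _; rewrite cexp_orth //.
      by apply: leq_trans (dM (lift c i)); rewrite -(orientation_degree _ oA) leq_addr.
    by apply: leq_trans (dM (lift c i)); rewrite -{2}half_degree -addnn leq_addr.
  apply: eq_bigr => t _; rewrite (bigD1_ord c) //= finsert_eq.
  have -> : pt h (inord L : 'I_M) = 0 by rewrite /pt inordK ?subrr ?mulr0 // ltnS -addnn leq_addr.
  rewrite mul0r cexp0 mul1r; apply: eq_bigr => i _; rewrite finsert_lift; congr (cexp (_ * _)).
  have /(congr1 (fun k => k%:R : R)) := orientation_degree (lift c i) oA.
  by rewrite -{1}half_degree -addnn !natrD; lra.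
rewrite exchange_big mulr_sumr /=; apply: eq_bigr => t _.
under eq_bigr => A oA do rewrite (prod_orientation _ oA).
rewrite (sum_orientation G (fun p => cexp (pt h (t p.1) - pt h (t p.2)))
                 (fun p => cexp (- (pt h (t p.1) - pt h (t p.2))))).
under eq_bigr do rewrite cexpDN.
rewrite card_edges -prodr_const rmorph_prod -big_split /=.
by apply: eq_big => p; rewrite ?inE // rmorphM rmorph_nat.
Qed.

End EulerianFourier.

(** * Lattice points away from the diagonal *)

Section TorusShift.

Variables (R : realType) (L : nat).
Local Notation M := (L.*2).+1.
Local Notation h := (pi / M%:R : R).

(** Addition in ['I_M] is modulo [M], and [M] steps of the mesh make one period pi. *)
Lemma ptD (u a : 'I_M) : exists b : bool, pt h (u + a) = pt h u + h * a%:R - b%:R * pi.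
Proof.
have M0 : M%:R != 0 :> R by rewrite pnatr_eq0.
have hM : h * M%:R = pi by rewrite divfK.
have [uaM|Mua] := ltnP (u + a) M.
  by exists false; rewrite mulr0n mul0r subr0 /pt /= modn_small // natrD; ring.
exists true; rewrite mulr1n mul1r /pt /= -[in LHS](subnK Mua) modnDr modn_small.
  by rewrite natrB // natrD -[X in _ = _ - X]hM; ring.
by rewrite ltn_subLR // -addSn leq_add // ltnW.
Qed.

Lemma sinDpib (x : R) (b : bool) : sin (x + b%:R * pi) ^+ 2 = sin x ^+ 2.
Proof. by case: b; rewrite ?mul1r ?mul0r ?addr0 // sinDpi sqrrN. Qed.

Lemma sin_shift (u v a : 'I_M) :
  sin (pt h (u + a) - pt h (v + a)) ^+ 2 = sin (pt h u - pt h v) ^+ 2.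
Proof.
have [b ->] := ptD u a; have [b' ->] := ptD v a.
rewrite -(sinDpib (_ - _) b) -(sinDpib (pt h u - _) b').
by congr (sin _ ^+ 2); ring.
Qed.

Lemma norm_cos_shift (u v a : 'I_M) :
  `|cos (pt h (u + a) - pt h (v + a))| = `|cos (pt h u - pt h v)|.
Proof.
apply/eqP; rewrite -(@eqrXn2 _ 2) // !real_normK ?num_real //.
by rewrite !cos2sin2 sin_shift.
Qed.

Definition shift_inv n (F : {ffun 'I_n -> 'I_M} -> R) : Prop :=
  forall (a : 'I_M) (t : {ffun 'I_n -> 'I_M}), F [ffun i => t i + a] = F t.

Lemma sum_shift_inv n (F : {ffun 'I_n -> 'I_M} -> R) c z : shift_inv F ->
  \sum_t F t = M%:R * \sum_(t : {ffun 'I_n -> 'I_M} | t c == z) F t.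
Proof.
move=> sF; rewrite (partition_big (fun t : {ffun _} => t c) xpredT) //=.
transitivity (\sum_(a : 'I_M) \sum_(t : {ffun 'I_n -> 'I_M} | t c == z) F t); last first.
  by rewrite sumr_const card_ord mulr_natl.
apply: eq_bigr => a _.
rewrite (reindex_onto (fun t : {ffun 'I_n -> 'I_M} => [ffun i => t i + (a - z)])
  (fun t : {ffun 'I_n -> 'I_M} => [ffun i => t i + (z - a)])) /=.
  apply: eq_big => t; last by rewrite sF.
  rewrite ffunE.
  have -> : [ffun i => [ffun j => t j + (a - z)] i + (z - a)] = t.
    by apply/ffunP => i; rewrite !ffunE -addrA -(opprB a z) subrr addr0.
  rewrite eqxx andbT; apply/eqP/eqP => [/(congr1 (fun w => w - (a - z)))|->].
    by rewrite addrK subKr.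
  by rewrite addrC subrK.
move=> t _; apply/ffunP => i; rewrite !ffunE -addrA -(opprB a z) addNr.
by rewrite addr0.
Qed.

Lemma sum_pin_shift_inv n (F : {ffun 'I_n -> 'I_M} -> R) c c' z : shift_inv F ->
  \sum_(t : {ffun 'I_n -> 'I_M} | t c == z) F t =
  \sum_(t : {ffun 'I_n -> 'I_M} | t c' == z) F t.
Proof.
move=> sF; apply: (mulfI (_ : M%:R != 0)); first by rewrite pnatr_eq0.
by rewrite -!sum_shift_inv.
Qed.

End TorusShift.

Lemma ler_sum_inj (R : realDomainType) (I J : finType) (P : pred I) (Q : pred J)
    (f : I -> J) (F : J -> R) :
  {in P &, injective f} -> (forall i, P i -> Q (f i)) -> (forall j, 0 <= F j) ->
  \sum_(i | P i) F (f i) <= \sum_(j | Q j) F j.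
Proof.
move=> finj PQ F0.
have -> : \sum_(i | P i) F (f i) = \sum_(j in [set f i | i in P]) F j.
  by rewrite big_imset //=; apply: eq_bigl => i; rewrite inE.
rewrite big_mkcond [leRHS]big_mkcond; apply: ler_sum => j _.
case: imsetP => [[i Pi ->]|_]; first by rewrite PQ.
by case: ifP.
Qed.

Lemma sum_set_expr (R : comNzRingType) (I : finType) (a : R) :
  \sum_(S : {set I}) a ^+ #|S| = (1 + a) ^+ #|I|.
Proof.
have -> : (1 + a) ^+ #|I| = \prod_(i : I) (a + 1) by rewrite prodr_const addrC.
rewrite bigA_distr; apply: eq_big => [S|S _]; first by rewrite inE.
by rewrite -big_mkcond prodr_const.
Qed.

Section Tail.

Variables (R : realType) (m : nat) (G : sgraph 'I_m.+1) (gamma : R) (L : nat).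
Local Notation n := m.+1.
Local Notation M := (L.*2).+1.
Local Notation h := (pi / M%:R : R).
Local Notation torus := {ffun 'I_n -> 'I_M}.
Local Notation ang t j := (pt h (t j)).

Hypothesis gamma_gt0 : 0 < gamma.
Hypothesis gap : forall x : 'I_n -> R,
  gamma * (\sum_j \sum_k (x j - x k) ^+ 2) <= edge_sum G (fun j k => (x j - x k) ^+ 2).

Definition abs_prod (t : torus) : R :=
  \prod_(p | edge_pair G p) `|cos (ang t p.1 - ang t p.2)|.

Definition sin_dist (t : torus) j k : R := sin (ang t j - ang t k) ^+ 2.

(** The divisor is 4 instead of 2 because [edge_sum] counts each edge twice. *)
Definition gauss_weight (x : 'I_n -> R) : R :=
  expR (- (edge_sum G (fun j k => (x j - x k) ^+ 2) / 4)).

(** The thresholds 1/16 here and 1/64 in [far] fit together: if no vertex is far from [c], all sines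
    from [c] are at most 1/8, hence those from vertex 0 at most 1/4. So outside the core every [c]
    has a far vertex. *)
Definition core (t : torus) : bool := [forall k, sin_dist t 0 k <= 1 / 16].

Definition far c (t : torus) : {set 'I_n} := [set k | 1 / 64 < sin_dist t c k].

Lemma sin_dist_sym t j k : sin_dist t j k = sin_dist t k j.
Proof. by rewrite /sin_dist -opprB sinN sqrrN. Qed.

Lemma sin_dist_ge0 t j k : 0 <= sin_dist t j k.
Proof. exact: sqr_ge0. Qed.

Lemma sin_dist_shift : forall j k, shift_inv (fun t => sin_dist t j k).
Proof. by move=> j k a t; rewrite /sin_dist !ffunE sin_shift. Qed.

Lemma abs_prod_shift : shift_inv abs_prod.
Proof. by move=> a t; apply: eq_bigr => p _; rewrite !ffunE norm_cos_shift. Qed.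

Lemma abs_prod_ge0 t : 0 <= abs_prod t.
Proof. by apply: prodr_ge0. Qed.

(** The spectral gap tested on the indicator function of [v]. *)
Lemma degree_ge v : gamma * m%:R <= (degree G v)%:R.
Proof.
have := gap (fun j => (j == v)%:R).
pose e j k : R := ((j == v)%:R - (k == v)%:R) ^+ 2.
have e_sym j k : e j k = e k j by rewrite /e -opprB sqrrN.
have ev k : e v k = (k != v)%:R.
  by rewrite /e eqxx; case: eqP => _ /=; rewrite ?subrr ?subr0 ?expr0n ?expr1n.
have e0 j k : j != v -> e j k = (k == v)%:R.
  by move=> /negPf jv; rewrite /e jv sub0r sqrrN; case: eqP; rewrite ?expr0n ?expr1n.
have -> : \sum_j \sum_k e j k = 2 * m%:R.
  rewrite (bigD1_ord v) //= [X in _ + X](eq_bigr (fun=> 1)) => [|i _]; last first.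
    rewrite (bigD1 v) //= e0 ?eqxx; last by rewrite eq_sym neq_lift.
    by rewrite big1 ?addr0 // => k /negPf kv; rewrite e0 ?kv // eq_sym neq_lift.
  rewrite sumr_const card_ord (bigD1_ord v) //= ev eqxx add0r.
  rewrite (eq_bigr (fun=> 1)) => [|i _]; last by rewrite ev eq_sym neq_lift.
  by rewrite sumr_const card_ord; ring.
have -> : edge_sum G e = 2 * (degree G v)%:R.
  rewrite /edge_sum (bigD1 v) //=.
  rewrite (eq_bigr (fun=> 1)) => [|k gk]; last first.
    by rewrite ev; case: eqP gk => // ->; rewrite adj_irrefl.
  rewrite sumr_const (_ : #|_| = degree G v); last by apply: eq_card => k; rewrite inE.
  rewrite (eq_bigr (fun j => if G v j then 1 else 0)) => [|j jv]; last first.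
    under eq_bigr do rewrite e0 //.
    rewrite big_mkcond (bigD1 v) //= eqxx adj_sym big1 ?addr0 // => k /negPf kv.
    by rewrite kv if_same.
  rewrite -big_mkcondr sumr_const /= (_ : #|_| = degree G v); first by ring.
  apply: eq_card => k; rewrite !inE unfold_in andbC.
  by case: (k =P v) => [->|_]; rewrite ?adj_irrefl ?andbT ?andbF.
by rewrite mulrCA ler_pM2l.
Qed.

Lemma abs_prod_le_exp (e : 'I_n -> 'I_n -> R) (t : torus) : (forall j k, e j k = e k j) ->
  (forall j k, `|cos (ang t j - ang t k)| <= expR (- (e j k / 2))) ->
  abs_prod t <= expR (- (edge_sum G e / 4)).
Proof.
move=> e_sym He; rewrite edge_sum_pairs //.
have -> : - (2 * (\sum_(p | edge_pair G p) e p.1 p.2) / 4) =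
    \sum_(p | edge_pair G p) - (e p.1 p.2 / 2).
  by rewrite sumrN -mulr_suml; congr (- _); field.
by rewrite expR_sum; apply: ler_prod => p _; rewrite normr_ge0 He.
Qed.

(** Rests on 4 sin^2 (x - y) = (cos 2x - cos 2y)^2 + (sin 2x - sin 2y)^2. *)
Lemma abs_prod_le t :
  abs_prod t <= expR (- (gamma / 4 * \sum_j \sum_k sin_dist t j k)).
Proof.
apply: le_trans (abs_prod_le_exp (sin_dist_sym t) (fun j k => norm_cos_le_sin _)) _.
rewrite ler_expR lerN2 mulrAC ler_pM2r ?invr_gt0 //.
have sE j k : sin_dist t j k = ((cos (ang t j *+ 2) - cos (ang t k *+ 2)) ^+ 2
     + (sin (ang t j *+ 2) - sin (ang t k *+ 2)) ^+ 2) / 4.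
  have c1 := cos2Dsin2 (ang t j *+ 2); have c2 := cos2Dsin2 (ang t k *+ 2).
  have := cosB (ang t j *+ 2) (ang t k *+ 2).
  rewrite -mulrnBl (cos_mulr2n (_ - _)) (cos2sin2 (_ - _)) -/(sin_dist t j k) => c3.
  apply: (mulIf (_ : 4 != 0 :> R)); first by rewrite pnatr_eq0.
  rewrite divfK ?pnatr_eq0 //.
  transitivity ((cos (ang t j *+ 2) ^+ 2 + sin (ang t j *+ 2) ^+ 2)
     + (cos (ang t k *+ 2) ^+ 2 + sin (ang t k *+ 2) ^+ 2)
     - 2 * (cos (ang t j *+ 2) * cos (ang t k *+ 2) + sin (ang t j *+ 2) * sin (ang t k *+ 2))).
    by rewrite c1 c2 -c3; ring.
  by ring.
under eq_bigr => j _ do under eq_bigr => k _ do rewrite sE.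
rewrite [leRHS](eq_edge_sum _ (f := fun j k => 1 / 4 *
   ((cos (ang t j *+ 2) - cos (ang t k *+ 2)) ^+ 2 + (sin (ang t j *+ 2) - sin (ang t k *+ 2)) ^+ 2)));
  last by move=> j k; rewrite sE; field.
rewrite edge_sumZ edge_sumD.
under eq_bigr => j _ do rewrite -mulr_suml big_split /=.
rewrite -mulr_suml big_split /=.
have := gap (fun j => cos (ang t j *+ 2)); have := gap (fun j => sin (ang t j *+ 2)).
by lra.
Qed.

Lemma sum_sin_dist_center t : exists c,
  n%:R * (\sum_k sin_dist t c k) <= \sum_j \sum_k sin_dist t j k.
Proof.
apply/existsP; apply: contraT; rewrite negb_exists => /forallP H.
have : \sum_(c < n) \sum_j \sum_k sin_dist t j k < \sum_(c < n) n%:R * (\sum_k sin_dist t c k).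
  apply: ltr_sum => [|c _]; first by apply/hasP; exists 0; rewrite ?mem_index_enum.
  by rewrite ltNge H.
by rewrite sumr_const card_ord -mulr_sumr mulr_natl ltxx.
Qed.

Definition far_term (K : R) c S (t : torus) : R :=
  if (\sum_k sin_dist t c k <= K) && (far c t == S) then abs_prod t else 0.

(** The exponent is split in halves: one yields the smallness through [K], the other keeps a product
    that can be summed coordinatewise. *)
Definition spread_term (K : R) c (t : torus) : R :=
  expR (- (gamma / 8 * n%:R * K)) * expR (- (gamma / 8 * n%:R * \sum_k sin_dist t c k)).

(** The centre and its far set depend on [t]; summing over all candidates gives a majorant without
    this dependence. *)
Lemma tail_split K t : ~~ core t ->
  abs_prod t <= \sum_c (spread_term K c t +
    \sum_(S : {set 'I_n} | (c \notin S) && (S != set0)) far_term K c S t).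
Proof.
move=> nc; have [c Hc] := sum_sin_dist_center t.
have f0 c' S : 0 <= far_term K c' S t.
  by rewrite /far_term; case: ifP => // _; exact: abs_prod_ge0.
have s0 c' : 0 <= spread_term K c' t by rewrite mulr_ge0 ?expR_ge0.
apply: le_trans (_ : spread_term K c t +
  \sum_(S : {set 'I_n} | (c \notin S) && (S != set0)) far_term K c S t <= _);
  last first.
  rewrite [leRHS](bigD1 c) //= lerDl sumr_ge0 // => c' _.
  by rewrite addr_ge0 // sumr_ge0.
have [sK|Ks] := leP (\sum_k sin_dist t c k) K; last first.
  apply: le_trans (_ : spread_term K c t <= _); last by rewrite lerDl sumr_ge0.
  apply: le_trans (abs_prod_le t) _; rewrite /spread_term -expRD ler_expR.
  rewrite -opprD lerN2 -!mulrDr.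
  have -> : gamma / 8 * n%:R * (K + \sum_k sin_dist t c k) =
     gamma / 8 * (n%:R * (K + \sum_k sin_dist t c k)) by ring.
  have -> : gamma / 4 * \sum_j \sum_k sin_dist t j k =
     gamma / 8 * (2 * \sum_j \sum_k sin_dist t j k) by field.
  rewrite ler_pM2l ?divr_gt0 //; apply: le_trans (_ : n%:R * (2 * \sum_k sin_dist t c k) <= _).
    by rewrite ler_pM2l //; lra.
  by rewrite mulrCA ler_pM2l.
rewrite (bigD1 (far c t)) /=; last first.
  rewrite !inE /sin_dist subrr sin0 expr0n /= -leNgt; apply/andP; split; first by lra.
  apply: contra nc => /eqP F0; apply/forallP => k.
  have near j : `|sin (ang t c - ang t j)| <= 1 / 8.
    have : j \notin far c t by rewrite F0 inE.
    rewrite inE -leNgt /sin_dist -[sin _ ^+ 2]real_normK ?num_real // => H.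
    rewrite -(@ler_pXn2r _ 2) ?nnegrE ?divr_ge0 //; apply: (le_trans H).
    by rewrite le_eqVlt; apply/orP; left; apply/eqP; field.
  have -> : sin_dist t 0 k = sin ((ang t c - ang t k) + - (ang t c - ang t 0)) ^+ 2.
    by rewrite /sin_dist; congr (sin _ ^+ 2); ring.
  apply: le_trans (sqr_sin_triangle _ _) _; rewrite sinN normrN.
  have n1 := near k; have n2 := near 0.
  apply: le_trans (_ : (1 / 8 + 1 / 8) ^+ 2 <= _); last by rewrite le_eqVlt; apply/orP; left; apply/eqP; field.
  by apply: lerXn2r; rewrite ?nnegrE ?lerD ?addr_ge0 ?divr_ge0.
rewrite [far_term K c (far c t) t](_ : _ = abs_prod t); last by rewrite /far_term sK eqxx.
by rewrite addrCA lerDl addr_ge0 // sumr_ge0.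
Qed.

End Tail.

Lemma ler_edge_sum (R : realType) n (G : sgraph 'I_n) (e f : 'I_n -> 'I_n -> R) :
  (forall j k, G j k -> e j k <= f j k) -> edge_sum G e <= edge_sum G f.
Proof. by move=> ef; apply: ler_sum => j _; apply: ler_sum => k; exact: ef. Qed.

(** * The loss caused by far points *)

Section FarPoints.

Variables (R : realType) (m : nat) (G : sgraph 'I_m.+1) (gamma : R) (L : nat).
Local Notation n := m.+1.
Local Notation M := (L.*2).+1.
Local Notation h := (pi / M%:R : R).
Local Notation torus := {ffun 'I_n -> 'I_M}.
Local Notation ang t j := (pt h (t j)).
Local Notation abs_prod := (@abs_prod R m G L).
Local Notation sin_dist := (@sin_dist R m L).
Local Notation far := (@far R m L).

Hypothesis gamma_gt0 : 0 < gamma.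
Hypothesis gap : forall x : 'I_n -> R,
  gamma * (\sum_j \sum_k (x j - x k) ^+ 2) <= edge_sum G (fun j k => (x j - x k) ^+ 2).

Lemma pt_center : pt h (inord L : 'I_M) = 0.
Proof. by rewrite /pt inordK ?subrr ?mulr0 // ltnS -addnn leq_addr. Qed.

Lemma norm_pt_le_pihalf (k : 'I_M) : `|pt h k| <= pi / 2.
Proof.
have ME : M%:R = 2 * L%:R + 1 :> R by rewrite -natr1 -muln2 natrM mulrC.
have M0 : 0 < M%:R :> R by rewrite ltr0n.
apply: le_trans (pt_le _ _) _; first by rewrite divr_ge0 ?pi_ge0.
rewrite mulrAC -mulrA ler_wpM2l ?pi_ge0 // ler_pdivrMr // ME.
by lra.
Qed.

Lemma sin_dist_center (t : torus) c k : t c = inord L -> sin_dist t c k = sin (ang t k) ^+ 2.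
Proof. by move=> tc; rewrite /sin_dist tc pt_center sub0r sinN sqrrN. Qed.

Lemma sqr_ang_le (t : torus) c k : t c = inord L -> ang t k ^+ 2 <= 4 * sin_dist t c k.
Proof.
move=> tc; rewrite sin_dist_center //.
by have := sqr_sin_ge (norm_pt_le_pihalf (t k)); lra.
Qed.

(** If the sine from [c] to [k] is below 1/16, the sine from [v] to [k] is at least 1/16, since that
    from [c] to [v] exceeds 1/8. For every other [k] the difference [1 / 256 - sin_dist t c k] is at
    most 0. *)
Lemma far_edges_sum (t : torus) c v : t c = inord L -> v \in far c t ->
  (degree G v)%:R / 256 - \sum_k sin_dist t c k <=
  \sum_(k | G v k) (if k \in far c t then 0 else sin_dist t v k).
Proof.
move=> tc vS.
apply: le_trans (_ : \sum_(k | G v k) (1 / 256 - sin_dist t c k) <= _).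
  rewrite sumrB sumr_const (_ : #|_| = degree G v); last by apply: eq_card => k; rewrite inE.
  apply: lerB; first by rewrite -[leRHS]mulr_natl div1r.
  rewrite [leRHS](bigID (fun k => G v k)) /= lerDl sumr_ge0 // => k _.
  exact: sin_dist_ge0.
apply: ler_sum => k _; case: ifP => kS.
  by move: kS; rewrite inE; lra.
have s0 := sin_dist_ge0 R t v k.
have [|s1] := leP (1 / 256) (sin_dist t c k); first by lra.
have s2 : 1 / 64 < sin_dist t c v by move: vS; rewrite inE.
have := sin_dist_ge0 R t c k; move: s1 s2 s0; rewrite !(sin_dist_center _ tc) /sin_dist.
move=> s1 s2 s0 s3.
have := sqr_sin_triangle (ang t v - ang t k) (ang t k); rewrite subrK.
rewrite -(real_normK (num_real (sin (ang t v - ang t k)))).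
have := real_normK (num_real (sin (ang t k))).
move: (normr_ge0 (sin (ang t v - ang t k))) (normr_ge0 (sin (ang t k))).
move: (`|sin (ang t v - ang t k)|) (`|sin (ang t k)|) => a b a0 b0 bE tri.
have b1 : b <= 1 / 16.
  rewrite -(@ler_pXn2r _ 2) ?nnegrE ?divr_ge0 // bE; apply: (le_trans (ltW s1)).
  by rewrite le_eqVlt; apply/orP; left; apply/eqP; field.
have a1 : 1 / 16 <= a.
  rewrite leNgt; apply/negP => a1.
  have : (a + b) ^+ 2 <= (1 / 16 + 1 / 16) ^+ 2.
    by apply: lerXn2r; rewrite ?nnegrE ?addr_ge0 ?divr_ge0 // lerD // ltW.
  lra.
have : (1 / 16) ^+ 2 <= a ^+ 2 by apply: lerXn2r; rewrite ?nnegrE ?divr_ge0.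
lra.
Qed.

(** Replaces the far coordinates by values in [0, 1/n]. In the edge sum, a far point gains at least
    [gamma * m / 256 - K] from its edges to near points, while its new Gaussian terms cost at most
    [8 * K + 4]. *)
Lemma far_pointwise (t : torus) c (K : R) (w : 'I_n -> R) : t c = inord L ->
  \sum_k sin_dist t c k <= K ->
  (forall k, k \notin far c t -> w k = ang t k) ->
  (forall k, k \in far c t -> 0 <= w k <= n%:R^-1) ->
  abs_prod t <= expR (9 / 2 * K + 2 - gamma * m%:R / 512) ^+ #|far c t| * gauss_weight G w.
Proof.
move=> tc sK wN wS; set S := far c t in wN wS *.
(* No decay is claimed between two far points, the sine bound is used between a far and a near one,
   and the Gaussian bound between near ones, whose angles are at most 1/4. *)
pose e j k : R := if (j \in S) && (k \in S) then 0 else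
  if (j \in S) || (k \in S) then sin_dist t j k else (ang t j - ang t k) ^+ 2.
have e_sym j k : e j k = e k j.
  by rewrite /e andbC orbC sin_dist_sym -(opprB (ang t j)) sqrrN.
have xS k : k \notin S -> `|ang t k| <= 1 / 4.
  rewrite inE -leNgt => H; rewrite -(@ler_pXn2r _ 2) ?nnegrE ?divr_ge0 //.
  rewrite real_normK ?num_real //; apply: (le_trans (sqr_ang_le k tc)).
  apply: le_trans (_ : 4 * (1 / 64) <= _); first by rewrite ler_pM2l.
  by rewrite le_eqVlt; apply/orP; left; apply/eqP; field.
have cos_e j k : `|cos (ang t j - ang t k)| <= expR (- (e j k / 2)).
  rewrite /e; case: ifP => [_|_]; first by rewrite mul0r oppr0 expR0 cos_max.
  case: ifP => [_|/norP[jS kS]]; first exact: norm_cos_le_sin.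
  have d1 : `|ang t j - ang t k| <= 1 / 2.
    by apply: le_trans (ler_normB _ _) _; have := xS j jS; have := xS k kS; lra.
  have p2 := @pi_ge2 R; rewrite ger0_norm; first by apply: cos_le_gauss; lra.
  by apply: cos_ge0_pihalf; rewrite -ler_norml; lra.
apply: le_trans (abs_prod_le_exp G e_sym cos_e) _.
(* [u j k] is the change of the exponent charged to the far end [j]; an edge with two far ends is
   charged to both. *)
pose u j k : R := if j \in S then
  2 * (w j ^+ 2 + w k ^+ 2) - (if k \in S then 0 else sin_dist t j k) else 0.
have le_u : edge_sum G (fun j k => (w j - w k) ^+ 2) <= edge_sum G e + 2 * edge_sum G u.
  rewrite -[X in 2 * X]mulr1 mulrA mulr_natl mulr2n mulrDl !mulr1.
  rewrite {2}[edge_sum G u]edge_sum_sym -!edge_sumD; apply: ler_edge_sum => j k _.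
  have sq a b : (a - b) ^+ 2 <= 2 * (a ^+ 2 + b ^+ 2) :> R.
    have -> : 2 * (a ^+ 2 + b ^+ 2) = (a - b) ^+ 2 + (a + b) ^+ 2 by ring.
    by rewrite lerDl sqr_ge0.
  rewrite /e /u; case: (boolP (j \in S)) => jS; case: (boolP (k \in S)) => kS /=.
  - have := sq (w j) (w k); have := sqr_ge0 (w j); have := sqr_ge0 (w k); lra.
  - have := sq (w j) (w k); lra.
  - rewrite sin_dist_sym; have := sq (w j) (w k); lra.
  - by rewrite !wN //; lra.
have n0 : 0 < n%:R :> R by rewrite ltr0n.
have n1 : n%:R^-1 <= 1 :> R by rewrite invf_le1 // ler1n.
have wsq j : j \in S -> n%:R * w j ^+ 2 <= 1.
  move=> /wS /andP[w0 w1]; rewrite -[leRHS](divff (lt0r_neq0 n0)) ler_pM2l //.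
  apply: le_trans (_ : n%:R^-1 ^+ 2 <= _); first by apply: lerXn2r; rewrite ?nnegrE // ltW // invr_gt0.
  by rewrite expr2 ler_piMr // invr_ge0 ltW.
have sumw : \sum_k w k ^+ 2 <= 4 * K + 1.
  apply: le_trans (_ : \sum_k (4 * sin_dist t c k + n%:R^-1) <= _).
    apply: ler_sum => k _; have sk := sin_dist_ge0 R t c k.
    case: (boolP (k \in S)) => kS; last first.
      by rewrite wN // (le_trans (sqr_ang_le k tc)) // lerDl invr_ge0 ltW.
    have : w k ^+ 2 <= n%:R^-1 by rewrite -(ler_pM2l n0) divff ?gt_eqF // wsq.
    by move=> H; rewrite -[w k ^+ 2]add0r lerD // mulr_ge0.
  rewrite big_split /= -mulr_sumr sumr_const card_ord -[_ *+ n]mulr_natl divff ?gt_eqF //.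
  by lra.
have le_eu : edge_sum G u <= #|S|%:R * (9 * K + 4 - gamma * m%:R / 256).
  rewrite /edge_sum (bigID (fun j => j \in S)) /= [X in _ + X]big1 ?addr0; last first.
    by move=> j /negPf jS; rewrite big1 // => k _; rewrite /u jS.
  rewrite mulr_natl -sumr_const; apply: ler_sum => j jS.
  rewrite (eq_bigr (fun k => 2 * (w j ^+ 2 + w k ^+ 2) - (if k \in S then 0 else sin_dist t j k))); last first.
    by move=> k _; rewrite /u jS.
  rewrite sumrB; have := far_edges_sum tc jS; have := degree_ge gap j.
  have : \sum_(k | G j k) 2 * (w j ^+ 2 + w k ^+ 2) <= 8 * K + 4.
    apply: le_trans (_ : \sum_k 2 * (w j ^+ 2 + w k ^+ 2) <= _).
      rewrite [leRHS](bigID (fun k => G j k)) /= lerDl sumr_ge0 // => k _.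
      by rewrite mulr_ge0 // addr_ge0 ?sqr_ge0.
    rewrite -mulr_sumr big_split /= sumr_const card_ord -[_ *+ n]mulr_natl.
    by have := wsq j jS; lra.
  by rewrite -/S; lra.
rewrite /gauss_weight -expRM_natl -expRD ler_expR.
have := le_u; have := le_eu.
set s := #|S|%:R; move: (gamma * m%:R) => gm.
have -> : s * (9 / 2 * K + 2 - gm / 512) = s * (9 * K + 4 - gm / 256) / 2 by field.
by lra.
Qed.

End FarPoints.

(** * Summation over the bad configurations *)

Section TailSum.

Variables (R : realType) (m : nat) (G : sgraph 'I_m.+1) (gamma : R) (L : nat).
Local Notation n := m.+1.
Local Notation M := (L.*2).+1.
Local Notation h := (pi / M%:R : R).
Local Notation torus := {ffun 'I_n -> 'I_M}.
Local Notation ang t j := (pt h (t j)).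
Local Notation abs_prod := (@abs_prod R m G L).
Local Notation sin_dist := (@sin_dist R m L).
Local Notation far := (@far R m L).
Local Notation far_term := (@far_term R m G L).
Local Notation spread_term := (@spread_term R m gamma L).

Hypothesis gamma_gt0 : 0 < gamma.
Hypothesis gap : forall x : 'I_n -> R,
  gamma * (\sum_j \sum_k (x j - x k) ^+ 2) <= edge_sum G (fun j k => (x j - x k) ^+ 2).

Definition pinned_gauss c : R :=
  \sum_(t : torus | t c == inord L) gauss_weight G (fun k => ang t k).

Definition far_rate (K : R) : R :=
  4 * n%:R * expR (9 / 2 * K + 2 - gamma * m%:R / 512).

(* The coordinates of the far points are averaged against lattice points within
   [1/n] of the centre, at the price of a factor [M / (M / 4n)] each. *)
Lemma far_sum c (S : {set 'I_n}) (K : R) : (0 < L)%N -> c \notin S ->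
  \sum_(t : torus | t c == inord L) far_term K c S t <=
  far_rate K ^+ #|S| * pinned_gauss c.
Proof.
move=> L0 cS; set tau := expR (9 / 2 * K + 2 - gamma * m%:R / 512).
pose z : 'I_M := inord L; pose r := (M %/ (4 * n))%N.
have rL : (r <= L)%N.
  have : (r * 4 <= M)%N.
    by apply: leq_trans (leq_trunc_div M (4 * n)); rewrite leq_mul2l leq_pmulr ?orbT.
  by lia.
pose near : pred 'I_M := fun k => (L <= k <= L + r)%N.
pose Y := pffun_on z (mem S) near; pose U := pffun_on z (mem S) (@predT 'I_M).
have N_ge : (M <= 4 * n * #|near|)%N.
  have rN : (r.+1 <= #|near|)%N.
    have inj : injective (fun i : 'I_r.+1 => inord (L + i) : 'I_M).
      move=> i j /(congr1 val) /=; have := ltn_ord i; have := ltn_ord j => lj li.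
      by rewrite !inordK; [move/addnI/ord_inj | lia | lia].
    rewrite -[r.+1]card_ord -(card_imset _ inj); apply/subset_leq_card/subsetP => k.
    case/imsetP => i _ ->; have := ltn_ord i => li.
    by rewrite unfold_in /near inordK; lia.
  by apply: leq_trans (ltnW (ltn_ceil M (_ : 0 < 4 * n)%N)) _; rewrite // mulnC leq_mul2l rN orbT.
have N0 : (0 < #|near|)%N by move: N_ge; case: #|near| => //; rewrite muln0.
pose mix (t y : torus) : torus := [ffun k => if k \in S then y k else t k].
have near_ang k : near k -> 0 <= pt h k <= n%:R^-1.
  move=> /andP[k1 k2]; have k1R : L%:R <= k%:R :> R by rewrite ler_nat.
  have M0 : 0 < M%:R :> R by rewrite ltr0n.
  have h0 : 0 < h by rewrite divr_gt0 ?pi_gt0.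
  apply/andP; split; first by rewrite mulr_ge0 ?subr_ge0 // ltW.
  apply: le_trans (_ : h * r%:R <= _).
    by rewrite ler_pM2l // lerBlDl -natrD ler_nat.
  rewrite -[leRHS]mul1r ler_pdivlMr ?ltr0n // (_ : h * r%:R * n%:R = pi * (r%:R * n%:R) / M%:R); last by ring.
  rewrite ler_pdivrMr // mul1r.
  have : (r * (4 * n) <= M)%N by exact: leq_trunc_div.
  rewrite -(ler_nat R) !natrM; have : pi <= 4 :> R by have := @pihalf_lt2 R; lra.
  have : 0 <= r%:R * n%:R :> R by rewrite mulr_ge0.
  by nra.
have point (t y : torus) : t c = z -> y \in Y ->
    far_term K c S t <= tau ^+ #|S| * gauss_weight G (fun k => ang (mix t y) k).
  move=> tc /pfamilyP[_ yN]; rewrite /far_term; case: ifP => [/andP[sK /eqP fE]|_]; last first.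
    by rewrite mulr_ge0 ?exprn_ge0 ?expR_ge0.
  rewrite -{1}fE; apply: (far_pointwise gap tc sK) => k; rewrite fE /mix ffunE.
    by move=> /negPf ->.
  by move=> kS; rewrite kS; apply: near_ang; exact: yN.
have tau0 : 0 < tau by exact: expR_gt0.
have main : #|near|%:R ^+ #|S| * \sum_(t : torus | t c == z) far_term K c S t <=
    tau ^+ #|S| * (M%:R ^+ #|S| * pinned_gauss c).
  have -> : #|near|%:R ^+ #|S| * \sum_(t : torus | t c == z) far_term K c S t =
      \sum_(t : torus | t c == z) \sum_(y in Y) far_term K c S t.
    rewrite mulr_sumr; apply: eq_bigr => t _.
    by rewrite sumr_const card_pffun_on -natrX mulr_natl.
  apply: le_trans (_ : \sum_(t : torus | t c == z) \sum_(y in Y)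
     tau ^+ #|S| * gauss_weight G (fun k => ang (mix t y) k) <= _).
    by apply: ler_sum => t /eqP tc; apply: ler_sum => y; exact: point.
  rewrite pair_big_dep -mulr_sumr /= ler_pM2l ?exprn_gt0 //.
  have -> : M%:R ^+ #|S| * pinned_gauss c =
     \sum_(p : torus * torus | (p.1 c == z) && (p.2 \in U)) gauss_weight G (fun k => ang p.1 k).
    rewrite -(pair_big_dep (fun t : torus => t c == z) (fun _ u => u \in U)
       (fun t _ => gauss_weight G (fun k => ang t k))) /=.
    rewrite mulr_sumr; apply: eq_bigr => t _.
    by rewrite sumr_const card_pffun_on -[#|predT|]/(#|'I_M|) card_ord -natrX mulr_natl.
  (* The second component stores the overwritten coordinates, which makes [f] injective. *)
  pose f (p : torus * torus) : torus * torus :=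
    (mix p.1 p.2, [ffun k => if k \in S then p.1 k else z]).
  apply: (ler_sum_inj (f := f) (F := fun p : torus * torus => gauss_weight G (fun k => ang p.1 k))).
  - move=> [t y] [t' y']; rewrite !unfold_in /= => /andP[_ /pfamilyP[/subsetP sy _]].
    move=> /andP[_ /pfamilyP[/subsetP sy' _]] [/ffunP E1 /ffunP E2].
    congr (_, _); apply/ffunP => k; have := E1 k; have := E2 k; rewrite !ffunE.
      by case: ifP.
    case: (boolP (k \in S)) => // kS _ _.
    have off (v : torus) : {subset z.-support v <= mem S} -> v k = z.
      by move=> sv; apply/eqP; apply: contraNT kS => vk; apply: sv.
    by rewrite !off.
  - move=> [t y] /= /andP[/eqP tc _]; rewrite ffunE (negPf cS) tc eqxx /=.
    apply/pfamilyP; split=> //; apply/subsetP => k; rewrite unfold_in /= ffunE.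
    by case: ifP => //; rewrite eqxx.
  - by move=> p; exact: expR_ge0.
have Z0 : 0 <= pinned_gauss c by apply: sumr_ge0 => t _; exact: expR_ge0.
have NS0 : 0 < #|near|%:R ^+ #|S| :> R by rewrite exprn_gt0 // ltr0n.
rewrite -(ler_pM2l NS0); apply: (le_trans main).
rewrite !mulrA -!exprMn ler_wpM2r // lerXn2r // ?nnegrE ?mulr_ge0 ?expR_ge0 //.
rewrite /far_rate -/tau mulrC mulrA ler_pM2r //.
by rewrite -!natrM ler_nat mulnC.
Qed.

(** The sum factorizes over the coordinates. All lattice points satisfy |x| <= pi / 2, so sin^2 x >=
    x^2 / 4 compares each factor with a Gaussian sum. *)
Lemma spread_sum c (K : R) :
  h ^+ m * \sum_(t : torus | t c == inord L) spread_term K c t <=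
  expR (- (gamma / 8 * n%:R * K)) * (Num.sqrt (2 * pi / (gamma * n%:R / 16)) + 2 * h) ^+ m.
Proof.
have h0 : 0 < h by rewrite divr_gt0 ?pi_gt0.
have gn0 : 0 < gamma * n%:R / 16 by rewrite divr_gt0 // mulr_gt0.
rewrite -mulr_sumr mulrCA ler_pM2l ?expR_gt0 //.
rewrite (eq_bigl (fun t : torus => (t c == inord L) && true)); last by move=> t; rewrite andbT.
rewrite (sum_ffun_pin c (inord L) xpredT) /=.
rewrite (eq_bigr (fun t : {ffun 'I_m -> 'I_M} =>
   \prod_i expR (- (gamma / 8 * n%:R * sin (pt h (t i)) ^+ 2)))); last first.
  move=> t _; rewrite -expR_sum sumrN -mulr_sumr; congr (expR (- (_ * _))).
  rewrite (bigD1_ord c) //= {1}sin_dist_center ?finsert_eq // pt_center sin0 expr0n add0r.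
  by apply: eq_bigr => i _; rewrite sin_dist_center ?finsert_eq // finsert_lift.
rewrite -(bigA_distr_bigA (fun _ k => expR (- (gamma / 8 * n%:R * sin (pt h k) ^+ 2)))).
rewrite prodr_const card_ord -exprMn lerXn2r ?nnegrE //.
- by apply: mulr_ge0; [exact: ltW | apply: sumr_ge0 => k _; exact: expR_ge0].
- by rewrite addr_ge0 ?sqrtr_ge0 // mulr_ge0 // ltW.
have [B [_ /(_ (gamma * n%:R / 16) h 0 L gn0 h0)[le1 _]]] := gauss1_sum R.
apply: le_trans le1; rewrite mulr_sumr; apply: ler_sum => k _.
rewrite ler_pM2l // ler_expR lerN2 subr0.
have -> : gamma * n%:R / 16 / 2 * pt h k ^+ 2 = gamma / 8 * n%:R * (pt h k ^+ 2 / 4) by field.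
rewrite ler_pM2l; first by apply: sqr_sin_ge; exact: norm_pt_le_pihalf.
by rewrite mulr_gt0 // divr_gt0.
Qed.

(** The majorant is invariant under rotation, so for each candidate centre the pin moves from 0 to
    [c]. The sum over nonempty far sets is a binomial expansion without its first term. *)
Lemma tail_sum (K Z : R) : (0 < L)%N -> (forall c, h ^+ m * pinned_gauss c <= Z) ->
  h ^+ m * \sum_(t : torus | (t 0 == inord L) && ~~ core R t) abs_prod t <=
  n%:R * (expR (- (gamma / 8 * n%:R * K)) * (Num.sqrt (2 * pi / (gamma * n%:R / 16)) + 2 * h) ^+ m
          + ((1 + far_rate K) ^+ n - 1) * Z).
Proof.
move=> L0 HZ.
have h0 : 0 < h by rewrite divr_gt0 ?pi_gt0.
pose T c t := spread_term K c t + \sum_(S : {set 'I_n} | (c \notin S) && (S != set0)) far_term K c S t.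
have shT c : shift_inv (T c).
  have shd (j : 'I_n) a (t : torus) : \sum_k sin_dist [ffun i => t i + a] j k = \sum_k sin_dist t j k.
    by apply: eq_bigr => k _; rewrite (sin_dist_shift R j k a t).
  move=> a t; rewrite /T /spread_term shd; congr (_ + _).
  apply: eq_bigr => S _; rewrite /far_term shd abs_prod_shift; congr (if _ && (_ == _) then _ else _).
  by apply/setP => k; rewrite !inE (sin_dist_shift R c k a t).
apply: le_trans (_ : h ^+ m * \sum_(t : torus | t 0 == inord L) \sum_c T c t <= _).
  rewrite ler_pM2l ?exprn_gt0 // big_mkcondr; apply: ler_sum => t _.
  case: ifP => [nc|_]; first exact: tail_split.
  apply: sumr_ge0 => c _; rewrite addr_ge0 ?mulr_ge0 ?expR_ge0 // sumr_ge0 // => S _.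
  by rewrite /far_term; case: ifP => // _; exact: abs_prod_ge0.
set rhs := (_ + _ * Z); rewrite exchange_big mulr_sumr /=.
have -> : n%:R * rhs = \sum_(c < n) rhs by rewrite sumr_const card_ord mulr_natl.
rewrite {}/rhs.
apply: ler_sum => c _; rewrite (sum_pin_shift_inv 0 c _ (shT c)) big_split mulrDr.
apply: lerD; first exact: spread_sum.
rewrite exchange_big mulr_sumr /=.
have rate0 : 0 <= far_rate K by rewrite mulr_ge0 ?expR_ge0 // mulr_ge0.
have Z0 : 0 <= Z.
  apply: le_trans (HZ 0); apply: mulr_ge0; first by rewrite exprn_ge0 // ltW.
  by apply: sumr_ge0 => t _; exact: expR_ge0.
apply: le_trans (_ : \sum_(S : {set 'I_n} | S != set0) far_rate K ^+ #|S| * Z <= _).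
  rewrite big_mkcond [leRHS]big_mkcond; apply: ler_sum => S _.
  case: (boolP (c \notin S)) => cS /=; last by case: ifP => // _; rewrite mulr_ge0 ?exprn_ge0.
  case: ifP => // _; apply: le_trans (_ : h ^+ m * (far_rate K ^+ #|S| * pinned_gauss c) <= _).
    by rewrite ler_pM2l ?exprn_gt0 // far_sum.
  by rewrite mulrCA ler_wpM2l ?exprn_ge0.
rewrite -mulr_suml ler_wpM2r //.
have := sum_set_expr 'I_n (far_rate K); rewrite (bigD1 set0) //= cards0 expr0 card_ord => <-.
by rewrite addrAC subrr add0r.
Qed.

End TailSum.

(** * Gaussian sum of the reduced Laplacian *)

Section RankOne.

Variables (R : realType) (m : nat).
Implicit Types (A : 'M[R]_m) (u x : 'rV[R]_m).

Lemma eq_qf A (y z : 'I_m -> R) : y =1 z -> qf A y = qf A z.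
Proof. by move=> yz; apply: eq_bigr => i _; apply: eq_bigr => j _; rewrite !yz. Qed.

Lemma qfE A x : qf A (x 0) = (x *m A *m x^T) 0 0.
Proof.
rewrite -mulmxA mxE; apply: eq_bigr => i _; rewrite mxE mulr_sumr.
by apply: eq_bigr => j _; rewrite mxE; ring.
Qed.

(** The matrix determinant lemma: the bordered matrix [P] is made block triangular by row operations
    on one side and column operations on the other. *)
Lemma det_rank_one A u (a : R) : A \in unitmx ->
  \det (A - a *: (u^T *m u)) = \det A * (1 - a * (u *m invmx A *m u^T) 0 0).
Proof.
move=> uA; pose P : 'M[R]_(1 + m) := block_mx 1%:M u (a *: u^T) A.
have E1 : block_mx 1%:M 0 (- (a *: u^T)) 1%:M *m P = block_mx 1%:M u 0 (A - a *: (u^T *m u)).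
  rewrite mulmx_block !mul1mx !mul0mx !addr0 mulmx1 addNr.
  by rewrite mulNmx -scalemxAl addrC.
have E2 : P *m block_mx 1%:M 0 (- (invmx A *m (a *: u^T))) 1%:M =
    block_mx (1%:M - a *: (u *m invmx A *m u^T)) u 0 A.
  rewrite mulmx_block !mulmx1 !mulmx0 !add0r !mulmxN mulKVmx // subrr.
  by rewrite mulmxA -scalemxAr.
have := congr1 determinant E1; have := congr1 determinant E2.
rewrite !det_mulmx !det_lblock !det_ublock !det1 !mul1r !mulr1 => -> <-.
rewrite mulrC; congr (_ * _).
by rewrite det_mx11 !mxE eqxx mulr1n.
Qed.

Lemma qf_rank_one A u (a : R) x :
  qf (A - a *: (u^T *m u)) (x 0) = qf A (x 0) - a * (\sum_i u 0 i * x 0 i) ^+ 2.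
Proof.
have -> : (\sum_i u 0 i * x 0 i) = (x *m u^T) 0 0.
  by rewrite mxE; apply: eq_bigr => i _; rewrite mxE mulrC.
rewrite !qfE mulmxBr mulmxBl [LHS]mxE [X in _ + X = _]mxE; congr (_ - _).
rewrite -scalemxAr -scalemxAl mxE expr2; congr (_ * _).
rewrite mulmxA -(mulmxA (x *m u^T)) mxE big_ord1; congr (_ * _).
by rewrite -[u *m x^T]trmxK trmx_mul trmxK mxE.
Qed.

(* [A - 2 a u^T u >= 0] tested at [A^-1 u^T] gives [2 a u A^-1 u^T <= 1]. *)
Lemma det_rank_one_ge A u (a : R) : A^T = A -> posdef A -> 0 < a ->
  (forall x, 2 * a * (\sum_i u 0 i * x 0 i) ^+ 2 <= qf A (x 0)) ->
  \det A / 2 <= \det (A - a *: (u^T *m u)).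
Proof.
move=> sA pA a0 Hx; have dA := det_posdef sA pA.
have uA : A \in unitmx by rewrite unitmxE unitfE gt_eqF.
rewrite det_rank_one // ler_pM2l //.
set s := (u *m invmx A *m u^T) 0 0.
have sAi : (invmx A)^T = invmx A by rewrite trmx_inv sA.
have ux : \sum_i u 0 i * (u *m invmx A) 0 i = s.
  by rewrite /s mxE; apply: eq_bigr => i _; rewrite [u^T _ _]mxE mulrC.
have := Hx (u *m invmx A); rewrite ux qfE mulmxKV // trmx_mul sAi mulmxA -/s => H.
have [s0|s0] := leP s 0; first by have := mulr_ge0_le0 (ltW a0) s0; lra.
have : 2 * a * s <= 1.
  by rewrite -(ler_pM2r s0) mul1r (_ : 2 * a * s * s = 2 * a * s ^+ 2) //; ring.
by lra.
Qed.

End RankOne.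

Section ReducedLaplacian.

Variables (R : realType) (m : nat) (G : sgraph 'I_m.+1) (gamma : R) (c : 'I_m.+1).
Local Notation n := m.+1.

Hypothesis gamma_gt0 : 0 < gamma.
Hypothesis gap : forall x : 'I_n -> R,
  gamma * (\sum_j \sum_k (x j - x k) ^+ 2) <= edge_sum G (fun j k => (x j - x k) ^+ 2).

Definition redlap : 'M[R]_m := row' c (col' c (laplacian R G)).

Definition pin (x : 'I_m -> R) (v : 'I_n) : R := if unlift c v is Some i then x i else 0.

Lemma pin_center x : pin x c = 0.
Proof. by rewrite /pin unlift_none. Qed.

Lemma pin_lift x i : pin x (lift c i) = x i.
Proof. by rewrite /pin liftK. Qed.

Lemma redlap_sym : redlap^T = redlap.
Proof.
by apply/matrixP => i j; rewrite !mxE !(inj_eq lift_inj) eq_sym (adj_sym G); case: eqP => [->|].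
Qed.

Lemma qf_redlap x : qf redlap x = edge_sum G (fun j k => (pin x j - pin x k) ^+ 2) / 2.
Proof.
have := laplacian_form G (\row_j pin x j).
rewrite [in RHS](_ : edge_sum _ _ = edge_sum G (fun j k => (pin x j - pin x k) ^+ 2)); last first.
  by apply: eq_edge_sum => j k; rewrite !mxE.
move=> <-; rewrite mulrAC divff ?pnatr_eq0 // mul1r -qfE.
rewrite (@eq_qf _ _ _ _ (pin x)) => [|j]; last by rewrite mxE.
rewrite /qf (bigD1_ord c) //= [X in X + _]big1 ?add0r => [|j _]; last by rewrite pin_center mul0r mulr0.
apply: eq_bigr => i _; rewrite (bigD1_ord c) //= pin_center !mulr0 add0r.
by apply: eq_bigr => j _; rewrite !mxE !pin_lift.
Qed.

(** Of the double sum only rows [j] and [k] are kept; there each [l] contributes at least half of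
    the squared difference at [j] and [k]. This is the variance bound O(1/n) in dual form. *)
Lemma qf_redlap_ge x j k :
  gamma * n%:R / 4 * (pin x j - pin x k) ^+ 2 <= qf redlap x.
Proof.
rewrite qf_redlap; have := gap (pin x); set D := \sum_j _ => H.
suff : n%:R / 2 * (pin x j - pin x k) ^+ 2 <= D by move: gamma_gt0; nra.
have [->|jk] := eqVneq j k.
  rewrite subrr expr0n mulr0 sumr_ge0 // => i _.
  by rewrite sumr_ge0 // => l _; exact: sqr_ge0.
have D_ge : \sum_l (pin x j - pin x l) ^+ 2 + \sum_l (pin x k - pin x l) ^+ 2 <= D.
  rewrite /D [leRHS](bigD1 j) //= [X in _ <= _ + X](bigD1 k) ?[k == j]eq_sym //= addrA lerDl sumr_ge0 // => i _.
  by rewrite sumr_ge0 // => l _; exact: sqr_ge0.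
apply: le_trans D_ge; rewrite -big_split /=.
rewrite mulrAC -[n in n%:R]card_ord mulr_natl -sumr_const mulr_suml; apply: ler_sum => l _.
have : (pin x j - pin x k) ^+ 2 =
  2 * ((pin x j - pin x l) ^+ 2 + (pin x k - pin x l) ^+ 2)
    - (pin x j - pin x l + (pin x k - pin x l)) ^+ 2 by ring.
by have := sqr_ge0 (pin x j - pin x l + (pin x k - pin x l)); lra.
Qed.

Lemma posdef_redlap : posdef redlap.
Proof.
move=> x [i xi]; apply: lt_le_trans (qf_redlap_ge x (lift c i) c).
rewrite pin_lift pin_center subr0; apply: mulr_gt0; first by rewrite divr_gt0 // mulr_gt0.
by rewrite lt_def sqrf_eq0 xi sqr_ge0.
Qed.

Lemma gauss_vol_redlap :
  gauss_vol redlap = Num.sqrt ((2 * pi) ^+ m / (num_spanning_trees G)%:R).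
Proof. by rewrite /gauss_vol matrix_tree. Qed.

Lemma pinned_gaussE L : (pi / (L.*2).+1%:R) ^+ m * pinned_gauss R G L c =
  gsum (pi / (L.*2).+1%:R) L redlap.
Proof.
rewrite /gsum /pinned_gauss; congr (_ * _).
rewrite (eq_bigl (fun t : {ffun 'I_n -> 'I_(L.*2).+1} => (t c == inord L) && true)); last first.
  by move=> t; rewrite andbT.
rewrite (sum_ffun_pin c (inord L) xpredT) /=; apply: eq_bigr => t _.
rewrite /gauss_weight qf_redlap; congr expR; rewrite -mulrA -invfM -natrM; congr (- (_ / _)).
have tE v : pt (pi / (L.*2).+1%:R : R) (finsert c (inord L) t v) =
    pin (fun i => pt (pi / (L.*2).+1%:R) (t i)) v.
  by case: (unliftP c v) => [i ->|->]; rewrite ?finsert_lift ?finsert_eq ?pin_lift ?pin_center ?pt_center.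
by apply: eq_edge_sum => j k; rewrite !tE.
Qed.

(* [z ^+ 4 <= 8 / a ^+ 2 * expR (a * z ^+ 2 / 2)], and the exponential is absorbed
   by a rank-one perturbation of the quadratic form. *)
Lemma fourth_moment j k : exists2 h0 : R, 0 < h0 & forall h L, 0 < h < h0 ->
  h ^+ m * \sum_(t : {ffun 'I_m -> 'I_(L.*2).+1})
     expR (- (qf redlap (fun i => pt h (t i)) / 2)) *
     (pin (fun i => pt h (t i)) j - pin (fun i => pt h (t i)) k) ^+ 4
  <= 2048 / (gamma * n%:R) ^+ 2 * gauss_vol redlap.
Proof.
pose a := gamma * n%:R / 8.
have a0 : 0 < a by rewrite divr_gt0 // mulr_gt0.
pose u : 'rV[R]_m := \row_i ((lift c i == j)%:R - (lift c i == k)%:R).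
have uE (x : 'I_m -> R) : \sum_i u 0 i * x i = pin x j - pin x k.
  have dE v : \sum_i (lift c i == v)%:R * x i = pin x v.
    case: (unliftP c v) => [i ->|->]; rewrite ?pin_lift ?pin_center.
      rewrite (bigD1 i) //= eqxx mul1r big1 ?addr0 // => l li.
      by rewrite (inj_eq lift_inj) (negPf li) mul0r.
    by rewrite big1 // => l _; rewrite eq_sym (negPf (neq_lift c l)) mul0r.
  by rewrite -!dE -sumrB; apply: eq_bigr => i _; rewrite mxE mulrBl.
pose B := redlap - a *: (u^T *m u).
have qfB (x : 'I_m -> R) : qf B x = qf redlap x - a * (pin x j - pin x k) ^+ 2.
  have xE : (\row_i x i) 0 =1 x by move=> i; rewrite mxE.
  have qx (A : 'M[R]_m) : qf A x = qf A ((\row_i x i) 0).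
    by apply: eq_qf => i; rewrite xE.
  rewrite !qx qf_rank_one -uE; congr (_ - _ * _ ^+ 2).
  by apply: eq_bigr => i _; rewrite xE.
have aq (x : 'I_m -> R) : 2 * a * (pin x j - pin x k) ^+ 2 <= qf redlap x.
  by apply: le_trans (qf_redlap_ge x j k); rewrite le_eqVlt; apply/orP; left; apply/eqP; rewrite /a; field.
have sB : B^T = B by rewrite /B linearB linearZ /= redlap_sym trmx_mul trmxK.
have pB : posdef B.
  move=> x /posdef_redlap qx; rewrite qfB; have := aq x; lra.
have dB : \det redlap / 2 <= \det B.
  apply: det_rank_one_ge; [exact: redlap_sym | exact: posdef_redlap | exact: a0 |].
  by move=> x; rewrite uE; exact: aq.
have dr := det_posdef redlap_sym posdef_redlap.
have vB : gauss_vol B <= 2 * gauss_vol redlap.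
  have p0 : 0 < (2 * pi) ^+ m :> R by rewrite exprn_gt0 // mulr_gt0 ?pi_gt0.
  have dB0 : 0 < \det B by apply: lt_le_trans dB; rewrite divr_gt0.
  have -> : 2 * gauss_vol redlap = Num.sqrt (4 * ((2 * pi) ^+ m / \det redlap)).
    rewrite sqrtrM // (_ : 4 = 2 ^+ 2 :> R); last by ring.
    by rewrite sqrtr_sqr ger0_norm.
  rewrite /gauss_vol ler_sqrt; last by rewrite mulr_ge0 // divr_ge0 // ltW.
  rewrite mulrCA ler_pM2l //.
  rewrite -[leLHS]mul1r ler_pdivrMr // mulrAC ler_pdivlMr // mul1r.
  by lra.
have [h0 h00 Hh] := gsum_upper sB pB (ltr1n R 2).
exists h0 => // h L hh; have /andP[h_gt0 _] := hh.
apply: le_trans (_ : 8 / a ^+ 2 * gsum h L B <= _); last first.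
  have -> : 2048 / (gamma * n%:R) ^+ 2 = 8 / a ^+ 2 * 4.
    have gn0 : gamma * n%:R != 0 by rewrite gt_eqF // mulr_gt0.
    by rewrite /a; move: (gamma * n%:R) gn0 => gn gn0; field.
  rewrite -[leRHS]mulrA ler_pM2l ?divr_gt0 ?exprn_gt0 //.
  by apply: le_trans (Hh h L hh) _; lra.
rewrite /gsum mulrCA ler_pM2l ?exprn_gt0 // mulr_sumr; apply: ler_sum => t _.
set x := fun i => pt h (t i); rewrite qfB; set z := pin x j - pin x k.
have -> : - ((qf redlap x - a * z ^+ 2) / 2) = - (qf redlap x / 2) + a * z ^+ 2 / 2 by field.
rewrite expRD [leRHS]mulrCA ler_pM2l ?expR_gt0 //.
have v0 : 0 <= a * z ^+ 2 / 2 by rewrite divr_ge0 // mulr_ge0 ?sqr_ge0 // ltW.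
have := expR_ge1Dxn 1 v0; rewrite (_ : 2`!%:R = 2 :> R) // => He.
rewrite (_ : z ^+ 4 = 8 / a ^+ 2 * ((a * z ^+ 2 / 2) ^+ 2 / 2)); last first.
  by field; rewrite gt_eqF.
by rewrite ler_pM2l ?divr_gt0 ?exprn_gt0 //; lra.
Qed.

End ReducedLaplacian.

(** * Lattice points near the diagonal *)

Lemma uniform_small (R : realDomainType) (I : finType) (P : I -> R -> Prop) :
  (forall i, exists2 h0 : R, 0 < h0 & forall h, 0 < h < h0 -> P i h) ->
  exists2 h0 : R, 0 < h0 & forall i h, 0 < h < h0 -> P i h.
Proof.
move=> H; suff [h0 h00 Hh] : exists2 h0 : R, 0 < h0 &
    forall i h, i \in enum I -> 0 < h < h0 -> P i h.
  by exists h0 => // i h; apply: Hh; rewrite mem_enum.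
elim: (enum I) => [|i s [h1 h10 H1]]; first by exists 1.
have [h2 h20 H2] := H i; exists (Num.min h1 h2); first by rewrite lt_min h10.
move=> j h; rewrite inE lt_min => /predU1P[->|js] /and3P[h0 hh1 hh2].
  by apply: H2; rewrite h0.
by apply: H1 => //; rewrite h0.
Qed.

Section Core.

Variables (R : realType) (m : nat) (G : sgraph 'I_m.+1) (gamma : R).
Local Notation n := m.+1.
Local Notation redlap := (redlap R G 0).

Hypothesis gamma_gt0 : 0 < gamma.
Hypothesis gap : forall x : 'I_n -> R,
  gamma * (\sum_j \sum_k (x j - x k) ^+ 2) <= edge_sum G (fun j k => (x j - x k) ^+ 2).

Section Fixed.

Variable L : nat.
Local Notation M := (L.*2).+1.
Local Notation h := (pi / M%:R : R).
Local Notation torus := {ffun 'I_n -> 'I_M}.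
Local Notation ang t j := (pt h (t j)).
Local Notation abs_prod := (@abs_prod R m G L).
Local Notation core := (@core R m L).

Definition cos_prod (t : torus) : R := \prod_(p | edge_pair G p) cos (ang t p.1 - ang t p.2).

Lemma core_diff (t : torus) j k : t 0 = inord L -> core t -> `|ang t j - ang t k| <= 1.
Proof.
move=> t0 /forallP ct; have small i : `|ang t i| <= 1 / 2.
  rewrite -(@ler_pXn2r _ 2) ?nnegrE ?divr_ge0 // real_normK ?num_real //.
  apply: (le_trans (sqr_ang_le R i t0)).
  by rewrite (_ : (1 / 2) ^+ 2 = 4 * (1 / 16) :> R) ?ler_pM2l //; field.
by apply: le_trans (ler_normB _ _) _; have := small j; have := small k; lra.
Qed.

Lemma core_cos_ge0 (t : torus) j k : t 0 = inord L -> core t -> 0 <= cos (ang t j - ang t k).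
Proof.
move=> t0 ct; apply: cos_ge0_pihalf; rewrite -ler_norml.
by apply: le_trans (core_diff j k t0 ct) _; have := @pi_ge2 R; lra.
Qed.

Lemma core_cos_prod (t : torus) : t 0 = inord L -> core t -> cos_prod t = abs_prod t.
Proof. by move=> t0 ct; apply: eq_bigr => p _; rewrite ger0_norm // core_cos_ge0. Qed.

Lemma core_upper (t : torus) : t 0 = inord L -> core t ->
  cos_prod t <= gauss_weight G (fun k => ang t k).
Proof.
move=> t0 ct; rewrite core_cos_prod // /gauss_weight edge_sum_pairs; last first.
  by move=> j k; rewrite -opprB sqrrN.
have -> (S : R) : - (2 * S / 4) = - (S / 2) by field.
rewrite mulr_suml -sumrN expR_sum; apply: ler_prod => p _; rewrite normr_ge0 /=.
rewrite ger0_norm ?core_cos_ge0 //; apply: cos_le_gauss.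
by apply: le_trans (core_diff _ _ t0 ct) _; have := @pi_ge2 R; lra.
Qed.

Lemma ang_finsert (t : {ffun 'I_m -> 'I_M}) v :
  ang (finsert 0 (inord L) t) v = pin 0 (fun i => pt h (t i)) v.
Proof.
by case: (unliftP 0 v) => [i ->|->]; rewrite ?finsert_lift ?finsert_eq ?pin_lift ?pin_center ?pt_center.
Qed.

Lemma core_lower_pointwise (t : {ffun 'I_m -> 'I_M}) (x := fun i => pt h (t i)) :
  (forall i, `|x i| <= 1 / 4) ->
  core (finsert 0 (inord L) t) /\
  expR (- (qf redlap x / 2)) * expR (- (edge_sum G (fun j k => (pin 0 x j - pin 0 x k) ^+ 4) / 2))
    <= cos_prod (finsert 0 (inord L) t).
Proof.
move=> xs; have px v : `|pin 0 x v| <= 1 / 4.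
  by case: (unliftP 0 v) => [i ->|->]; rewrite ?pin_lift ?pin_center ?normr0 ?divr_ge0.
split.
  apply/forallP => k; rewrite (sin_dist_center R _ (finsert_eq _ _ _)) ang_finsert.
  apply: le_trans (sqr_sin_le _) _; rewrite -real_normK ?num_real //.
  rewrite (_ : 1 / 16 = (1 / 4) ^+ 2 :> R); last by field.
  by apply: lerXn2r; rewrite ?nnegrE ?divr_ge0.
rewrite qf_redlap -expRD !edge_sum_pairs; last 2 first.
- by move=> j k; rewrite -opprB !(exprM _ 2 2) sqrrN.
- by move=> j k; rewrite -opprB sqrrN.
have -> (S T : R) : - (2 * S / 2 / 2) + - (2 * T / 2) = - (S / 2 + T) by field.
rewrite mulr_suml -big_split -sumrN expR_sum; apply: ler_prod => p _.
rewrite expR_ge0 /= !ang_finsert; apply: cos_ge_gauss.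
apply: le_trans (ler_normB _ _) _.
by have := px p.1; have := px p.2; lra.
Qed.

End Fixed.

(** The Gaussian mean is taken over a box which may exceed the torus, so that its total mass is
    known from below. Removing the points with a coordinate beyond 1/4 then costs O(1/n). *)
Lemma core_lower : exists2 h0 : R, 0 < h0 & forall L, (0 < L)%N -> pi / (L.*2).+1%:R < h0 ->
  (expR (- (2048 / gamma ^+ 2)) / 2 - 256 * (2048 / gamma ^+ 2) / n%:R) * gauss_vol redlap <=
  (pi / (L.*2).+1%:R) ^+ m *
    \sum_(t : {ffun 'I_n -> 'I_(L.*2).+1} | (t 0 == inord L) && core R t) cos_prod t.
Proof.
set C := 2048 / gamma ^+ 2; have C0 : 0 < C by rewrite divr_gt0 // exprn_gt0.
have half01 : 0 < (1 / 2 : R) < 1 by lra.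
have [h2 [B [h20 B0 Hlow]]] :=
  gsum_lower (redlap_sym R G 0) (posdef_redlap 0 gamma_gt0 gap) half01.
have [h1 h10 Hmom] := uniform_small (fun p : 'I_n * 'I_n =>
  let: ex_intro2 h0 h00 H := fourth_moment 0 gamma_gt0 gap p.1 p.2 in
  ex_intro2 _ _ h0 h00 (fun h hh L => H h L hh)).
exists (Num.min h1 h2); first by rewrite lt_min h10.
move=> L L0; set h := pi / _; rewrite lt_min => /andP[hh1 hh2].
have M0 : 0 < (L.*2).+1%:R :> R by rewrite ltr0n.
have h0 : 0 < h by rewrite divr_gt0 ?pi_gt0.
have hL : 1 / 4 <= h * L%:R.
  have ME : (L.*2).+1%:R = 2 * L%:R + 1 :> R by rewrite -natr1 -muln2 natrM mulrC.
  rewrite /h mulrAC ler_pdivlMr // ME.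
  have : 1 <= L%:R :> R by rewrite ler1n.
  by have := @pi_ge2 R; nra.
(* Same mesh, but a range reaching the length [B] demanded by [gsum_lower], while the torus only
   reaches pi / 2. *)
pose L' := maxn L (Num.truncn (B / h)).+1.
have LL : (L <= L')%N by exact: leq_maxl.
have BL' : B <= h * L'%:R.
  rewrite mulrC -ler_pdivrMr //; apply: le_trans (ltW (truncnS_gt _)) _.
  by rewrite ler_nat leq_maxr.
pose w (x : 'I_m -> R) := expR (- (qf redlap x / 2)).
pose X (x : 'I_m -> R) := edge_sum G (fun j k => (pin 0 x j - pin 0 x k) ^+ 4) / 2.
pose box := {ffun 'I_m -> 'I_(L'.*2).+1}.
pose xs (t : box) i := pt h (t i).
set gv := gauss_vol redlap in Hlow Hmom *.
have gv0 : 0 < gv := gauss_vol_gt0 (redlap_sym R G 0) (posdef_redlap 0 gamma_gt0 gap).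
have hm0 : 0 < h ^+ m by rewrite exprn_gt0.
have W_ge : gv / 2 <= h ^+ m * \sum_(t : box) w (xs t).
  have := Hlow h L' _ BL'; rewrite h0 hh2 => /(_ isT); rewrite /gsum => H.
  by apply: le_trans H; lra.
have n0 : 0 < n%:R :> R by rewrite ltr0n.
have mom j k : h ^+ m * \sum_(t : box) w (xs t) * (pin 0 (xs t) j - pin 0 (xs t) k) ^+ 4 <= C / n%:R ^+ 2 * gv.
  have := Hmom (j, k) h; rewrite h0 hh1 => /(_ isT L').
  by rewrite (_ : 2048 / (gamma * n%:R) ^+ 2 = C / n%:R ^+ 2) // /C exprMn invfM mulrA.
have EX : h ^+ m * \sum_(t : box) w (xs t) * X (xs t) <= C * gv / 2.
  have -> : h ^+ m * \sum_(t : box) w (xs t) * X (xs t) =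
    edge_sum G (fun j k => h ^+ m * \sum_(t : box) w (xs t) * (pin 0 (xs t) j - pin 0 (xs t) k) ^+ 4) / 2.
    rewrite edge_sumZ -mulrA; congr (_ * _); rewrite /X /edge_sum.
    under eq_bigr do rewrite mulrA.
    rewrite -mulr_suml; congr (_ / _).
    under eq_bigr do rewrite mulr_sumr.
    rewrite exchange_big; apply: eq_bigr => j _.
    under eq_bigr do rewrite mulr_sumr.
    by rewrite exchange_big.
  rewrite ler_pM2r ?invr_gt0 //.
  apply: le_trans (_ : \sum_(j < n) \sum_(k < n) C / n%:R ^+ 2 * gv <= _).
    apply: ler_sum => j _; rewrite big_mkcond; apply: ler_sum => k _.
    case: ifP => _; first exact: mom.
    by rewrite mulr_ge0 ?divr_ge0 ?exprn_ge0 // ltW.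
  rewrite !sumr_const !card_ord -[leLHS]mulr_natl -[X in _ * X <= _]mulr_natl le_eqVlt; apply/orP; left; apply/eqP.
  by move: (n%:R : R) n0 => q q0; field; rewrite gt_eqF.
(* The tangent line of [expR] at the upper bound [C] of the mean of [X]. *)
have total : expR (- C) * (gv / 2) <= h ^+ m * \sum_(t : box) w (xs t) * expR (- X (xs t)).
  apply: le_trans (_ : h ^+ m * \sum_(t : box) w (xs t) * (expR (- C) * (1 + C - X (xs t))) <= _); last first.
    rewrite ler_pM2l //; apply: ler_sum => t _; rewrite ler_pM2l ?expR_gt0 //.
    rewrite [expR (- X (xs t))](_ : _ = expR (- C) * expR (C - X (xs t))); last first.
      by rewrite -expRD addrA addNr add0r.
    by rewrite ler_pM2l ?expR_gt0 // -addrA expR_ge1Dx.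
  have -> : h ^+ m * \sum_(t : box) w (xs t) * (expR (- C) * (1 + C - X (xs t))) =
     expR (- C) * ((1 + C) * (h ^+ m * \sum_(t : box) w (xs t)) - h ^+ m * \sum_(t : box) w (xs t) * X (xs t)).
    rewrite [(1 + C) * _]mulrCA -mulrBr mulrCA; congr (_ * _).
    by rewrite !mulr_sumr -sumrB mulr_sumr; apply: eq_bigr => t _; ring.
  by rewrite ler_pM2l ?expR_gt0 //; nra.
(* Markov's inequality for fourth powers and a union bound over the coordinates; 256 is 4^4. *)
have tail : h ^+ m * \sum_(t : box | ~~ [forall i, `|xs t i| <= 1 / 4]) w (xs t) * expR (- X (xs t))
    <= 256 * C / n%:R * gv.
  apply: le_trans (_ : h ^+ m * \sum_(t : box) \sum_i
     256 * (w (xs t) * (pin 0 (xs t) (lift 0 i) - pin 0 (xs t) 0) ^+ 4) <= _).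
    rewrite ler_pM2l // big_mkcond; apply: ler_sum => t _.
    have p0 i : 0 <= 256 * (w (xs t) * (pin 0 (xs t) (lift 0 i) - pin 0 (xs t) 0) ^+ 4).
      by apply: mulr_ge0 => //; apply: mulr_ge0; rewrite ?expR_ge0 ?exprn_even_ge0.
    case: ifP => [/forallPn [i xi]|_]; last exact: sumr_ge0.
    rewrite (bigD1 i) //= -[leLHS]addr0; apply: lerD; last exact: sumr_ge0.
    rewrite mulrCA ler_pM2l ?expR_gt0 //.
    apply: le_trans (_ : 1 <= _).
      rewrite -expR0 ler_expR oppr_le0 divr_ge0 // sumr_ge0 // => j _.
      by rewrite sumr_ge0 // => k _; rewrite exprn_even_ge0.
    rewrite pin_lift pin_center subr0 (exprM _ 2 2).
    have : (1 / 4) ^+ 2 <= xs t i ^+ 2.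
      rewrite -(real_normK (num_real (xs t i))); apply: lerXn2r; rewrite ?nnegrE ?divr_ge0 //.
      by rewrite ltW // ltNge.
    move: (xs t i ^+ 2) => y; nra.
  rewrite exchange_big mulr_sumr /=.
  apply: le_trans (_ : \sum_(i < m) 256 * (C / n%:R ^+ 2 * gv) <= _).
    by apply: ler_sum => i _; rewrite -mulr_sumr mulrCA ler_pM2l //; exact: mom.
  rewrite sumr_const card_ord -[leLHS]mulr_natl.
  apply: le_trans (_ : n%:R * (256 * (C / n%:R ^+ 2 * gv)) <= _).
    apply: ler_wpM2r; last by rewrite ler_nat.
    by apply: mulr_ge0 => //; apply: mulr_ge0; [rewrite divr_ge0 ?exprn_ge0 // ltW | exact: ltW].
  rewrite le_eqVlt; apply/orP; left; apply/eqP.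
  by move: (n%:R : R) n0 => q q0; field; rewrite gt_eqF.
pose phi x := if [forall i, `|x i| <= 1 / 4] then w x * expR (- X x) else 0.
have inner : h ^+ m * \sum_(t : box) phi (xs t) <=
    h ^+ m * \sum_(t : {ffun 'I_n -> 'I_(L.*2).+1} | (t 0 == inord L) && core R t) cos_prod t.
  rewrite ler_pM2l //.
  have -> : \sum_(t : box) phi (xs t) =
      \sum_(t : box | [forall i, (L' - L <= t i <= L' + L)%N]) phi (xs t).
    rewrite [RHS]big_mkcond; apply: eq_bigr => t _; case: ifPn => // /forallPn [i ti].
    rewrite /phi; case: ifP => // /forallP /(_ i) xi; case/negP: ti.
    move: (le_trans xi hL); rewrite /xs /pt normrM (gtr0_norm h0) ler_pM2l // ler_norml.
    by rewrite leq_subLR -!(ler_nat R) !natrD; lra.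
  rewrite -(@sum_box_restrict R L' L m phi h LL); last by move=> x y /funext ->.
  rewrite sum_ffun_pin [leRHS]big_mkcond; apply: ler_sum => t _; rewrite /phi.
  case: ifP => [/forallP xi|_]; last first.
    case: ifP => // ct; apply: prodr_ge0 => p _; apply: core_cos_ge0 ct.
    exact: finsert_eq.
  by have [-> ] := core_lower_pointwise xi.
apply: le_trans inner.
have -> : \sum_(t : box) phi (xs t) = \sum_(t : box) w (xs t) * expR (- X (xs t))
    - \sum_(t : box | ~~ [forall i, `|xs t i| <= 1 / 4]) w (xs t) * expR (- X (xs t)).
  rewrite [X in _ = X - _](bigID (fun t : box => [forall i, `|xs t i| <= 1 / 4])) /= addrK.
  by rewrite [RHS]big_mkcond.
rewrite mulrBr; apply: le_trans (lerB total tail); rewrite le_eqVlt; apply/orP; left; apply/eqP.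
by move: (expR (- C)) (n%:R : R) n0 => E q q0; field; rewrite gt_eqF.
Qed.

End Core.

(** * Asymptotic bounds *)

Section Asymptotics.

Variables (R : realType) (gamma : R).
Hypothesis gamma_gt0 : 0 < gamma.

(* [energy_cut] makes [expR (- (gamma / 8 * n * energy_cut))] beat the factor
   [spread_base ^+ n] by [expR (- n)]; [far_const] bounds [n ^+ 3 * far_rate] via
   [expR (- y) <= 24 / y ^+ 4]. *)
Definition spread_base : R := 1 + 8 / Num.sqrt gamma.
Definition energy_cut : R := 8 * (1 + spread_base) / gamma.
Definition far_const : R :=
  4 * 24 * 16 * 512 ^+ 4 * expR (9 / 2 * energy_cut + 2) / gamma ^+ 4.

Lemma far_const_gt0 : 0 < far_const.
Proof. by rewrite divr_gt0 ?exprn_gt0 // mulr_gt0 ?expR_gt0 // !mulr_gt0 // exprn_gt0. Qed.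

(** The last hypothesis is t(G) <= n^m in disguise and says s^m <= [v] for s = sqrt (2 pi / n). The
    power is at most s^m exp (n [spread_base]), and [energy_cut] leaves exp (-n) <= 2 / n^2. *)
Lemma spread_bound m (h v : R) : 0 < h ->
  2 * h <= Num.sqrt (2 * pi / (gamma * m.+1%:R / 16)) ->
  Num.sqrt ((2 * pi) ^+ m / m.+1%:R ^+ m) <= v ->
  expR (- (gamma / 8 * m.+1%:R * energy_cut)) *
    (Num.sqrt (2 * pi / (gamma * m.+1%:R / 16)) + 2 * h) ^+ m <= 2 / m.+1%:R ^+ 2 * v.
Proof.
set n := m.+1; move=> h0 hs Hv.
have n0 : 0 < n%:R :> R by rewrite ltr0n.
have p2 : 0 < 2 * pi :> R by rewrite mulr_gt0 ?pi_gt0.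
have sg0 : 0 < Num.sqrt gamma by rewrite sqrtr_gt0.
pose s : R := Num.sqrt (2 * pi / n%:R).
have s0 : 0 <= s by rewrite sqrtr_ge0.
have sE : Num.sqrt (2 * pi / (gamma * n%:R / 16)) = s * (4 / Num.sqrt gamma).
  have -> : 2 * pi / (gamma * n%:R / 16) = 2 * pi / n%:R * (4 ^+ 2 / gamma).
    by move: (n%:R : R) n0 => q q0; field; rewrite !gt_eqF.
  rewrite sqrtrM ?divr_ge0 ?ltW //; congr (_ * _).
  by rewrite sqrtrM ?sqr_ge0 // sqrtr_sqr ger0_norm // sqrtrV // ltW.
have b1 : 1 <= spread_base by rewrite lerDl divr_ge0 // ltW.
have vE : Num.sqrt ((2 * pi) ^+ m / n%:R ^+ m) = s ^+ m.
  rewrite -exprVn -exprMn /s; elim: (m) => [|k IH]; first by rewrite !expr0 sqrtr1.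
  by rewrite !exprS sqrtrM ?IH // divr_ge0 // ltW.
have pw : (Num.sqrt (2 * pi / (gamma * n%:R / 16)) + 2 * h) ^+ m <= s ^+ m * expR (spread_base *+ n).
  apply: le_trans (_ : (s * (8 / Num.sqrt gamma)) ^+ m <= _).
    apply: lerXn2r; rewrite ?nnegrE.
    - by rewrite addr_ge0 ?sqrtr_ge0 // mulr_ge0 // ltW.
    - by rewrite mulr_ge0 // divr_ge0 // ltW.
    by rewrite sE in hs *; lra.
  rewrite exprMn ler_wpM2l ?exprn_ge0 //.
  apply: le_trans (_ : spread_base ^+ m <= _).
    apply: lerXn2r; rewrite ?nnegrE ?divr_ge0 //; first exact: ltW.
      exact: (le_trans ler01 b1).
    by rewrite /spread_base lerDr.
  apply: le_trans (_ : spread_base ^+ n <= _); first by rewrite ler_weXn2l.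
  rewrite -mulr_natl expRM_natl; apply: lerXn2r; rewrite ?nnegrE ?expR_ge0 //.
    exact: (le_trans ler01 b1).
  by apply: le_trans (expR_ge1Dx _); rewrite lerDr.
apply: le_trans (ler_wpM2l (expR_ge0 _) pw) _.
rewrite mulrCA -expRD -vE mulrC.
have -> : - (gamma / 8 * n%:R * energy_cut) + spread_base *+ n = - n%:R.
  rewrite -mulr_natl /energy_cut; field; by rewrite gt_eqF.
apply: ler_pM; rewrite ?expR_ge0 ?sqrtr_ge0 //.
rewrite expRN invf_ple ?posrE ?expR_gt0 ?divr_gt0 ?exprn_gt0 // invf_div.
have := expR_ge1Dxn 1 (ltW n0); rewrite (_ : 2`!%:R = 2 :> R) //.
by lra.
Qed.

(** With T <= [far_const] / n^3, (1 + T)^n - 1 <= exp (nT) - 1 <= 2 n T, the last step because nT <=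
    1/2. *)
Lemma far_rate_bound m : (0 < m)%N -> 2 * far_const <= m.+1%:R ->
  (1 + far_rate m gamma energy_cut) ^+ m.+1 - 1 <= 2 * far_const / m.+1%:R ^+ 2.
Proof.
set n := m.+1; move=> m0 nD.
have n0 : 0 < n%:R :> R by rewrite ltr0n.
have mn : n%:R / 2 <= m%:R :> R.
  have : 1 <= m%:R :> R by rewrite ler1n.
  by rewrite /n -natr1; lra.
set T := far_rate _ _ _.
have T0 : 0 <= T by rewrite mulr_ge0 ?expR_ge0 // mulr_ge0.
have TD : T <= far_const / n%:R ^+ 3.
  rewrite /T /far_rate expRD.
  set y := gamma * m%:R / 512.
  have y_ge : gamma * (n%:R / 2) / 512 <= y by rewrite /y ler_pM2r ?invr_gt0 // ler_pM2l.
  set y' := gamma * (n%:R / 2) / 512 in y_ge.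
  have y'0 : 0 < y' by rewrite !divr_gt0 // mulr_gt0 // divr_gt0.
  have ey : expR (- y) <= 24 / y' ^+ 4.
    apply: le_trans (_ : expR (- y') <= _); first by rewrite ler_expR lerN2.
    rewrite expRN invf_ple ?posrE ?expR_gt0 ?divr_gt0 ?exprn_gt0 // invf_div.
    have := expR_ge1Dxn 3 (ltW y'0); rewrite (_ : 4`!%:R = 24 :> R) //.
    by lra.
  apply: le_trans (_ : 4 * n%:R * (expR (9 / 2 * energy_cut + 2) * (24 / y' ^+ 4)) <= _).
    by rewrite ler_pM2l ?mulr_gt0 // ler_pM2l ?expR_gt0.
  rewrite le_eqVlt; apply/orP; left; apply/eqP; rewrite /y' /far_const.
  move: (n%:R : R) n0 (expR _) => q q0 E; field.
  by rewrite !gt_eqF.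
have nT : n%:R * T <= far_const / n%:R ^+ 2.
  apply: le_trans (ler_wpM2l (ltW n0) TD) _; rewrite le_eqVlt; apply/orP; left; apply/eqP.
  by move: (n%:R : R) n0 => q q0; field; rewrite gt_eqF.
have nT2 : n%:R * T <= 1 / 2.
  apply: le_trans nT _; rewrite ler_pdivrMr ?exprn_gt0 //.
  have : 1 <= n%:R :> R by rewrite ler1n.
  have := far_const_gt0; move: (n%:R : R) n0 nD => q q0 qD; nra.
have nT0 : 0 <= n%:R * T by rewrite mulr_ge0.
apply: le_trans (_ : expR (n%:R * T) - 1 <= _).
  by rewrite lerB // expRM_natl; apply: lerXn2r; rewrite ?nnegrE ?expR_ge0 ?addr_ge0 // expR_ge1Dx.
apply: le_trans (_ : 2 * (n%:R * T) <= _); last by rewrite -mulrA ler_pM2l.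
have : expR (n%:R * T) <= (1 - n%:R * T)^-1.
  rewrite -[n%:R * T in leLHS]opprK expRN lef_pV2 ?posrE ?expR_gt0 ?expR_ge1Dx //.
  by lra.
have q0 : 0 < 1 - n%:R * T by lra.
move=> H; rewrite lerBlDl; apply: le_trans H _.
rewrite -[leLHS]mul1r ler_pdivrMr //.
by move: (n%:R * T) nT0 nT2 => q ? ?; nra.
Qed.

(** As division by 0 gives 0, t(G) = 0 would make the Gaussian volume vanish, against positive
    definiteness. *)
Lemma num_spanning_trees_gt0 m (G : sgraph 'I_m.+1) :
  (forall x : 'I_m.+1 -> R,
    gamma * (\sum_j \sum_k (x j - x k) ^+ 2) <= edge_sum G (fun j k => (x j - x k) ^+ 2)) ->
  (0 < num_spanning_trees G)%N.
Proof.
move=> gap.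
have : gauss_vol (redlap R G 0) != 0.
  by rewrite gt_eqF // gauss_vol_gt0 ?redlap_sym //; exact: posdef_redlap _ gamma_gt0 gap.
rewrite lt0n; apply: contraNneq => t0.
by rewrite gauss_vol_redlap t0 invr0 mulr0 sqrtr0.
Qed.

Lemma eulerian_bounds m (G : sgraph 'I_m.+1) :
  (forall x, ~~ odd (degree G x)) ->
  (forall x : 'I_m.+1 -> R,
    gamma * (\sum_j \sum_k (x j - x k) ^+ 2) <= edge_sum G (fun j k => (x j - x k) ^+ 2)) ->
  (0 < m)%N -> 2 * far_const <= m.+1%:R ->
  let v := Num.sqrt ((2 * pi) ^+ m / (num_spanning_trees G)%:R) in
  let err := (2 + 4 * far_const) / m.+1%:R * v in
  (expR (- (2048 / gamma ^+ 2)) / 2 - 256 * (2048 / gamma ^+ 2) / m.+1%:R) * v - err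
   <= (EO G)%:R * pi ^+ m / 2 ^+ #|edges G| <= 2 * v + err.
Proof.
move=> evenG gap m0 nD; cbv zeta.
set v := Num.sqrt _; set err := _ / m.+1%:R * v; set n := m.+1 in nD gap *.
have n0 : 0 < n%:R :> R by rewrite ltr0n.
have vE c : gauss_vol (redlap R G c) = v by exact: gauss_vol_redlap.
have v0 : 0 < v.
  by rewrite -(vE 0); apply: gauss_vol_gt0; [exact: redlap_sym | exact: posdef_redlap _ gamma_gt0 gap].
have [h1 h10 H1] := core_lower gamma_gt0 gap.
have [h2 h20 H2] := uniform_small (fun c : 'I_n =>
  let: ex_intro2 h0 h00 H := gsum_upper (redlap_sym R G c) (posdef_redlap c gamma_gt0 gap) (ltr1n R 2) in
  ex_intro2 _ _ h0 h00 (fun h hh L => H h L hh)).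
set rt := Num.sqrt (2 * pi / (gamma * n%:R / 16)).
have rt0 : 0 < rt by rewrite sqrtr_gt0 divr_gt0 ?divr_gt0 // mulr_gt0 ?pi_gt0.
pose e := Num.min (Num.min h1 h2) (rt / 2).
have e0 : 0 < e by rewrite !lt_min h10 h20 divr_gt0.
(* The first summand forces [h < e], the second [m <= L.*2]. *)
pose L := ((Num.truncn (pi / e)).+1 + m)%N.
have L0 : (0 < L)%N by rewrite /L addSn.
have mL : (m <= L.*2)%N by rewrite /L; move: (_.+1) => k; clear; lia.
set h := pi / (L.*2).+1%:R : R.
have M0 : 0 < (L.*2).+1%:R :> R by rewrite ltr0n.
have h0 : 0 < h by rewrite divr_gt0 ?pi_gt0.
have he : h < e.
  rewrite /h ltr_pdivrMr // -ltr_pdivrMl // mulrC; apply: lt_le_trans (truncnS_gt _) _.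
  by rewrite ler_nat /L; move: (Num.truncn _) => k; clear; lia.
move: (he); rewrite !lt_min => /andP[/andP[hh1 hh2] hh3].
have Z c : h ^+ m * pinned_gauss R G L c <= 2 * v.
  by rewrite pinned_gaussE -(vE c) H2 // h0.
have tr : h ^+ m * \sum_(t : {ffun 'I_n -> 'I_(L.*2).+1} | (t 0 == inord L) && ~~ core R t)
    abs_prod R G t <= err.
  apply: le_trans (tail_sum gamma_gt0 gap energy_cut L0 Z) _.
  have t_le : Num.sqrt ((2 * pi) ^+ m / n%:R ^+ m) <= v.
    have p0 : 0 < (2 * pi) ^+ m :> R by rewrite exprn_gt0 // mulr_gt0 ?pi_gt0.
    have t0 : 0 < (num_spanning_trees G)%:R :> R. by rewrite ltr0n; exact: num_spanning_trees_gt0 gap.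
    apply: ler_wsqrtr.
    rewrite ler_pM2l // lef_pV2 ?posrE ?exprn_gt0 //.
    by rewrite -natrX ler_nat; exact: num_spanning_trees_le 0.
  have hrt : 2 * h <= rt by lra.
  have sb := spread_bound h0 hrt t_le; have fb := far_rate_bound m0 nD.
  have fb2 := ler_wpM2r (ltW (mulr_gt0 (ltr0Sn R 1) v0)) fb.
  apply: le_trans (ler_wpM2l (ltW n0) (lerD sb fb2)) _.
  rewrite le_eqVlt; apply/orP; left; apply/eqP; rewrite /err.
  by move: (n%:R : R) n0 => q q0; field; rewrite gt_eqF.
have EOE : (EO G)%:R * pi ^+ m / 2 ^+ #|edges G| =
   h ^+ m * \sum_(t : {ffun 'I_n -> 'I_(L.*2).+1} | t 0 == inord L) cos_prod R G t.
  have := eulerian_fourier R 0 evenG mL.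
  rewrite -[X in _ = 2 ^+ _ * X]/(\sum_(t : {ffun 'I_n -> 'I_(L.*2).+1} | t 0 == inord L) cos_prod R G t).
  set S := \sum_(t | _) _ => E.
  have -> : pi = h * (L.*2).+1%:R :> R by rewrite divfK // gt_eqF.
  apply: (canLR (mulfK _)); first by rewrite expf_neq0 // pnatr_eq0.
  by rewrite exprMn mulrCA E -mulrA [S * _]mulrC.
rewrite EOE (bigID (core R (m := m) (L := L))) /= mulrDr.
have low := H1 L L0 hh1; rewrite vE -/h in low.
have up : h ^+ m *
   \sum_(t : {ffun 'I_n -> 'I_(L.*2).+1} | (t 0 == inord L) && core R t) cos_prod R G t <= 2 * v.
  apply: le_trans (Z 0); rewrite ler_pM2l ?exprn_gt0 // /pinned_gauss.
  rewrite big_mkcondr; apply: ler_sum => t /eqP t0; case: ifP => [ct|_]; last exact: expR_ge0.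
  exact: core_upper.
have rest : `|h ^+ m *
   \sum_(t : {ffun 'I_n -> 'I_(L.*2).+1} | (t 0 == inord L) && ~~ core R t) cos_prod R G t| <= err.
  apply: le_trans tr; rewrite normrM gtr0_norm ?exprn_gt0 // ler_pM2l ?exprn_gt0 //.
  apply: le_trans (ler_norm_sum _ _ _) _; apply: ler_sum => t _.
  by rewrite /cos_prod normr_prod.
move: rest; rewrite ler_norml => /andP[r1 r2]; apply/andP; split.
  by apply: lerD low r1.
exact: lerD up r2.
Qed.

End Asymptotics.

(** Pinning leaves [m] Gaussian variables for [m.+1] vertices, whence the stray factor sqrt 2 / sqrt
    pi. *)
Lemma asymptotic_bound_eq (R : realType) (E m : nat) (t : R) : 0 < t ->
  2 `^ (E%:R + m.+1%:R / 2) * pi `^ (- (m.+1%:R / 2)) / Num.sqrt t =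
  Num.sqrt 2 / Num.sqrt pi * (2 ^+ E * Num.sqrt ((2 * pi) ^+ m / t) / pi ^+ m).
Proof.
move=> t0; have p0 : 0 < pi :> R := pi_gt0 R.
have half (a : R) k : 0 < a -> a `^ (k%:R / 2) = Num.sqrt a ^+ k.
  by move=> a0; rewrite mulrC powRrM powR_mulrn ?powR_ge0 // powR12_sqrt // ltW.
have sqX (a : R) k : 0 <= a -> Num.sqrt (a ^+ k) = Num.sqrt a ^+ k.
  move=> a0; elim: k => [|k IH]; first by rewrite !expr0 sqrtr1.
  by rewrite !exprS sqrtrM // IH.
rewrite powRD ?pnatr_eq0 ?implybT // powR_mulrn // powRN !half //.
rewrite sqrtrM ?exprn_ge0 ?mulr_ge0 ?ltW // sqrtrV ?(ltW t0) // exprMn sqrtrM ?exprn_ge0 // !sqX ?ltW //.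
have -> : pi ^+ m = Num.sqrt pi ^+ m * Num.sqrt pi ^+ m :> R.
  by rewrite -exprMn -expr2 sqr_sqrtr // ltW.
have sp : Num.sqrt pi != 0 :> R by rewrite gt_eqF // sqrtr_gt0.
have st : Num.sqrt t != 0 by rewrite gt_eqF // sqrtr_gt0.
rewrite [Num.sqrt 2 ^+ _]exprS [Num.sqrt pi ^+ m.+1]exprS.
have : Num.sqrt pi ^+ m != 0 :> R by rewrite expf_neq0.
move: (Num.sqrt pi ^+ m : R) (Num.sqrt 2 ^+ m : R) (Num.sqrt pi : R) sp
  (Num.sqrt t) st (2 ^+ E : R) (Num.sqrt 2 : R).
by move=> a b c c0 d d0 e f a0; field; rewrite a0 c0 d0.
Qed.

Theorem theorem2p1 (R : realType) (gamma : R) (gamma_gt0 : 0 < gamma) :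
  exists (k1 k2 : R) (n0 : nat),
    [/\ 0 < k1, 0 < k2 &
      forall (n : nat) (G : sgraph 'I_n),
        (n0 <= n)%N ->
        (forall x : 'I_n, ~~ odd (degree G x)) ->
        gamma * n%:R <= algebraic_connectivity R G ->
        let bound :=
          2 `^ (#|edges G|%:R + n%:R / 2) * pi `^ (- (n%:R / 2))
            / Num.sqrt (num_spanning_trees G)%:R in
        k1 * bound <= (EO G)%:R <= k2 * bound].
Proof.
have lower (a b x v y : R) : (a + b) * v <= x / 2 * v -> (x - a) * v - b * v <= y -> x / 2 * v <= y.
  by lra.
have upper (a b v y : R) : (a + b) * v <= 1 * v -> 0 <= a * v -> y <= 2 * v + b * v -> y <= 3 * v.
  by lra.
have p0 : 0 < pi :> R := pi_gt0 R.
have sp0 : 0 < Num.sqrt pi :> R by rewrite sqrtr_gt0.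
have s20 : 0 < Num.sqrt 2 :> R by rewrite sqrtr_gt0.
pose C := 2048 / gamma ^+ 2; have C0 : 0 < C by rewrite divr_gt0 // exprn_gt0.
pose c := expR (- C) / 2; have c0 : 0 < c by rewrite divr_gt0 ?expR_gt0.
have c20 : 0 < c / 2 by rewrite divr_gt0.
pose D := far_const gamma; have D0 : 0 < D := far_const_gt0 gamma_gt0.
pose B := 256 * C + (2 + 4 * D).
have B0 : 0 < B by rewrite /B; lra.
(* For n >= [Q] the error [B / n] is at most both [c / 2] and 1, and [2 * D <= n] as
   [eulerian_bounds] requires. *)
pose Q := B / (c / 2) + B + 2 * D.
(* The 3 is the factor 2 of the Gaussian upper bound plus an error of at most 1. One successor
   rounds [Q] up, the other ensures [0 < m]. *)
exists (c / 2 * (Num.sqrt pi / Num.sqrt 2)), (3 * (Num.sqrt pi / Num.sqrt 2)), (Num.truncn Q).+2.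
split; [by apply: mulr_gt0; apply: divr_gt0 | by apply: mulr_gt0 => //; apply: divr_gt0 |].
move=> [//|m] G nQ evenG gap; cbv zeta.
have n0 : 0 < m.+1%:R :> R by rewrite ltr0n.
have Qn : Q <= m.+1%:R.
  by apply: le_trans (ltW (truncnS_gt _)) _; rewrite ler_nat ltnW.
have m0 : (0 < m)%N by case: (m) nQ.
have Bc : B / m.+1%:R <= c / 2.
  rewrite ler_pdivrMr // [leRHS]mulrC -ler_pdivrMr //; apply: le_trans _ Qn.
  by rewrite /Q; lra.
have B1 : B / m.+1%:R <= 1.
  rewrite ler_pdivrMr // mul1r; apply: le_trans _ Qn.
  by have : 0 < B / (c / 2) := divr_gt0 B0 c20; rewrite /Q; lra.
have Dn : 2 * D <= m.+1%:R.
  apply: le_trans _ Qn.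
  by have : 0 < B / (c / 2) := divr_gt0 B0 c20; rewrite /Q; lra.
have gap' := spectral_gap gamma_gt0 gap.
have t0 : 0 < (num_spanning_trees G)%:R :> R.
  by rewrite ltr0n; exact: (num_spanning_trees_gt0 gamma_gt0 gap').
have := eulerian_bounds gamma_gt0 evenG gap' m0 Dn; cbv zeta.
rewrite asymptotic_bound_eq // -/C -/D.
set v := Num.sqrt _; set X := _ * pi ^+ m / _.
have v0 : 0 <= v by exact: sqrtr_ge0.
have pm0 : 0 < pi ^+ m :> R by rewrite exprn_gt0.
have E0 : 0 < 2 ^+ #|edges G| :> R by rewrite exprn_gt0.
have EOE : (EO G)%:R = X * (2 ^+ #|edges G| / pi ^+ m).
  by rewrite /X mulrA divfK ?gt_eqF // mulfK // gt_eqF.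
have kE k : k * (Num.sqrt pi / Num.sqrt 2) * (Num.sqrt 2 / Num.sqrt pi *
    (2 ^+ #|edges G| * v / pi ^+ m)) = k * v * (2 ^+ #|edges G| / pi ^+ m).
  move: (Num.sqrt pi : R) sp0 (Num.sqrt 2 : R) s20 (pi ^+ m : R) pm0 (2 ^+ #|edges G| : R).
  by move=> a a0 b b0 d d0 e; field; rewrite !gt_eqF.
rewrite !kE EOE !ler_pM2r ?divr_gt0 // => /andP[lo hi].
have Bv := ler_wpM2r v0 Bc; have Bv' := ler_wpM2r v0 B1.
have BE : B / m.+1%:R = 256 * C / m.+1%:R + (2 + 4 * D) / m.+1%:R by rewrite -mulrDl.
rewrite BE in Bv Bv'.
have Cn : 0 <= 256 * C / m.+1%:R * v.
  by apply: mulr_ge0 => //; rewrite divr_ge0 // mulr_ge0 // ltW.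
apply/andP; split; first exact: lower Bv lo.
exact: upper Bv' Cn hi.
Qed.
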